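(* Let $E$ be a finite graph without sinks or sources in which every cycle has an exit, let $k\ge1$, and let $\tau,\tau'\in\mathrm{Perm}(E^k)$ be endpoint-fixing permutations such that $(E_\tau,\mathcal{L}_\tau)$ and $(E_{\tau'},\mathcal{L}_{\tau'})$ are synchronizing in the first label. Then the statement (6) $(O_\tau,\mathcal{L}_{O_\tau})=(O_{\tau'},\mathcal{L}_{O_{\tau'}})$ is equivalent to each of the following (mutually equivalent) statements: (1) $\mathsf{X}_{(E_\tau,\mathcal{L}_\tau)}=\mathsf{X}_{(E_{\tau'},\mathcal{L}_{\tau'})}$. (2) There exists an endpoint-fixing $\pi\in\mathrm{Perm}(E^{k-1})$ such that $\tau'=g_\pi(\tau)$. (3) There exists an endpoint-fixing $\pi\in\mathrm{Perm}(E^{k-1})$ such that $\mathrm{Ad}(U_\pi)\circ\lambda_\tau=\lambda_{\tau'}$. (4) $\phi_{T_\tau}=\phi_{T_{\tau'}}$. (5) $\phi_\tau=\phi_{\tau'}$.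
   Context: A graph means a directed multigraph $E=(E^0,E^1,r,s)$. $E^l$ is the set of paths of length $l$ (length-0 paths are vertices), $E^l_{u\to v}$ those with source $u$ and range $v$. A cycle $\mu$ has an exit if some $s(\mu_i)$ emits at least two edges. $\mathsf{X}_E$ (resp. $\mathsf{X}_E^+$) is the set of bi-infinite paths (resp. infinite paths $x_1x_2\cdots$) in $E$. $C^*(E)$ is the universal $C^*$-algebra generated by mutually orthogonal projections $\{P_v\}_{v\in E^0}$ and partial isometries $\{S_e\}_{e\in E^1}$ with $S_e^*S_e=P_{r(e)}$, $S_e^*S_f=0$ for $e\ne f$, $S_eS_e^*\le P_{s(e)}$, and $P_v=\sum_{s(e)=v}S_eS_e^*$ for $v$ emitting a nonzero finite number of edges. $S_\mu=S_{\mu_1}\cdots S_{\mu_l}$, $S_v=P_v$ for a vertex, $P_\mu=S_\mu S_\mu^*$. $\mathcal{D}_E$ is the $C^*$-subalgebra generated by all $P_\mu$. A permutation $\tau$ of $E^l$ is endpoint-fixing if $\tau(E^l_{u\to v})=E^l_{u\to v}$ for all $u,v$; then $U_\tau=\sum_{\alpha\in E^l}S_{\tau(\alpha)}S_\alpha^*$ is unitary, and $\lambda_\tau$ is the unital $*$-endomorphism with $\lambda_\tau(S_e)=U_\tau S_e$. $\mathrm{Ad}(U)(x)=UxU^*$. For endpoint-fixing $\tau\in\mathrm{Perm}(E^k)$, the permutation graph $(E_\tau,\mathcal{L}_\tau)$ has vertex set $E_\tau^0=E^{k-1}$, edge set $E_\tau^1=E^k$, and each $\mu=e\alpha\in E^k$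 with $\tau(e\alpha)=\beta f$ ($e,f\in E^1$, $\alpha,\beta\in E^{k-1}$) is an edge with source $s_\tau(\mu)=\beta$, range $r_\tau(\mu)=\alpha$, first label $\mathcal{L}_1(\mu)=e$, second label $\mathcal{L}_2(\mu)=f$, $\mathcal{L}_\tau(\mu)=[e,f]$; write $\mu\colon\beta\xrightarrow{e,f}\alpha$. It is synchronizing in the first label if there is $m$ such that any two paths in $E_\tau$ of length $m$ with equal $\mathcal{L}_1$-labels have equal source. $\mathsf{X}_{(E_\tau,\mathcal{L}_\tau)}$ is the set of $\mathcal{L}_\tau$-labels of bi-infinite paths in $E_\tau$. For endpoint-fixing $\tau\in\mathrm{Perm}(E^k)$ and $\pi\in\mathrm{Perm}(E^{k-1})$, $g_\pi(\tau)$ is the endpoint-fixing permutation of $E^k$ with $g_\pi(\tau)(e\,\pi(\alpha))=\pi(\beta)f$ whenever $\tau(e\alpha)=\beta f$. Let $\phi_1,\phi_2\colon\mathsf{X}_{E_\tau}\to\mathsf{X}_E$ apply $\mathcal{L}_1$, resp. $\mathcal{L}_2$, to each edge. When $(E_\tau,\mathcal{L}_\tau)$ is synchronizing in the first label, $\phi_1$ is bijective; put $\phi_{T_\tau}=\phi_2\circ\phi_1^{-1}$ (the map coded by the textile system $T_\tau$ associated with the permutation graph). In that case also $\lambda_\tau$ restricts to an automorphism of $\mathcal{D}_E$; identifying $z\in\mathsf{X}_E^+$ with the character $\phi_z$ of $\mathcal{D}_E$ given by $\phi_z(P_\mu)=1$ if $\mu$ is a prefix of $z$ and $0$ otherwise,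 the induced map $\phi_\tau^+\colon\mathsf{X}_E^+\to\mathsf{X}_E^+$ is given by $\phi_{\phi_\tau^+(x)}=\phi_x\circ(\lambda_\tau|_{\mathcal{D}_E})^{-1}$, and the induced two-sided map $\phi_\tau\colon\mathsf{X}_E\to\mathsf{X}_E$ by $\phi_\tau(x)_m=\lim_{n\to\infty}\phi_\tau^+(x_{-n}x_{-n+1}\cdots)_{m+n+1}$ (eventually constant; one-sided sequences are indexed from 1). Ordered permutation graph. Fix a strict total order on $E^0$ and a strict total order on $E^1$ such that $e<f$ whenever $s(e)<s(f)$, or $s(e)=s(f)$ and $r(e)<r(f)$. For $\alpha\in E_\tau^0$ let $M_\tau(\alpha)=e_1r(f_1)e_2r(f_2)\cdots$ be the lexicographically minimal sequence for which there is an infinite path $\alpha\xrightarrow{e_1,f_1}\alpha_1\xrightarrow{e_2,f_2}\alpha_2\cdots$ in $(E_\tau,\mathcal{L}_\tau)$. For an edge $\mu\colon\beta\xrightarrow{e,f}\alpha$ let $M_\tau^1(\mu)=e\,r(f)\,M_\tau(\alpha)$. Order vertices (edges) of $E_\tau$ by lexicographic order of $M_\tau$ (resp. $M^1_\tau$); these are strict total orders when $(E_\tau,\mathcal{L}_\tau)$ is synchronizing in the first label. Let $O_{u\to v}=\{o^i_{u\to v}:0\le i<|E^{k-1}_{u\to v}|\}$, $O^0=\bigcup_{u,v}O_{u\to v}$ (disjoint), $O^1=\{\mu_0,\dots,\mu_{|E^k|-1}\}$ be fixed sets of symbols. Let $\omega^0_\tau\colon E_\tau^0\to O^0$ send the $i$-th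 smallest element (counting from 0) of $E^{k-1}_{u\to v}$ to $o^i_{u\to v}$, and $\omega^1_\tau\colon O^1\to E^1_\tau$ send $\mu_i$ to the $i$-th smallest edge (counting from 0). Then $(O_\tau,\mathcal{L}_{O_\tau})$ has vertex set $O^0$, edge set $O^1$, source map $\omega^0_\tau\circ s_\tau\circ\omega^1_\tau$, range map $\omega^0_\tau\circ r_\tau\circ\omega^1_\tau$, and labeling $\mathcal{L}_{O_\tau}=\mathcal{L}_\tau\circ\omega^1_\tau$. *)

(* Defs.v *)
From HB Require Import structures.
From mathcomp Require Import all_boot all_order all_algebra perm.
From mathcomp Require Import all_classical all_reals topology normedtype.
From mathcomp Require Import complex.

Set Implicit Arguments.
Unset Strict Implicit.
Unset Printing Implicit Defensive.

Import Order.TTheory GRing.Theory Num.Theory numFieldNormedType.Exports.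

Local Open Scope classical_set_scope.
Local Open Scope ring_scope.

Record graph (V W : Type) := Graph { src : W -> V; rng : W -> V }.

Record lgraph (V W L : Type) := LGraph {
  lgraph_graph :> graph V W;
  lab : W -> L
}.

Section Paths.
Variables (V W : finType) (E : graph V W).

Fixpoint walk (v : V) (s : seq W) : bool :=
  if s is e :: q then (src E e == v) && walk (rng E e) q else true.

(* A path is recorded together with its source, so that paths of length 0 are
   exactly the vertices. *)
Record gpath (l : nat) := GPath {
  gpath_val : V * l.-tuple W;
  gpath_walk : walk gpath_val.1 gpath_val.2
}.

HB.instance Definition _ l := [isSub for @gpath_val l].
HB.instance Definition _ l := [Finite of gpath l by <:].

Definition psrc l (p : gpath l) : V := (val p).1.
Definition edges l (p : gpath l) : l.-tuple W := (val p).2.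
Definition prng l (p : gpath l) : V := last (psrc p) (map (rng E) (edges p)).

Definition paths_between l (uv : V * V) : {set gpath l} :=
  [set p | (psrc p == uv.1) && (prng p == uv.2)].

Definition endpoint_fixing l (t : {perm gpath l}) : Prop :=
  forall u v, [set t p | p in paths_between l (u, v)]%SET
              = paths_between l (u, v).

Definition no_sinks : Prop := forall v, exists e, src E e = v.
Definition no_sources : Prop := forall v, exists e, rng E e = v.

Definition cycles_have_exits : Prop :=
  forall l (mu : gpath l.+1), psrc mu = prng mu ->
    exists2 e, e \in edges mu & (2 <= #|[pred f | src E f == src E e]|)%N.

Definition ipaths : set (nat -> W) :=
  [set x | forall i, rng E (x i) = src E (x i.+1)].
Definition bipaths : set (int -> W) :=
  [set x | forall i, rng E (x i) = src E (x (i + 1))].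

Definition is_prefix l (mu : gpath l) (z : nat -> W) : bool :=
  (psrc mu == src E (z 0%N)) && (tval (edges mu) == mkseq z l).

(* The two ways of cutting a path of length k.+1: as e alpha, with
   [e = first_edge mu], [alpha = path_tail mu], and as beta f, with
   [beta = path_front mu], [f = last_edge mu]. *)
Section Cut.
Variables (k : nat) (mu : gpath k.+1).

Definition first_edge : W := thead (edges mu).
Definition last_edge : W := tnth (edges mu) ord_max.

Lemma path_tail_subproof :
  walk (rng E first_edge, [tuple of behead (edges mu)]).1
       (rng E first_edge, [tuple of behead (edges mu)]).2.
Proof.
rewrite /first_edge /edges; case: mu => -[v t] /=.
by case/tupleP: t => e t /=; rewrite theadE => /andP[].
Qed.

Definition path_tail : gpath k := GPath path_tail_subproof.

Lemma walk_belast v e q : walk v (e :: q) -> walk v (belast e q).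
Proof.
by elim: q v e => //= f q IH v e /andP[-> /IH].
Qed.

Lemma path_front_subproof :
  let t := [tuple of belast first_edge [tuple of behead (edges mu)]] in
  walk (psrc mu, t).1 (psrc mu, t).2.
Proof.
rewrite /first_edge /edges /psrc; case: mu => -[v t] /=.
by case/tupleP: t => e t; rewrite theadE; exact: walk_belast.
Qed.

Definition path_front : gpath k := GPath path_front_subproof.

End Cut.

End Paths.

Definition label_shift (V W : finType) (L : Type) (G : lgraph V W L) :
    set (int -> L) :=
  [set lab G \o y | y in bipaths G].

Definition synchronizing_fst (V W : finType) (L1 L2 : Type)
    (G : lgraph V W (L1 * L2)) : Prop :=
  exists m : nat, forall p q : gpath G m,
    [seq (lab G e).1 | e <- edges p] = [seq (lab G e).1 | e <- edges q] ->
    psrc p = psrc q.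

Section PermutationGraph.
Variables (V W : finType) (E : graph V W) (k : nat).

Definition perm_graph (t : {perm gpath E k.+1}) :
    lgraph (gpath E k) (gpath E k.+1) (W * W) :=
  LGraph
    (Graph (fun mu => path_front (t mu)) (fun mu => path_tail mu))
    (fun mu => (first_edge mu, last_edge (t mu))).

(* [s (e (pi alpha)) = (pi beta) f] whenever [t (e alpha) = beta f], with
   [mu = e alpha] and [nu = e (pi alpha)]. *)
Definition g_spec (pi : {perm gpath E k}) (t s : {perm gpath E k.+1}) : Prop :=
  forall mu nu, first_edge nu = first_edge mu ->
    path_tail nu = pi (path_tail mu) ->
    path_front (s nu) = pi (path_front (t mu)) /\
    last_edge (s nu) = last_edge (t mu).

(* [xget d X] is used here and below as "the element of X"; the default d only
   matters if X is empty. *)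
Definition g_perm (pi : {perm gpath E k}) (t : {perm gpath E k.+1}) :
    {perm gpath E k.+1} :=
  xget t [set s | endpoint_fixing s /\ g_spec pi t s].

(* The map coded by the textile system of [t]: [phi_2 \o phi_1^-1], where
   [phi_i] applies the i-th label to every edge. *)
Definition textile_map (t : {perm gpath E k.+1}) (x : int -> W) : int -> W :=
  let G := perm_graph t in
  let phi1 (y : int -> gpath E k.+1) := fun i => (lab G (y i)).1 in
  let phi2 (y : int -> gpath E k.+1) := fun i => (lab G (y i)).2 in
  xget x [set phi2 y | y in bipaths G `&` [set y | phi1 y = x]].

End PermutationGraph.

Definition strict_total_order (T : eqType) (r : rel T) : Prop :=
  [/\ irreflexive r, transitive r & forall x y, x != y -> r x y || r y x].

Definition compatible_orders (V W : finType) (E : graph V W)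
    (ltV : rel V) (ltW : rel W) : Prop :=
  forall e f, ltV (src E e) (src E f) \/
              (src E e = src E f /\ ltV (rng E e) (rng E f)) -> ltW e f.

Section OrderedPermutationGraph.
Variables (V W : finType) (E : graph V W) (ltV : rel V) (ltW : rel W).
Variables (k : nat) (t : {perm gpath E k.+1}).

Let G := perm_graph t.

(* A sequence e_1 r(f_1) e_2 r(f_2) ... is encoded as the sequence of the
   pairs (e_i, r(f_i)). *)
Definition lt_pair (a b : W * V) : bool :=
  ltW a.1 b.1 || ((a.1 == b.1) && ltV a.2 b.2).

Definition lexlt (m m' : nat -> W * V) : Prop :=
  exists i, (forall j, (j < i)%N -> m j = m' j) /\ lt_pair (m i) (m' i).

Definition code (mu : gpath E k.+1) : W * V := ((lab G mu).1, rng E (lab G mu).2).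

Definition codes_from (a : gpath E k) : set (nat -> W * V) :=
  [set code \o y | y in ipaths G `&` [set y | src G (y 0%N) = a]].

(* [is_M a m] : m is the sequence M(a); [is_M1 mu m] : m is M^1(mu). *)
Definition is_M (a : gpath E k) (m : nat -> W * V) : Prop :=
  codes_from a m /\ forall m', codes_from a m' -> ~ lexlt m' m.

Definition is_M1 (mu : gpath E k.+1) (m : nat -> W * V) : Prop :=
  m 0%N = code mu /\ is_M (rng G mu) (fun i => m i.+1).

Definition lt_vertex (a b : gpath E k) : Prop :=
  exists m m', [/\ is_M a m, is_M b m' & lexlt m m'].

Definition lt_edge (mu nu : gpath E k.+1) : Prop :=
  exists m m', [/\ is_M1 mu m, is_M1 nu m' & lexlt m m'].

Definition le_vertex : rel (gpath E k) := fun a b => (a == b) || `[< lt_vertex a b >].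
Definition le_edge : rel (gpath E k.+1) := fun a b => (a == b) || `[< lt_edge a b >].

(* The symbols o^i_{u -> v} and mu_i. *)
Definition Overtex : finType := {uv : V * V & 'I_#|paths_between E k uv|}.
Definition Oedge : finType := 'I_#|{: gpath E k.+1}|.

Lemma vertex_rank_subproof (a : gpath E k) :
  (index a (sort le_vertex (enum (paths_between E k (psrc a, prng a))))
   < #|paths_between E k (psrc a, prng a)|)%N.
Proof.
rewrite [ltnRHS]cardE -(size_sort le_vertex) index_mem mem_sort mem_enum.
by rewrite inE /= !eqxx.
Qed.

Definition omega0 (a : gpath E k) : Overtex :=
  Tagged (fun uv => 'I_#|paths_between E k uv|)
    (Ordinal (vertex_rank_subproof a)).

Definition omega1 (i : Oedge) : gpath E k.+1 :=
  tnth [tuple of sort le_edge (enum_tuple {: gpath E k.+1})] i.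

Definition ordered_perm_graph : lgraph Overtex Oedge (W * W) :=
  LGraph
    (Graph (omega0 \o src G \o omega1) (omega0 \o rng G \o omega1))
    (lab G \o omega1).

End OrderedPermutationGraph.

(* Not necessarily unital; the multiplication is therefore not that of a
   mathcomp ring. *)
HB.mixin Record isCstarAlgebra (R : realType) A
    of CompleteNormedModule R[i] A := {
  cmul : A -> A -> A;
  adj : A -> A;
  cmulA : associative cmul;
  cmulDl : left_distributive cmul +%R;
  cmulDr : right_distributive cmul +%R;
  cscalerAl : forall (c : R[i]) (x y : A), cmul (c *: x) y = c *: cmul x y;
  cscalerAr : forall (c : R[i]) (x y : A), cmul x (c *: y) = c *: cmul x y;
  cnormM : forall x y : A, `|cmul x y| <= `|x| * `|y|;
  adjK : involutive adj;
  adjD : {morph adj : x y / x + y};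
  adjZ : forall (c : R[i]) (x : A), adj (c *: x) = c^* *: adj x;
  adjM : forall x y : A, adj (cmul x y) = cmul (adj y) (adj x);
  cstar_identity : forall x : A, `|cmul (adj x) x| = `|x| ^+ 2
}.

#[short(type="cstarType")]
HB.structure Definition CstarAlgebra (R : realType) :=
  { A of CompleteNormedModule R[i] A & isCstarAlgebra R A }.

Declare Scope cstar_scope.
Delimit Scope cstar_scope with cstar.
Notation "x ** y" := (cmul x y) (at level 40, left associativity) : cstar_scope.
Local Open Scope cstar_scope.

Section CstarTheory.
Variables (R : realType) (A B : cstarType R).

Definition star_hom (f : A -> B) : Prop :=
  [/\ linear f, forall x y, f (x ** y) = f x ** f y
    & forall x, f (adj x) = adj (f x)].

Definition is_cstar_subalgebra (D : set A) : Prop :=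
  closed D /\
  [/\ D 0, forall x y, D x -> D y -> D (x + y),
      forall (c : R[i]) x, D x -> D (c *: x),
      forall x y, D x -> D y -> D (x ** y) & forall x, D x -> D (adj x)].

Definition cstar_generated (X : set A) : set A := smallest is_cstar_subalgebra X.

(* A character of the subalgebra D; its values outside D are irrelevant. *)
Definition is_character (D : set A) (chi : A -> R[i]) : Prop :=
  [/\ forall (c : R[i]) x y, D x -> D y -> chi (c *: x + y) = c * chi x + chi y,
      forall x y, D x -> D y -> chi (x ** y) = chi x * chi y,
      forall x, D x -> chi (adj x) = (chi x)^*
    & exists2 x, D x & chi x != 0].

Definition is_projection (p : A) : Prop := adj p = p /\ p ** p = p.
Definition is_partial_isometry (s : A) : Prop := s ** adj s ** s = s.

Definition cstar_le (a b : A) : Prop := exists c, b - a = adj c ** c.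

End CstarTheory.

Section CuntzKrieger.
Variables (R : realType) (V W : finType) (E : graph V W) (A : cstarType R).
Variables (P : V -> A) (S : W -> A).

Definition cuntz_krieger : Prop :=
  [/\ (forall v, is_projection (P v)) /\ (forall u v, u != v -> P u ** P v = 0),
      forall e, is_partial_isometry (S e),
      (forall e, adj (S e) ** S e = P (rng E e)) /\
      (forall e f, e != f -> adj (S e) ** S f = 0),
      forall e, cstar_le (S e ** adj (S e)) (P (src E e))
    & forall v, (exists e, src E e = v) ->
        P v = \sum_(e | src E e == v) S e ** adj (S e)].

End CuntzKrieger.

(* A is C*(E), with canonical generators P and S: the C*-algebra generated by a
   Cuntz-Krieger E-family and universal among such. *)
Definition is_graph_cstar (R : realType) (V W : finType) (E : graph V W)
    (A : cstarType R) (P : V -> A) (S : W -> A) : Prop :=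
  [/\ cuntz_krieger E P S,
      cstar_generated (range P `|` range S) = setT
    & forall (B : cstarType R) (Q : V -> B) (T : W -> B),
        cuntz_krieger E Q T ->
        exists f : A -> B, [/\ star_hom f, forall v, f (P v) = Q v
                             & forall e, f (S e) = T e]].

Section GraphAlgebra.
Variables (R : realType) (V W : finType) (E : graph V W) (A : cstarType R).
Variables (P : V -> A) (S : W -> A).

Fixpoint S_walk (v : V) (s : seq W) : A :=
  if s is e :: q then (if q is [::] then S e else S e ** S_walk (rng E e) q)
  else P v.

Definition S_path l (mu : gpath E l) : A := S_walk (psrc mu) (edges mu).
Definition P_path l (mu : gpath E l) : A := S_path mu ** adj (S_path mu).

Definition diagonal : set A :=
  cstar_generated [set a | exists l (mu : gpath E l), a = P_path mu].

Definition U_perm l (t : {perm gpath E l}) : A :=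
  \sum_(a : gpath E l) S_path (t a) ** adj (S_path a).

Definition Ad (u x : A) : A := u ** x ** adj u.

(* The unit of C*(E) is the sum of the vertex projections, as E has finitely
   many vertices. *)
Definition cstar_one : A := \sum_(v : V) P v.

Definition lambda l (t : {perm gpath E l}) : A -> A :=
  xget (fun x : A => x) [set f | [/\ star_hom f, f cstar_one = cstar_one
                     & forall e, f (S e) = U_perm t ** S e]].

Definition lambda_diag_inv l (t : {perm gpath E l}) (d : A) : A :=
  xget d [set d' | diagonal d' /\ lambda t d' = d].

Definition path_character (z : nat -> W) : A -> R[i] :=
  xget (fun=> 0)
    [set chi | is_character diagonal chi /\
       forall l (mu : gpath E l), chi (P_path mu) = (is_prefix mu z)%:R].

Definition phi_plus l (t : {perm gpath E l}) (x : nat -> W) : nat -> W :=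
  xget x [set y | ipaths E y /\ forall d, diagonal d ->
            path_character y d = path_character x (lambda_diag_inv t d)].

(* Here one-sided sequences are indexed from 0, so that x_m is at position m + n
   in x_{-n} x_{-n+1} ...; the absolute value is harmless, as m + n >= 0 for
   large n. *)
Definition phi_two_sided l (t : {perm gpath E l}) (x : int -> W) : int -> W :=
  fun m => xget (x m)
    [set e : W | \forall n \near \oo,
       phi_plus t (fun j : nat => x (j%:Z - n%:Z)) (absz (m + n%:Z)) = e].

End GraphAlgebra.

(* Main.v *)
(* Write [G] for the permutation graph of [t].  In [G] the first label and the
   range determine an edge, and so do the source and the second label.  Hence,
   if [G] is synchronizing in the first label, every path of [E] is the first
   label of exactly one path of [G], the label shift is the graph of the map
   coded by [t], and a vertex of [G] can be recovered from the labels of any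
   bi-infinite path through it: from the future by synchronization, from the
   past by synchronizing earlier and following the second labels.  Matching
   vertices with the same label sequences turns equality of label shifts into
   the conjugating permutation [pi].

   On the algebra side, [lambda t (S_e) S_alpha = S_beta S_f] for every edge
   from [beta] to [alpha] labelled [e, f].  This identity gives the action of
   [Ad (U_pi)] on endomorphisms, and shows that for an infinite path of [G]
   with initial vertex [b] and labels [e_0, f_0], [e_1, f_1], ... the character
   of [b f_0 f_1 ...] composed with [lambda t] is the character of
   [e_0 e_1 ...]; so the two-sided map induced by [lambda t] is the map coded
   by [t], delayed by [k].  Characters and nonvanishing of the vertex
   projections come from the representation of C*(E) on l2 of the space of
   infinite paths; uniqueness statements rest on automatic continuity of
   *-homomorphisms, which needs no spectral theory because a self-adjoint
   element of norm at most 1/2 is half the sum of two unitaries. *)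
Require Import Defs.
From HB Require Import structures.
From mathcomp Require Import all_boot all_order all_algebra perm.
From mathcomp Require Import all_classical all_reals topology normedtype.
From mathcomp Require Import complex.
From mathcomp Require Import ereal esum sequences finmap ring lra zify.

Set Implicit Arguments.
Unset Strict Implicit.
Unset Printing Implicit Defensive.

Import Order.TTheory GRing.Theory Num.Theory numFieldNormedType.Exports.

Local Open Scope classical_set_scope.
Local Open Scope ring_scope.

(** * Unordered sums and the Hilbert space l2 *)

(** Most maps in the statements are selected by [xget], so existence, and uniqueness where the value
    matters, must be proved: for [textile_map] by unique lifting, for [lambda] by universality and
    continuity, for [phi_plus] by separating paths with cylinder projections. The inverse of
    [lambda] on the diagonal is the costly one: surjectivity is visible only on cylinder
    projections, and passing to limits needs closed range. The estimate [|x| <= 6 * |lambda x|]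
    supplies it, by bounding norms on the diagonal through the values of path characters, a Gelfand
    formula up to a constant; sharp constants are nowhere needed. As C*(E) is known only by its
    universal property, a concrete C*-algebra of operators has to be built before any vertex
    projection is known to be nonzero. The ordered graphs enter through [pi]: it gives an
    isomorphism that keeps labels and endpoints, hence minimal words and ranks. Conversely an
    ordered graph is its permutation graph with vertices and edges renamed, so it has the same label
    shift. *)

Section UnorderedSums.
Variables (R : realType) (X : choiceType).
Implicit Types (f g p q : X -> R).

Definition rsummable g : Prop := (\esum_(x in [set: X]) `|g x|%:E < +oo)%E.
(* [fine] makes the sum of a non-summable family the junk value 0. *)
Definition psum g : R := fine (\esum_(x in [set: X]) (g x)%:E)%E.
Definition rsum g : R :=
  psum (fun x => Num.max (g x) 0) - psum (fun x => Num.max (- g x) 0).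

Lemma rsummable_le g p : (forall x, `|g x| <= p x) -> rsummable p -> rsummable g.
Proof.
move=> gp; apply: le_lt_trans; apply: le_esum => x _.
by rewrite lee_fin (le_trans (gp x)) ?ler_norm.
Qed.

Lemma rsummableD f g : rsummable f -> rsummable g -> rsummable (fun x => f x + g x).
Proof.
move=> sf sg; apply: (@rsummable_le _ (fun x => `|f x| + `|g x|)) => [x|].
  exact: ler_normD.
rewrite /rsummable (eq_esum (b := fun x => `|f x|%:E + `|g x|%:E)%E); last first.
  by move=> x _; rewrite ger0_norm ?addr_ge0 ?EFinD.
by rewrite esumD ?lte_add_pinfty // => x _; rewrite lee_fin.
Qed.

Lemma psum_esum p : (forall x, 0 <= p x) -> rsummable p ->
  (\esum_(x in [set: X]) (p x)%:E = (psum p)%:E)%E.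
Proof.
move=> p0; rewrite /rsummable (eq_esum (b := fun x => (p x)%:E)); last first.
  by move=> x _; rewrite ger0_norm.
by move=> sp; rewrite fineK // ge0_fin_numE // esum_ge0 // => x _; rewrite lee_fin.
Qed.

Lemma psumD p q : (forall x, 0 <= p x) -> (forall x, 0 <= q x) ->
  rsummable p -> rsummable q -> psum (fun x => p x + q x) = psum p + psum q.
Proof.
move=> p0 q0 sp sq; apply: EFin_inj.
rewrite EFinD -!psum_esum //; first last.
- exact: rsummableD.
- by move=> x; rewrite addr_ge0.
by rewrite -esumD // => x _; rewrite lee_fin.
Qed.

Lemma psum_ge_fin p (F : {fset X}) : (forall x, 0 <= p x) -> rsummable p ->
  \sum_(x <- F) p x <= psum p.
Proof.
move=> p0 sp; rewrite -lee_fin -psum_esum //; apply: esum_ge.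
exists [set` F]; first by split => //; exact: finite_fset.
by rewrite fsbig_finite //= set_fsetK sumEFin.
Qed.

Lemma psum_ge0 p : (forall x, 0 <= p x) -> 0 <= psum p.
Proof. by move=> p0; rewrite fine_ge0 // esum_ge0 // => x _; rewrite lee_fin. Qed.

Lemma psum_le_fin p M : (forall x, 0 <= p x) ->
  (forall F : {fset X}, \sum_(x <- F) p x <= M) -> rsummable p /\ psum p <= M.
Proof.
move=> p0 pM.
have le : (\esum_(x in [set: X]) (p x)%:E <= M%:E)%E.
  apply: ge_ereal_sup => _ [F [finF _] <-].
  by rewrite fsbig_finite //= sumEFin lee_fin.
have sp : rsummable p.
  rewrite /rsummable (eq_esum (b := fun x => (p x)%:E)); last first.
    by move=> x _; rewrite ger0_norm.
  exact: le_lt_trans le (ltry _).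
by split => //; rewrite -lee_fin -psum_esum.
Qed.

Lemma rsummable_norm g : rsummable g -> rsummable (fun x => `|g x|).
Proof. by rewrite /rsummable; under eq_esum => x _ do rewrite -normr_id. Qed.

Lemma rsummable_max0 g : rsummable g -> rsummable (fun x => Num.max (g x) 0).
Proof.
move=> /rsummable_norm; apply: rsummable_le => x.
by rewrite ger0_norm ?le_max ?lexx ?orbT // ge_max ler_norm normr_ge0.
Qed.

Lemma rsummableN g : rsummable g -> rsummable (fun x => - g x).
Proof. by move=> /rsummable_norm; apply: rsummable_le => x; rewrite normrN. Qed.

(** Crossing terms, the positive part of [g] plus [q] equals its negative part plus [p], so
    additivity of [psum] suffices. This freedom in the decomposition reduces additivity and
    homogeneity of [rsum] to nonnegative families. *)
Lemma rsum_sub g p q : (forall x, 0 <= p x) -> (forall x, 0 <= q x) ->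
  rsummable p -> rsummable q -> (forall x, g x = p x - q x) ->
  rsum g = psum p - psum q.
Proof.
move=> p0 q0 sp sq gE.
have sg : rsummable g.
  rewrite (_ : g = fun x => p x + - q x); last exact/funext.
  by apply: rsummableD => //; exact: rsummableN.
apply/eqP; rewrite /rsum subr_eq addrAC eq_sym subr_eq eq_sym; apply/eqP.
rewrite -!psumD //; first last.
- exact: rsummable_max0.
- by move=> x; rewrite le_max lexx orbT.
- exact/rsummable_max0/rsummableN.
- by move=> x; rewrite le_max lexx orbT.
congr psum; apply/funext => x; rewrite gE !maxEle opprB !subr_le0.
by case: (leP (p x) (q x)) => h1; case: (leP (q x) (p x)) => h2; lra.
Qed.

Lemma max0_subE (a : R) : a = Num.max a 0 - Num.max (- a) 0.
Proof. by rewrite !maxEle oppr_le0; do 2 case: leP => ?; lra. Qed.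

Lemma rsumD f g : rsummable f -> rsummable g ->
  rsum (fun x => f x + g x) = rsum f + rsum g.
Proof.
move=> sf sg.
have m0 h x : 0 <= Num.max (h x) (0 : R) by rewrite le_max lexx orbT.
have sm h : rsummable h -> rsummable (fun x => Num.max (- h x) 0).
  by move=> sh; exact/rsummable_max0/rsummableN.
rewrite (@rsum_sub _ (fun x => Num.max (f x) 0 + Num.max (g x) 0)
    (fun x => Num.max (- f x) 0 + Num.max (- g x) 0)); first last.
- by move=> x; rewrite [f x in LHS]max0_subE [g x in LHS]max0_subE; ring.
- by apply: rsummableD; exact: sm.
- by apply: rsummableD; exact: rsummable_max0.
- by move=> x; rewrite addr_ge0 ?(m0 (fun x => - _ x)).
- by move=> x; rewrite addr_ge0.
rewrite psumD ?psumD //; try exact: rsummable_max0; try exact: sm.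
by rewrite /rsum; ring.
Qed.

Lemma rsum_psum g : (forall x, 0 <= g x) -> rsummable g -> rsum g = psum g.
Proof.
move=> g0 sg; rewrite (@rsum_sub g g (fun=> 0)) //; last first.
- by move=> x; rewrite subr0.
- by rewrite /rsummable esum1 // => x _; rewrite normr0.
by rewrite /psum [X in _ - fine X]esum1 // subr0.
Qed.

Lemma rsumN g : rsummable g -> rsum (fun x => - g x) = - rsum g.
Proof.
move=> sg; rewrite /rsum opprB; congr (_ - _).
by congr psum; apply/funext => x; rewrite opprK.
Qed.

Lemma rsummableZ c g : rsummable g -> rsummable (fun x => c * g x).
Proof.
move=> sg.
have [] := @psum_le_fin (fun x => `|c * g x|) (`|c| * psum (fun x => `|g x|)).
- by move=> x.
- move=> F; under eq_bigr do rewrite normrM.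
  by rewrite -mulr_sumr ler_wpM2l // psum_ge_fin //; exact: rsummable_norm.
by rewrite /rsummable; under eq_esum => x _ do rewrite normr_id.
Qed.

Lemma rsumZ c g : rsummable g -> rsum (fun x => c * g x) = c * rsum g.
Proof.
have half (a : R) p : 0 <= a -> (forall x, 0 <= p x) -> rsummable p ->
    psum (fun x => a * p x) <= a * psum p.
  move=> a0 p0 sp; have [] // := @psum_le_fin (fun x => a * p x) (a * psum p).
  - by move=> x; rewrite mulr_ge0.
  - by move=> F; rewrite -mulr_sumr ler_wpM2l // psum_ge_fin.
(* The reverse inequality is [half] applied to [a^-1] and the family [a * p]. *)
have pos (a : R) p : 0 <= a -> (forall x, 0 <= p x) -> rsummable p ->
    psum (fun x => a * p x) = a * psum p.
  move=> a0 p0 sp; apply/eqP; rewrite eq_le half //=.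
  have [->|an0] := eqVneq a 0; first by rewrite mul0r psum_ge0 // => x; rewrite mul0r.
  rewrite -ler_pdivlMl ?lt_def ?an0 //.
  apply: le_trans (half _ _ _ _ _); last 3 first.
  - by rewrite invr_ge0.
  - by move=> x; rewrite mulr_ge0.
  - exact: rsummableZ.
  by rewrite le_eqVlt; apply/orP; left; apply/eqP; congr psum; apply/funext => x; rewrite mulKf.
have m0 h x : 0 <= Num.max (h x) (0 : R) by rewrite le_max lexx orbT.
have posr a f : 0 <= a -> rsummable f -> rsum (fun x => a * f x) = a * rsum f.
  move=> a0 sf; have sNf := rsummableN sf.
  rewrite (@rsum_sub _ (fun x => a * Num.max (f x) 0) (fun x => a * Num.max (- f x) 0)).
  - rewrite !pos ?mulrBr //; try exact: rsummable_max0.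
  - by move=> x; rewrite mulr_ge0.
  - by move=> x; rewrite mulr_ge0 // (m0 (fun x => - f x)).
  - exact/rsummableZ/rsummable_max0.
  - exact/rsummableZ/rsummable_max0.
  - by move=> x; rewrite [f x in LHS]max0_subE mulrBr.
move=> sg; have [c0|/ltW c0] := leP 0 c; first exact: posr.
rewrite -[c]opprK mulNr -posr ?oppr_ge0 // -rsumN; last exact: rsummableZ.
by congr rsum; apply/funext => x; rewrite mulNr.
Qed.

(** Only the supports have to correspond, because shift maps on path space are bijections between
    proper subsets. *)
Lemma esum_reindex (D D' : set X) (e : X -> X) (f g : X -> \bar R) : set_bij D D' e ->
  (forall x, D x -> f x = g (e x)) ->
  (forall x, ~ D x -> f x = 0%E) -> (forall x, ~ D' x -> g x = 0%E) ->
  (\esum_(x in [set: X]) f x = \esum_(x in [set: X]) g x)%E.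
Proof.
move=> eb fg f0 g0; transitivity (\esum_(x in D) f x)%E.
  rewrite [RHS]esum_mkcond; apply: eq_esum => x _; case: ifPn => //.
  by rewrite notin_setE => /f0.
transitivity (\esum_(x in D') g x)%E; last first.
  rewrite [LHS]esum_mkcond; apply: eq_esum => x _; case: ifPn => //.
  by rewrite notin_setE => /g0 ->.
by rewrite (reindex_esum D D' e) //; apply: eq_esum.
Qed.

Lemma rsum_reindex (D D' : set X) (e : X -> X) f g : set_bij D D' e ->
  (forall x, D x -> f x = g (e x)) ->
  (forall x, ~ D x -> f x = 0) -> (forall x, ~ D' x -> g x = 0) ->
  rsum f = rsum g.
Proof.
move=> eb fg f0 g0; rewrite /rsum /psum; congr (fine _ - fine _);
  by apply: (esum_reindex eb) => x h; rewrite ?(fg _ h) ?(f0 _ h) ?(g0 _ h) ?oppr0 ?maxxx.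
Qed.

Lemma rsummable_reindex (D D' : set X) (e : X -> X) f g : set_bij D D' e ->
  (forall x, D x -> f x = g (e x)) ->
  (forall x, ~ D x -> f x = 0) -> (forall x, ~ D' x -> g x = 0) ->
  rsummable g -> rsummable f.
Proof.
move=> eb fg f0 g0; rewrite /rsummable; apply: le_lt_trans; rewrite le_eqVlt; apply/orP; left.
apply/eqP; apply: (esum_reindex eb) => x h;
  by rewrite ?(fg _ h) ?(f0 _ h) ?(g0 _ h) ?normr0.
Qed.

Lemma psum_le p q : (forall x, 0 <= p x <= q x) -> rsummable q -> psum p <= psum q.
Proof.
move=> pq sq; have p0 x : 0 <= p x by have /andP[] := pq x.
have [] // := @psum_le_fin p (psum q) p0 => F.
apply: le_trans (psum_ge_fin F _ sq); last first.
  by move=> x; have /andP[/le_trans] := pq x; apply.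
by apply: ler_sum => x _; have /andP[] := pq x.
Qed.

End UnorderedSums.

Section L2.
Variables (R : realType) (X : choiceType).
Local Notation C := R[i].
Implicit Types (f g : X -> C).

Definition sqn (z : C) : R := complex.Re z ^+ 2 + complex.Im z ^+ 2.

Definition ell2 : {pred X -> C} := [pred f | `[< rsummable (fun x => sqn (f x)) >]].

Lemma ell2P f : reflect (rsummable (fun x => sqn (f x))) (f \in ell2).
Proof. exact: asboolP. Qed.

Lemma sqn_ge0 z : 0 <= sqn z.
Proof. by rewrite addr_ge0 ?sqr_ge0. Qed.

Lemma sqnM z w : sqn (z * w) = sqn z * sqn w.
Proof. by case: z w => a b [c d]; rewrite /sqn /=; ring. Qed.

Lemma sqnD z w : sqn (z + w) <= 2 * sqn z + 2 * sqn w.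
Proof.
case: z w => a b [c d]; rewrite /sqn /= -subr_ge0.
(* Parallelogram identity: the difference of the two sides is [sqn (z - w)]. *)
rewrite [leRHS](_ : _ = (a - c) ^+ 2 + (b - d) ^+ 2); last by ring.
by rewrite addr_ge0 ?sqr_ge0.
Qed.

Lemma ell2_submod : GRing.submod_closed ell2.
Proof.
split.
  apply/ell2P; rewrite /rsummable esum1 // => x _.
  by rewrite /sqn /= expr0n addr0 normr0.
move=> a f g /ell2P sf /ell2P sg; apply/ell2P.
apply: rsummable_le (rsummableD (rsummableZ (2 * sqn a) sf) (rsummableZ 2 sg)).
move=> x; rewrite ger0_norm ?sqn_ge0 //.
by apply: le_trans (sqnD _ _) _; rewrite /GRing.scale /= sqnM mulrA.
Qed.

HB.instance Definition _ := GRing.isSubmodClosed.Build C (X -> C) ell2 ell2_submod.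

Record l2 := L2 { l2_val :> X -> C; l2_valP : l2_val \in ell2 }.
HB.instance Definition _ := [isSub for l2_val].
HB.instance Definition _ := [Choice of l2 by <:].
HB.instance Definition _ := [SubChoice_isSubLmodule of l2 by <:].

End L2.

Section InnerProduct.
Variables (R : realType) (X : choiceType).
Local Notation C := R[i].
Local Notation l2 := (l2 R X).
Implicit Types f g h : l2.

Lemma l2_ext (f g : l2) : (forall x, f x = g x) -> f = g.
Proof. by move=> fg; apply/val_inj/funext. Qed.

Lemma l2ZDE a (f g : l2) x : (a *: f + g) x = a * f x + g x.
Proof. by []. Qed.
Lemma l2DE (f g : l2) x : (f + g) x = f x + g x.
Proof. by []. Qed.
Lemma l2BE (f g : l2) x : (f - g) x = f x - g x.
Proof. by []. Qed.
Lemma l2ZE a (f : l2) x : (a *: f) x = a * f x.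
Proof. by []. Qed.
Lemma l20E x : (0 : l2) x = 0.
Proof. by []. Qed.

Definition dot (z w : C) : R := complex.Re z * complex.Re w + complex.Im z * complex.Im w.

(* The real part of the inner product; together with complex linearity it
   carries the same information. *)
Definition ip (f g : l2) : R := rsum (fun x => dot (f x) (g x)).

Lemma dotzz z : dot z z = sqn z.
Proof. by rewrite /dot /sqn !expr2. Qed.

Lemma dot_summable (f g : l2) : rsummable (fun x => dot (f x) (g x)).
Proof.
have /ell2P sf := l2_valP f; have /ell2P sg := l2_valP g.
apply: rsummable_le (rsummableD sf sg) => x.
move: (f x) (g x) => [a b] [c d]; rewrite /dot /sqn /= ler_norml; apply/andP; split.
  rewrite -subr_ge0 [leRHS](_ : _ = ((a + c) ^+ 2 + (b + d) ^+ 2 +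
    (a ^+ 2 + b ^+ 2 + c ^+ 2 + d ^+ 2)) / 2); last by field.
  by rewrite divr_ge0 ?addr_ge0 ?sqr_ge0.
rewrite -subr_ge0 [leRHS](_ : _ = ((a - c) ^+ 2 + (b - d) ^+ 2 +
    (a ^+ 2 + b ^+ 2 + c ^+ 2 + d ^+ 2)) / 2); last by field.
by rewrite divr_ge0 ?addr_ge0 ?sqr_ge0.
Qed.

Lemma ipC f g : ip f g = ip g f.
Proof. by congr rsum; apply/funext => x; rewrite /dot; ring. Qed.

Lemma ipDl f g h : ip (f + g) h = ip f h + ip g h.
Proof.
rewrite -rsumD; [|exact: dot_summable|exact: dot_summable].
congr rsum; apply/funext => x; rewrite l2DE.
by move: (f x) (g x) (h x) => [a b] [c d] [u v]; rewrite /dot /=; ring.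
Qed.

Lemma ipZ (a : C) f g : ip (a *: f) g = ip f (a^* *: g).
Proof.
congr rsum; apply/funext => x; rewrite !l2ZE.
by move: (f x) (g x) a => [a b] [c d] [u v]; rewrite /dot /=; ring.
Qed.

Lemma ipZr (a : R) f g : ip (a%:C%C *: f) g = a * ip f g.
Proof.
rewrite -rsumZ; last exact: dot_summable.
congr rsum; apply/funext => x; rewrite !l2ZE.
by move: (f x) (g x) => [u b] [c d]; rewrite /dot /=; ring.
Qed.

Lemma ipDr f g h : ip f (g + h) = ip f g + ip f h.
Proof. by rewrite ipC ipDl ![ip _ f]ipC. Qed.

Lemma ipZrr (a : R) f g : ip f (a%:C%C *: g) = a * ip f g.
Proof. by rewrite ipC ipZr ipC. Qed.

Lemma ip_psum f : ip f f = psum (fun x => sqn (f x)).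
Proof.
rewrite /ip rsum_psum; last exact: dot_summable.
- by congr psum; apply/funext => x; rewrite dotzz.
- by move=> x; rewrite dotzz sqn_ge0.
Qed.

Lemma ip_ge0 f : 0 <= ip f f.
Proof. by rewrite ip_psum psum_ge0 // => x; exact: sqn_ge0. Qed.

Lemma ip_ge_fin f (F : {fset X}) : \sum_(x <- F) sqn (f x) <= ip f f.
Proof.
rewrite ip_psum psum_ge_fin //; first by move=> x; exact: sqn_ge0.
exact/ell2P/l2_valP.
Qed.

Lemma sqn_le_ip f x : sqn (f x) <= ip f f.
Proof. by have := ip_ge_fin f [fset x]%fset; rewrite big_seq_fset1. Qed.

Lemma sqn_eq0 (z : C) : sqn z <= 0 -> z = 0.
Proof.
case: z => a b; rewrite /sqn /= => h.
have a0 := sqr_ge0 a; have b0 := sqr_ge0 b.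
have -> : a = 0 by apply/eqP; rewrite -sqrf_eq0; apply/eqP; lra.
by have -> : b = 0 by apply/eqP; rewrite -sqrf_eq0; apply/eqP; lra.
Qed.

Lemma ip_eq0 f : ip f f <= 0 -> f = 0.
Proof. by move=> h; apply: l2_ext => x; apply: sqn_eq0 (le_trans (sqn_le_ip f x) h). Qed.

Lemma ip0l f : ip 0 f = 0.
Proof. by rewrite -(scale0r f) (ipZr 0) mul0r. Qed.

Lemma ipNl f g : ip (- f) g = - ip f g.
Proof. by apply/eqP; rewrite -addr_eq0 -ipDl addNr ip0l. Qed.

Lemma ip_uniq g h : (forall f, ip f g = ip f h) -> g = h.
Proof.
move=> gh; apply/eqP; rewrite -subr_eq0; apply/eqP/ip_eq0.
by rewrite ipDr -scaleN1r -[-1](rmorphN1 (real_complex R)) ipZrr gh mulN1r subrr.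
Qed.

Lemma cauchy_schwarz f g : ip f g ^+ 2 <= ip f f * ip g g.
Proof.
have q t : 0 <= ip f f + 2 * t * ip f g + t ^+ 2 * ip g g.
  have := ip_ge0 (f + t%:C%C *: g); rewrite ipDl !ipDr !ipZr !ipZrr [ip g f]ipC.
  by congr (0 <= _); ring.
have [g0|gn0] := eqVneq (ip g g) 0.
  have -> : g = 0 by apply: ip_eq0; rewrite g0.
  by rewrite ipC !ip0l expr0n mulr0.
have gp : 0 < ip g g by rewrite lt_def gn0 ip_ge0.
(* This value of [t] minimizes the quadratic polynomial in [q]. *)
have := q (- ip f g / ip g g).
rewrite -(ler_pM2r gp) mul0r.
have -> : (ip f f + 2 * (- ip f g / ip g g) * ip f g +
   (- ip f g / ip g g) ^+ 2 * ip g g) * ip g g = ip f f * ip g g - ip f g ^+ 2.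
  by field.
by rewrite subr_ge0.
Qed.

Definition hn f : R := Num.sqrt (ip f f).

Lemma hn_ge0 f : 0 <= hn f. Proof. exact: sqrtr_ge0. Qed.

Lemma sqr_hn f : hn f ^+ 2 = ip f f.
Proof. by rewrite sqr_sqrtr // ip_ge0. Qed.

Lemma ip_le_hn f g : ip f g <= hn f * hn g.
Proof.
apply: le_trans (ler_norm _) _; rewrite -(@ler_pXn2r _ 2) ?nnegrE ?mulr_ge0 ?hn_ge0 //.
by rewrite exprMn !sqr_hn real_normK ?num_real // cauchy_schwarz.
Qed.

Lemma hn_le f M : 0 <= M -> ip f f <= M ^+ 2 -> hn f <= M.
Proof. by move=> M0; rewrite -sqr_hn ler_pXn2r ?nnegrE ?hn_ge0. Qed.

Lemma hnN f : hn (- f) = hn f.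
Proof. by rewrite /hn ipNl ipC ipNl opprK. Qed.

Lemma ipNr f g : ip f (- g) = - ip f g.
Proof. by rewrite ipC ipNl ipC. Qed.

Lemma ip_abs_le_hn f g : `|ip f g| <= hn f * hn g.
Proof.
by rewrite ler_norml ip_le_hn andbT lerNl -ipNl; apply: le_trans (ip_le_hn _ _) _; rewrite hnN.
Qed.

Lemma hnD f g : hn (f + g) <= hn f + hn g.
Proof.
apply: hn_le; first by rewrite addr_ge0 ?hn_ge0.
rewrite ipDl !ipDr [ip g f]ipC sqrrD !sqr_hn.
by have := ip_le_hn f g; lra.
Qed.

Lemma hnZ (a : C) f : hn (a *: f) = complex.Re `|a| * hn f.
Proof.
rewrite /hn ipZ scalerA.
have -> : a^* * a = (sqn a)%:C%C.
  by case: a => u v; rewrite /sqn; apply/eqP; rewrite eq_complex /=; apply/andP; split; apply/eqP; ring.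
rewrite ipC ipZr sqrtrM ?sqn_ge0 // normc_def; congr (_ * _).
Qed.

Lemma hn0 : hn 0 = 0. Proof. by rewrite /hn ip0l sqrtr0. Qed.

Lemma hn_eq0 f : hn f = 0 -> f = 0.
Proof. by move=> h; apply: ip_eq0; rewrite -sqr_hn h expr0n. Qed.


Lemma normc_le_hn f x : `|f x| <= (hn f)%:C%C.
Proof.
rewrite normc_def lecR; apply: ler_wsqrtr; exact: sqn_le_ip.
Qed.

End InnerProduct.

(** * The C*-algebra of bounded operators on l2 *)

Section BoundedOperators.
Variables (R : realType) (X : choiceType).
Local Notation C := R[i].
Local Notation l2 := (l2 R X).
Implicit Types (f g h : l2).

(** Asking for an adjoint in the definition replaces the Riesz representation theorem; in return
    sums, products and limits must each come with an adjoint. *)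
Definition bounded_op : {pred l2 -> l2} := [pred T | `[<
  [/\ linear T, exists T' : l2 -> l2, forall f g, ip (T f) g = ip f (T' g)
    & exists2 M, 0 <= M & forall f, hn (T f) <= M * hn f] >]].

Lemma bounded_opP (T : l2 -> l2) : reflect
  [/\ linear T, exists T' : l2 -> l2, forall f g, ip (T f) g = ip f (T' g)
    & exists2 M, 0 <= M & forall f, hn (T f) <= M * hn f] (T \in bounded_op).
Proof. exact: asboolP. Qed.

Lemma bounded_op_submod : GRing.submod_closed bounded_op.
Proof.
split.
  apply/bounded_opP; split.
  - by move=> a f g; rewrite /= scaler0 addr0.
  - by exists (fun=> 0) => f g; rewrite /= ip0l ipC ip0l.
  - by exists 0 => // f; rewrite /= hn0 mul0r.
move=> a S T /bounded_opP[linS [S' SE] [M M0 SM]] /bounded_opP[linT [T' TE] [N N0 TN]].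
have E f : (a *: S + T) f = a *: S f + T f by [].
apply/bounded_opP; split.
- move=> b f g; rewrite !E linS linT !scalerDr !scalerA [a * b]mulrC.
  by rewrite addrACA.
- exists (fun g => S' (a^* *: g) + T' g) => f g.
  by rewrite ipDr -SE -TE E ipDl ipZ.
- exists (complex.Re `|a| * M + N).
    by rewrite addr_ge0 // mulr_ge0 // normc_def /= sqrtr_ge0.
  move=> f; rewrite E; apply: le_trans (hnD _ _) _.
  rewrite mulrDl lerD // hnZ -mulrA ler_wpM2l //.
  by rewrite normc_def /= sqrtr_ge0.
Qed.

HB.instance Definition _ :=
  GRing.isSubmodClosed.Build C (l2 -> l2) bounded_op bounded_op_submod.

Record bop := Bop { bop_val :> l2 -> l2; bop_valP : bop_val \in bounded_op }.
HB.instance Definition _ := [isSub for bop_val].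
HB.instance Definition _ := [Choice of bop by <:].
HB.instance Definition _ := [SubChoice_isSubLmodule of bop by <:].

Implicit Types (S T : bop).

Lemma bop_ext S T : (forall f, S f = T f) -> S = T.
Proof. by move=> ST; apply/val_inj/funext. Qed.

Lemma bopP T : [/\ linear T, exists T' : l2 -> l2, forall f g, ip (T f) g = ip f (T' g)
    & exists2 M, 0 <= M & forall f, hn (T f) <= M * hn f].
Proof. exact/bounded_opP/bop_valP. Qed.

Lemma bop_linear T : linear T. Proof. by case: (bopP T). Qed.
HB.instance Definition _ T := GRing.isLinear.Build C l2 l2 *:%R T (bop_linear T).

Lemma bop_scale T a f : T (a *: f) = a *: T f.
Proof. exact: linearZ. Qed.

Lemma bopDE S T f : (S + T) f = S f + T f. Proof. by []. Qed.
Lemma bopBE S T f : (S - T) f = S f - T f. Proof. by []. Qed.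
Lemma bopZE a T f : (a *: T) f = a *: T f. Proof. by []. Qed.
Lemma bop0E f : (0 : bop) f = 0. Proof. by []. Qed.

Definition opn T : R := sup [set hn (T f) | f in [set f | hn f <= 1]].

Lemma opn_sup T : has_sup [set hn (T f) | f in [set f | hn f <= 1]].
Proof.
split; first by exists (hn (T 0)); exists 0 => //=; rewrite hn0.
have [_ _ [M M0 TM]] := bopP T; exists M => _ [f /= f1 <-].
by apply: le_trans (TM f) _; rewrite -[leRHS]mulr1 ler_wpM2l.
Qed.

Lemma opn_ge0 T : 0 <= opn T.
Proof.
apply: le_trans (sup_ubound (opn_sup T).2 _); last by exists 0 => //=; rewrite hn0.
exact: hn_ge0.
Qed.

Lemma hn_gt0 f : f != 0 -> 0 < hn f.
Proof.
by move=> f0; rewrite lt_def hn_ge0 andbT; apply: contraNneq f0 => /hn_eq0 ->.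
Qed.

Lemma Re_normR (a : R) : complex.Re `|a%:C%C : C| = `|a|.
Proof. by rewrite normc_def /= expr0n addr0 sqrtr_sqr. Qed.

Lemma hn_bop T f : hn (T f) <= opn T * hn f.
Proof.
have [->|f0] := eqVneq f 0; first by rewrite linear0 hn0 mulr0.
have hf := hn_gt0 f0.
rewrite -ler_pdivrMr //; apply: (sup_ubound (opn_sup T).2).
exists ((hn f)^-1%:C%C *: f) => /=.
  by rewrite hnZ Re_normR ger0_norm ?invr_ge0 ?hn_ge0 // mulVf // gt_eqF.
by rewrite linearZ /= hnZ Re_normR ger0_norm ?invr_ge0 ?hn_ge0 // mulrC.
Qed.

Lemma opn_le T M : 0 <= M -> (forall f, hn (T f) <= M * hn f) -> opn T <= M.
Proof.
move=> M0 TM; apply: ge_sup; first by case: (opn_sup T).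
move=> _ [f /= f1 <-]; apply: le_trans (TM f) _.
by rewrite -[leRHS]mulr1 ler_wpM2l.
Qed.

Lemma opnD S T : (opn (S + T))%:C%C <= (opn S)%:C%C + (opn T)%:C%C :> C.
Proof.
rewrite -rmorphD lecR; apply: opn_le; first by rewrite addr_ge0 ?opn_ge0.
by move=> f; apply: le_trans (hnD _ _) _; rewrite mulrDl lerD ?hn_bop.
Qed.

Lemma opn_eq0 T : (opn T)%:C%C = 0 :> C -> T = 0.
Proof.
move=> [T0]; apply: bop_ext => f; apply: hn_eq0; apply/eqP.
by rewrite eq_le hn_ge0 andbT -(mul0r (hn f)) -T0 hn_bop.
Qed.

Lemma Re_norm_ge0 (a : C) : 0 <= complex.Re `|a|.
Proof. by rewrite normc_def sqrtr_ge0. Qed.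

Lemma opnZ (a : C) T : (opn (a *: T))%:C%C = `|a| * (opn T)%:C%C :> C.
Proof.
have aE (b : C) : `|b| = (complex.Re `|b|)%:C%C by rewrite normc_def.
have half (b : C) S : opn (b *: S) <= complex.Re `|b| * opn S.
  apply: opn_le => [|f]; first by rewrite mulr_ge0 ?opn_ge0 ?Re_norm_ge0.
  by rewrite hnZ -mulrA ler_wpM2l ?hn_bop ?Re_norm_ge0.
rewrite aE -rmorphM; congr (_%:C%C); apply/eqP; rewrite eq_le half andTb.
have [->|a0] := eqVneq a 0; first by rewrite normr0 mul0r opn_ge0.
rewrite -ler_pdivlMl; last first.
  by rewrite -ltcR -aE normr_gt0.
apply: le_trans (_ : opn (a^-1 *: (a *: T)) <= _); first by rewrite scalerA mulVf // scale1r.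
apply: le_trans (half _ _) _; rewrite ler_wpM2r ?opn_ge0 //.
by rewrite -lecR -aE normfV aE -fmorphV.
Qed.

HB.instance Definition _ := Lmodule_isNormed.Build C bop opnD opnZ opn_eq0.

Lemma bop_normE T : `|T| = (opn T)%:C%C. Proof. by []. Qed.

End BoundedOperators.

Section OperatorAlgebra.
Variables (R : realType) (X : choiceType).
Local Notation C := R[i].
Local Notation l2 := (l2 R X).
Local Notation bop := (bop R X).
Implicit Types (f g h : l2) (S T : bop).

(** Nondegeneracy of [ip] forces linearity. The bound comes from
    [ip (T' f) (T' f) = ip (T (T' f)) f] and Cauchy-Schwarz, after division by [hn (T' f)]. *)
Lemma adjoint_bounded T (T' : l2 -> l2) : (forall f g, ip (T f) g = ip f (T' g)) ->
  T' \in @bounded_op R X.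
Proof.
move=> TE; apply/bounded_opP; split.
- move=> a f g; apply: ip_uniq => h.
  rewrite ipDr -!TE -[a]conjCK -ipZ ipDr -ipZ; congr (_ + _).
  by rewrite -linearZ /= -TE.
- by exists T => f g; rewrite ipC -TE ipC.
- exists (opn T); first exact: opn_ge0.
  move=> f; have [->|T'f] := eqVneq (hn (T' f)) 0; first by rewrite mulr_ge0 ?opn_ge0 ?hn_ge0.
  have T'0 : 0 < hn (T' f) by rewrite lt_def T'f hn_ge0.
  rewrite -(ler_pM2l T'0) -expr2 sqr_hn -TE; apply: le_trans (ip_le_hn _ _) _.
  by apply: le_trans (ler_wpM2r (hn_ge0 _) (hn_bop T _)) _; rewrite mulrAC mulrC mulrA.
Qed.

Lemma bop_adj_exists T : exists T' : bop, forall f g, ip (T f) g = ip f (T' g).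
Proof.
have [_ [T' TE] _] := bopP T.
by exists (Bop (adjoint_bounded TE)).
Qed.

Definition bop_adj T : bop := projT1 (cid (bop_adj_exists T)).

Lemma bop_adjE T f g : ip (T f) g = ip f (bop_adj T g).
Proof. by rewrite /bop_adj; case: cid. Qed.

Lemma bop_adj_uniq T S : (forall f g, ip (T f) g = ip f (S g)) -> bop_adj T = S.
Proof.
by move=> TS; apply: bop_ext => g; apply: ip_uniq => f; rewrite -bop_adjE.
Qed.

Lemma bop_mul_bounded S T : S \o T \in @bounded_op R X.
Proof.
apply/bounded_opP; split.
- by move=> a f g /=; rewrite !linearP.
- by exists (bop_adj T \o bop_adj S) => f g /=; rewrite -!bop_adjE.
- exists (opn S * opn T); first by rewrite mulr_ge0 ?opn_ge0.
  move=> f /=; apply: le_trans (hn_bop _ _) _.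
  by rewrite -mulrA ler_wpM2l ?opn_ge0 ?hn_bop.
Qed.

Definition bop_mul S T : bop := Bop (bop_mul_bounded S T).

Lemma bop_mulE S T f : bop_mul S T f = S (T f). Proof. by []. Qed.

Lemma opn_adj_le T : opn (bop_adj T) <= opn T.
Proof.
apply: opn_le; first exact: opn_ge0.
move=> f; have [->|T'f] := eqVneq (hn (bop_adj T f)) 0.
  by rewrite mulr_ge0 ?opn_ge0 ?hn_ge0.
have T'0 : 0 < hn (bop_adj T f) by rewrite lt_def T'f hn_ge0.
rewrite -(ler_pM2l T'0) -expr2 sqr_hn -bop_adjE; apply: le_trans (ip_le_hn _ _) _.
by apply: le_trans (ler_wpM2r (hn_ge0 _) (hn_bop T _)) _; rewrite mulrAC mulrC mulrA.
Qed.

Lemma bop_adjK : involutive bop_adj.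
Proof. by move=> T; apply: bop_adj_uniq => f g; rewrite ipC -bop_adjE ipC. Qed.

Lemma bop_adjD : {morph bop_adj : S T / S + T}.
Proof.
by move=> S T; apply: bop_adj_uniq => f g; rewrite !bopDE ipDl ipDr !bop_adjE.
Qed.

Lemma bop_adjZ (c : C) T : bop_adj (c *: T) = c^* *: bop_adj T.
Proof.
apply: bop_adj_uniq => f g; rewrite !bopZE ipZ bop_adjE; congr ip.
by rewrite linearZ.
Qed.

Lemma bop_adjM S T : bop_adj (bop_mul S T) = bop_mul (bop_adj T) (bop_adj S).
Proof. by apply: bop_adj_uniq => f g; rewrite !bop_mulE !bop_adjE. Qed.

Lemma opnM S T : opn (bop_mul S T) <= opn S * opn T.
Proof.
apply: opn_le; first by rewrite mulr_ge0 ?opn_ge0.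
move=> f; rewrite bop_mulE; apply: le_trans (hn_bop S _) _.
by rewrite -mulrA ler_wpM2l ?opn_ge0 ?hn_bop.
Qed.

Lemma bop_cstar T : opn (bop_mul (bop_adj T) T) = opn T ^+ 2.
Proof.
apply/eqP; rewrite eq_le; apply/andP; split.
  by apply: le_trans (opnM _ _) _; rewrite expr2 ler_wpM2r ?opn_ge0 ?opn_adj_le.
set N := opn (bop_mul _ _).
have N0 : 0 <= N by exact: opn_ge0.
rewrite -(sqr_sqrtr N0) ler_pXn2r ?nnegrE ?opn_ge0 ?sqrtr_ge0 //.
apply: opn_le => [|f]; first exact: sqrtr_ge0.
rewrite -(@ler_pXn2r _ 2) ?nnegrE ?mulr_ge0 ?sqrtr_ge0 ?hn_ge0 // exprMn (sqr_sqrtr N0).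
rewrite [leLHS]sqr_hn bop_adjE; apply: le_trans (ip_le_hn _ _) _.
by rewrite expr2 mulrA [leLHS]mulrC ler_wpM2r ?hn_ge0 // -bop_mulE hn_bop.
Qed.

Lemma Re_dist_le (z w : C) : `|complex.Re z - complex.Re w| <= complex.Re `|z - w|.
Proof.
rewrite normc_def; case: z w => a b [c d] /=.
by rewrite -sqrtr_sqr ler_wsqrtr // lerDl sqr_ge0.
Qed.

Lemma Im_dist_le (z w : C) : `|complex.Im z - complex.Im w| <= complex.Re `|z - w|.
Proof.
rewrite normc_def; case: z w => a b [c d] /=.
by rewrite -sqrtr_sqr ler_wsqrtr // lerDr sqr_ge0.
Qed.

Lemma cauchy_real_cvg (F : set_system bop) {FF : ProperFilter F} (k : bop -> R) (c : R) :
  (forall S T, `|k S - k T| <= opn (S - T) * c) -> cauchy F -> cvg (k @ F).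
Proof.
move=> kle Fc; apply: cauchy_cvg; apply: cauchy_exP => e e0.
(* [c] may vanish or be negative, so the radius is divided by [Num.max c 1]. *)
have c0 : 0 < Num.max c 1 by rewrite lt_max ltr01 orbT.
have d0 : 0 < (e / Num.max c 1)%:C%C :> C by rewrite ltcR divr_gt0.
have [T0 T0F] := (cauchyP F).1 Fc _ d0.
exists (k T0); change (F [set T | ball (k T0) e (k T)]).
apply: filterS T0F => T; rewrite -!ball_normE /ball_ /= ltcR => h.
apply: le_lt_trans (kle _ _) _.
apply: le_lt_trans (_ : opn (T0 - T) * Num.max c 1 < _).
  by rewrite ler_wpM2l ?opn_ge0 // le_max lexx.
by rewrite -ltr_pdivlMr.
Qed.


Lemma bop_near (F : set_system bop) {FF : ProperFilter F} (e : R) : cauchy F -> 0 < e ->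
  \forall T0 \near F, \forall T \near F, opn (T0 - T) <= e.
Proof.
move=> Fc e0; have e20 : 0 < (e / 2)%:C%C :> C by rewrite ltcR divr_gt0.
have [T1 T1F] := (cauchyP F).1 Fc _ e20.
have close T : ball T1 (e / 2)%:C%C T -> opn (T1 - T) < e / 2.
  rewrite -ball_normE /ball_ /=; by rewrite ltcR.
apply: filterS (T1F) => T0 /close h0; apply: filterS (T1F) => T /close h.
rewrite -lecR -bop_normE (_ : T0 - T = (T1 - T) - (T1 - T0)); last first.
  by rewrite opprB [RHS]addrC addrA subrK.
apply: le_trans (ler_normB _ _) _; rewrite !bop_normE -rmorphD lecR.
by rewrite [leRHS](splitr e) ltW // ltrD.
Qed.

(* Pointwise evaluations of a Cauchy filter of operators converge, and the
   limits form again square summable families by Fatou. *)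
Lemma bop_limit (F : set_system bop) {FF : ProperFilter F} : cauchy F ->
  exists L : l2 -> l2, forall e : R, 0 < e ->
    F [set T : bop | forall f, hn (T f - L f) <= e * hn f].
Proof.
move=> Fc.
have dist f x S T : complex.Re `|S f x - T f x| <= opn (S - T) * hn f.
  apply: le_trans (hn_bop (S - T) f).
  rewrite -lecR; apply: le_trans (normc_le_hn ((S - T) f) x).
  by rewrite bopBE l2BE normc_def.
have cRe f x : cvg ((fun T : bop => complex.Re (T f x)) @ F).
  apply: (cauchy_real_cvg (c := hn f)) => // S T.
  exact: le_trans (Re_dist_le _ _) (dist f x S T).
have cIm f x : cvg ((fun T : bop => complex.Im (T f x)) @ F).
  apply: (cauchy_real_cvg (c := hn f)) => // S T.
  exact: le_trans (Im_dist_le _ _) (dist f x S T).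
pose l f x : C := (lim ((fun T : bop => complex.Re (T f x)) @ F) +i*
                   lim ((fun T : bop => complex.Im (T f x)) @ F))%C.
have key f (T0 : bop) (e : R) : 0 <= e -> (\forall T \near F, opn (T0 - T) <= e) ->
    rsummable (fun x => sqn (T0 f x - l f x)) /\
    psum (fun x => sqn (T0 f x - l f x)) <= (e * hn f) ^+ 2.
  move=> e0 T0e; apply: psum_le_fin => [x|Y]; first exact: sqn_ge0.
  have cv : (fun T : bop => \sum_(x <- Y) sqn (T0 f x - T f x)) @ F
            --> \sum_(x <- Y) sqn (T0 f x - l f x).
    apply: (cvg_big (@add_continuous R^o)) => x _.
    have r1 : (fun T : bop => complex.Re (T0 f x) - complex.Re (T f x)) @ F -->
        complex.Re (T0 f x) - complex.Re (l f x).
      by apply: cvgB; [exact: cvg_cst|exact: cRe].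
    have r2 : (fun T : bop => complex.Im (T0 f x) - complex.Im (T f x)) @ F -->
        complex.Im (T0 f x) - complex.Im (l f x).
      by apply: cvgB; [exact: cvg_cst|exact: cIm].
    have sqnB (z w : C) : sqn (z - w) =
        (complex.Re z - complex.Re w) * (complex.Re z - complex.Re w) +
        (complex.Im z - complex.Im w) * (complex.Im z - complex.Im w).
      by case: z w => a b [c d]; rewrite /sqn !expr2.
    rewrite sqnB; under eq_cvg do rewrite sqnB.
    exact: (cvgD (cvgM r1 r1) (cvgM r2 r2)).
  apply: (cvgr_to_le cv); apply: filterS T0e => T T0T.
  apply: le_trans (ip_ge_fin ((T0 - T) f) Y) _.
  rewrite -sqr_hn ler_pXn2r ?nnegrE ?mulr_ge0 ?hn_ge0 //.
  by apply: le_trans (hn_bop _ _) _; rewrite ler_wpM2r ?hn_ge0.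
have lell2 f : l f \in @ell2 R X.
  have [T0 T01] := filter_ex (bop_near Fc ltr01).
  have [s _] := key f T0 1 ler01 T01.
  have d : (fun x => T0 f x - l f x) \in @ell2 R X by exact/ell2P.
  rewrite (_ : l f = l2_val (T0 f - L2 d)) ?l2_valP //.
  by apply/funext => x; rewrite l2BE; rewrite /= opprB addrCA subrr addr0.
exists (fun f => L2 (lell2 f)) => e e0.
apply: filterS (bop_near Fc e0) => T Te f.
have [_ le] := key f T e (ltW e0) Te.
by apply: hn_le; rewrite ?mulr_ge0 ?hn_ge0 ?(ltW e0) // ip_psum.
Qed.


(** A pointwise limit alone is not yet in [bounded_op], which demands an adjoint. Since [bop_adj]
    does not increase norms, the image filter is Cauchy too, and its limit [L'] is the adjoint of
    [L]. *)
Lemma bop_complete (F : set_system bop) : ProperFilter F -> cauchy F -> cvg F.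
Proof.
move=> FF Fc.
have adjN T : bop_adj (- T) = - bop_adj T.
  by apply/eqP; rewrite -addr_eq0 -bop_adjD addNr; apply/eqP/bop_adj_uniq => f g;
     rewrite !bop0E ip0l ipC ip0l.
have Fac : cauchy (bop_adj @ F).
  apply: cauchy_exP => e e0; have [T0 T0F] := (cauchyP F).1 Fc _ e0.
  exists (bop_adj T0); change (F [set T | ball (bop_adj T0) e (bop_adj T)]).
  apply: filterS T0F => T; rewrite -!ball_normE /ball_ /=.
  by apply: le_lt_trans; rewrite -adjN -bop_adjD lecR opn_adj_le.
have [L LE] := bop_limit Fc; have [L' L'E] := bop_limit Fac.
have small (x M : R) : (forall e, 0 < e -> x <= e * M) -> x <= 0.
  move=> h; rewrite leNgt; apply/negP => x0.
  have M0 : 0 < `|M| + 1 by rewrite ltr_wpDl.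
  have := h (x / (2 * (`|M| + 1))); rewrite divr_gt0 ?mulr_gt0 // => /(_ isT).
  have := ler_norm M => nM; apply/negP; rewrite -ltNge.
  rewrite -mulrA gtr_pMr // mulrC ltr_pdivrMr ?mulr_gt0 //; lra.
have L_eq0 f g : hn (f - g) <= 0 -> f = g.
  move=> h; apply/eqP; rewrite -subr_eq0; apply/eqP/hn_eq0/eqP.
  by rewrite eq_le h hn_ge0.
have linL : linear L.
  move=> a f g; apply: L_eq0.
  apply: (small _ (hn (a *: f + g) + complex.Re `|a| * hn f + hn g)) => e e0.
  have [T TE] := filter_ex (LE _ e0).
  rewrite (_ : _ - _ = - (T (a *: f + g) - L (a *: f + g)) +
      (a *: (T f - L f) + (T g - L g))); last first.
    rewrite bop_linear scalerBr [in RHS]addrACA -[in RHS]opprD [in RHS]opprB.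
    by rewrite [RHS]addrA subrK.
  have h1 := TE (a *: f + g); have h3 := TE g.
  have h2 : hn (a *: (T f - L f)) <= complex.Re `|a| * (e * hn f).
    rewrite hnZ; apply: ler_wpM2l; [exact: Re_norm_ge0|exact: TE].
  apply: le_trans (hnD _ _) _; rewrite hnN.
  apply: le_trans (lerD h1 (le_trans (hnD _ _) (lerD h2 h3))) _.
  by rewrite [leRHS](_ : _ = e * hn (a *: f + g) + (complex.Re `|a| * (e * hn f) + e * hn g)) //; ring.
have adjL f g : ip (L f) g = ip f (L' g).
  apply/eqP; rewrite -subr_eq0 -normr_le0.
  apply: (small _ (hn f * hn g + hn f * hn g)) => e e0.
  have adjE : F [set T | forall f, hn (bop_adj T f - L' f) <= e * hn f] := L'E _ e0.
  have [T [TE T'E]] := filter_ex (filterI (LE _ e0) adjE).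
  rewrite (_ : _ - _ = ip f (bop_adj T g - L' g) - ip (T f - L f) g); last first.
    by rewrite ipDl ipDr ipNl ipNr bop_adjE; ring.
  apply: le_trans (ler_normB _ _) _; rewrite mulrDr lerD //.
    by apply: le_trans (ip_abs_le_hn _ _) _; rewrite mulrCA ler_wpM2l ?hn_ge0.
  by apply: le_trans (ip_abs_le_hn _ _) _; rewrite mulrA ler_wpM2r ?hn_ge0.
have bL : L \in @bounded_op R X.
  apply/bounded_opP; split => //; first by exists L'.
  have [T TE] := filter_ex (LE _ ltr01).
  exists (opn T + 1) => [|f]; first by rewrite addr_ge0 ?opn_ge0.
  rewrite -[L f](subKr (T f)) mulrDl; apply: le_trans (hnD _ _) _.
  by rewrite hnN; apply: lerD; [exact: hn_bop|exact: TE].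
apply/cvg_ex; exists (Bop bL); apply/(@cvgrPdist_le _ _ _ F _ idfun) => e e0.
(* Norms take values in [R[i]], where [0 < e] forces [e] to be real. *)
have eE : e = (complex.Re e)%:C%C by case: e e0 => a b; rewrite ltcE /= => /andP[/eqP -> _].
have e0' : 0 < complex.Re e by rewrite -ltcR -eE.
apply: filterS (LE _ e0') => T TE /=.
rewrite distrC bop_normE eE lecR; apply: opn_le; first exact: ltW.
exact: TE.
Qed.

HB.instance Definition _ := Uniform_isComplete.Build bop bop_complete.

Lemma bop_mulA : associative bop_mul.
Proof. by move=> S T U; apply: bop_ext. Qed.
Lemma bop_scaleAl (c : C) S T : bop_mul (c *: S) T = c *: bop_mul S T.
Proof. by apply: bop_ext. Qed.
Lemma bop_mulDl : left_distributive bop_mul +%R.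
Proof. by move=> S T U; apply: bop_ext. Qed.
Lemma bop_mulDr : right_distributive bop_mul +%R.
Proof. by move=> S T U; apply: bop_ext => f; rewrite bopDE !bop_mulE bopDE linearD. Qed.
Lemma bop_scaleAr (c : C) S T : bop_mul S (c *: T) = c *: bop_mul S T.
Proof. by apply: bop_ext => f; rewrite bopZE !bop_mulE bopZE linearZ. Qed.
Lemma bop_normM S T : `|bop_mul S T| <= `|S| * `|T|.
Proof. by rewrite !bop_normE -rmorphM lecR opnM. Qed.
Lemma bop_cstarE T : `|bop_mul (bop_adj T) T| = `|T| ^+ 2.
Proof. by rewrite !bop_normE bop_cstar rmorphXn. Qed.

HB.instance Definition _ := isCstarAlgebra.Build R bop
  bop_mulA bop_mulDl bop_mulDr bop_scaleAl bop_scaleAr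
  bop_normM bop_adjK bop_adjD bop_adjZ bop_adjM bop_cstarE.


End OperatorAlgebra.

(** * Composition operators of partial bijections *)

Section PartialBijections.
Variables (R : realType) (X : choiceType).
Local Notation C := R[i].
Local Notation l2 := (l2 R X).
Local Notation bop := (bop R X).

(** The generators of the path space representation and their adjoints are all composition operators
    with such maps. Carrying both domains and both maps makes the adjoint the operator of the
    swapped data. *)
Definition partial_inverses (D D' : pred X) (s s' : X -> X) : Prop :=
  (forall y, D y -> D' (s y) /\ s' (s y) = y) /\
  (forall x, D' x -> D (s' x) /\ s (s' x) = x).

Lemma partial_inverses_sym D D' s s' :
  partial_inverses D D' s s' -> partial_inverses D' D s' s.
Proof. by move=> []. Qed.

Section Operator.
Variables (D D' : pred X) (s s' : X -> X).
Hypothesis ss' : partial_inverses D D' s s'.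

Lemma partial_inverses_bij : set_bij [set y | D y] [set x | D' x] s.
Proof.
have [h h'] := ss'; split.
- by move=> y /h [].
- by move=> y z; rewrite !in_setE => /h [_ ys] /h [_ zs] syz; rewrite -ys syz zs.
- by move=> x /h' [Ds' sx]; exists (s' x).
Qed.

Definition wfun (f : X -> C) (y : X) : C := if D y then f (s y) else 0.

Lemma wfun_ell2 (f : l2) : wfun f \in @ell2 R X.
Proof.
apply/ell2P; apply: (rsummable_reindex (g := fun x => if D' x then sqn (f x) else 0)
  partial_inverses_bij).
- by move=> y /= Dy; rewrite /wfun Dy; have [/(_ _ Dy)[-> _] _] := ss'.
- by move=> y /= /negP/negbTE Dy; rewrite /wfun Dy /sqn /= expr0n addr0.
- by move=> x /= /negP/negbTE ->.
apply: rsummable_le (elimT (ell2P _) (l2_valP f)) => x.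
by case: ifP; rewrite ?normr0 ?sqn_ge0 // ger0_norm ?sqn_ge0.
Qed.

Definition wmap (f : l2) : l2 := L2 (wfun_ell2 f).

Lemma wmapE f y : wmap f y = if D y then f (s y) else 0.
Proof. by []. Qed.

Lemma wmap_linear : linear wmap.
Proof.
move=> a f g; apply: l2_ext => y; rewrite [RHS]l2ZDE [LHS]wmapE ![in RHS]wmapE.
by case: ifP => _; rewrite ?l2ZDE // mulr0 addr0.
Qed.

Lemma hn_wmap f : hn (wmap f) <= hn f.
Proof.
apply: hn_le; first exact: hn_ge0.
have sf : rsummable (fun x => sqn (f x)) by exact/ell2P/l2_valP.
rewrite sqr_hn (ip_psum f).
have -> : ip (wmap f) (wmap f) = rsum (fun x => if D' x then sqn (f x) else 0).
  apply: (rsum_reindex partial_inverses_bij) => y /=.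
  - by move=> Dy; rewrite /= /wfun Dy dotzz; have [/(_ _ Dy)[-> _] _] := ss'.
  - by move=> /negP/negbTE Dy; rewrite /= /wfun Dy /dot /= !mul0r addr0.
  - by move=> /negP/negbTE ->.
rewrite rsum_psum; first by apply: psum_le => // x; case: ifP; rewrite ?lexx ?sqn_ge0.
  by move=> x; case: ifP; rewrite ?lexx ?sqn_ge0.
apply: rsummable_le sf => x.
by case: ifP; rewrite ?normr0 ?sqn_ge0 // ger0_norm ?sqn_ge0.
Qed.

End Operator.

Lemma wmap_adjoint D D' s s' (h : partial_inverses D D' s s')
    (h' : partial_inverses D' D s' s) f g : ip (wmap h f) g = ip f (wmap h' g).
Proof.
apply: (rsum_reindex (partial_inverses_bij h)) => y /=.
- move=> Dy; rewrite /wfun Dy; have [/(_ _ Dy)[Dsy sy] _] := h.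
  by rewrite Dsy sy.
- by move=> /negP/negbTE Dy; rewrite /wfun Dy /dot /= !mul0r addr0.
- by move=> /negP/negbTE Dy; rewrite /wfun Dy /dot /= !mulr0 addr0.
Qed.

Lemma wmap_bounded D D' s s' (h : partial_inverses D D' s s') :
  wmap h \in @bounded_op R X.
Proof.
apply/bounded_opP; split; first exact: wmap_linear.
- by exists (wmap (partial_inverses_sym h)) => f g; exact: wmap_adjoint.
- by exists 1 => // f; rewrite mul1r; exact: hn_wmap.
Qed.

Definition wop D D' s s' (h : partial_inverses D D' s s') : bop := Bop (wmap_bounded h).

Lemma wopE D D' s s' (h : partial_inverses D D' s s') f y :
  wop h f y = if D y then f (s y) else 0.
Proof. by []. Qed.

Lemma wop_adj D D' s s' (h : partial_inverses D D' s s')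
    (h' : partial_inverses D' D s' s) : adj (wop h) = wop h'.
Proof. by apply: bop_adj_uniq => f g; exact: wmap_adjoint. Qed.

Lemma bop_eq (S T : bop) : (forall f y, S f y = T f y) -> S = T.
Proof. by move=> ST; apply: bop_ext => f; apply: l2_ext. Qed.

Lemma cmul_bopE (S T : bop) f : (S ** T)%cstar f = S (T f).
Proof. by []. Qed.

Lemma bop_sumE (I : finType) (Q : pred I) (T : I -> bop) f y :
  (\sum_(i | Q i) T i) f y = \sum_(i | Q i) T i f y.
Proof. by apply: (big_morph (fun S : bop => S f y)). Qed.

Lemma delta_sum_le (z : X) (F : {fset X}) : \sum_(x <- F) sqn ((x == z)%:R : C) <= 1.
Proof.
have [zF|zF] := boolP (z \in F).
  rewrite (big_fsetD1 z) //= eqxx big1_fset => [|x].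
    by rewrite /sqn /= expr1n expr0n !addr0.
  by rewrite !inE => /andP[/negbTE -> _] _; rewrite /sqn /= expr0n addr0.
rewrite big1_fset ?ler01 // => x xF _.
by rewrite (negbTE (memPn zF x xF)) /sqn /= expr0n addr0.
Qed.

Lemma delta_ell2 (z : X) : (fun x => (x == z)%:R : C) \in @ell2 R X.
Proof.
by apply/ell2P; exact: (psum_le_fin (fun x => sqn_ge0 _) (@delta_sum_le z)).1.
Qed.

Definition delta z : l2 := L2 (delta_ell2 z).

Lemma deltaE z x : delta z x = (x == z)%:R. Proof. by []. Qed.

Lemma hn_delta z : hn (delta z) <= 1.
Proof.
apply: hn_le => //; rewrite expr1n ip_psum.
exact: (psum_le_fin (fun x => sqn_ge0 _) (@delta_sum_le z)).2.
Qed.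

(** Matrix entries are thus continuous in the operator; characters of the diagonal will be built
    from them. *)
Lemma bop_entry_le (T : bop) z x : `|T (delta z) x| <= `|T|.
Proof.
apply: le_trans (normc_le_hn _ _) _; rewrite bop_normE lecR.
apply: le_trans (hn_bop _ _) _; rewrite -[leRHS]mulr1.
by rewrite ler_wpM2l ?opn_ge0 ?hn_delta.
Qed.

End PartialBijections.

(** * Paths and permutation graphs *)

Section Paths.
Variables (V W : finType) (E : graph V W).

Lemma gpath_eq l (p q : gpath E l) : psrc p = psrc q -> edges p = edges q -> p = q.
Proof.
move=> ps pe; apply: val_inj; move: ps pe; rewrite /psrc /edges.
by case: (val p) (val q) => [u s] [v r] /= -> ->.
Qed.

Lemma walk_rcons v s e :
  walk E v (rcons s e) = walk E v s && (src E e == last v (map (rng E) s)).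
Proof. by elim: s v => [|f s IH] v /=; rewrite ?andbT // IH andbA. Qed.

Lemma edges_first_tail k (mu : gpath E k.+1) :
  edges mu = first_edge mu :: edges (path_tail mu) :> seq W.
Proof.
rewrite /first_edge /path_tail {3}/edges /=.
by case/tupleP: (edges mu) => e s; rewrite theadE.
Qed.

Lemma edges_front_last k (mu : gpath E k.+1) :
  edges mu = rcons (edges (path_front mu)) (last_edge mu) :> seq W.
Proof.
rewrite /last_edge /path_front {2}/edges /= /first_edge.
case/tupleP: (edges mu) => e s; rewrite theadE /=.
by rewrite (tnth_nth e) /= -[X in nth e _ X](size_tuple s) nth_last /= -lastI.
Qed.

Lemma psrc_first k (mu : gpath E k.+1) : psrc mu = src E (first_edge mu).
Proof.
have := gpath_walk mu; rewrite -/(psrc mu) -/(edges mu) edges_first_tail /=.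
by move/andP => [/eqP].
Qed.

Lemma psrc_tail k (mu : gpath E k.+1) : psrc (path_tail mu) = rng E (first_edge mu).
Proof. by []. Qed.

Lemma psrc_front k (mu : gpath E k.+1) : psrc (path_front mu) = psrc mu.
Proof. by []. Qed.

Lemma prng_tail k (mu : gpath E k.+1) : prng (path_tail mu) = prng mu.
Proof. by rewrite /prng edges_first_tail. Qed.

Lemma prng_front k (mu : gpath E k.+1) : prng (path_front mu) = src E (last_edge mu).
Proof.
have := gpath_walk mu; rewrite -/(psrc mu) -/(edges mu) edges_front_last walk_rcons.
by move/andP => [_ /eqP ->].
Qed.

Lemma prng_last k (mu : gpath E k.+1) : prng mu = rng E (last_edge mu).
Proof. by rewrite /prng edges_front_last map_rcons last_rcons. Qed.

Lemma cons_path_exists k (e : W) (a : gpath E k) : rng E e = psrc a ->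
  exists mu : gpath E k.+1, first_edge mu = e /\ path_tail mu = a.
Proof.
move=> ea.
have w : walk E (src E e, [tuple of e :: edges a]).1 (src E e, [tuple of e :: edges a]).2.
  by rewrite /= eqxx /= ea; exact: (gpath_walk a).
have fe : first_edge (GPath w) = e by rewrite /first_edge theadE.
exists (GPath w); split => //; apply: gpath_eq; first by rewrite psrc_tail fe.
by apply/val_inj; rewrite /= /edges /=.
Qed.

Lemma rcons_path_exists k (a : gpath E k) (f : W) : prng a = src E f ->
  exists mu : gpath E k.+1, path_front mu = a /\ last_edge mu = f.
Proof.
move=> af.
have w : walk E (psrc a, [tuple of rcons (edges a) f]).1
               (psrc a, [tuple of rcons (edges a) f]).2.
  by rewrite /= walk_rcons -[last _ _]/(prng a) af eqxx andbT; exact: (gpath_walk a).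
have := edges_front_last (GPath w); rewrite {1}/edges /= => /rcons_inj[e1 e2].
exists (GPath w); split => //; apply: gpath_eq; first by rewrite psrc_front.
exact/val_inj.
Qed.

Lemma first_tail_inj k (mu nu : gpath E k.+1) :
  first_edge mu = first_edge nu -> path_tail mu = path_tail nu -> mu = nu.
Proof.
move=> fe te; apply: gpath_eq; first by rewrite !psrc_first fe.
by apply: val_inj; rewrite /= !edges_first_tail fe te.
Qed.

Lemma front_last_inj k (mu nu : gpath E k.+1) :
  path_front mu = path_front nu -> last_edge mu = last_edge nu -> mu = nu.
Proof.
move=> fe le; apply: gpath_eq; first by rewrite -psrc_front fe psrc_front.
by apply: val_inj; rewrite /= !edges_front_last fe le.
Qed.

Lemma endpoint_fixingP l (t : {perm gpath E l}) :
  endpoint_fixing t <-> forall p, psrc (t p) = psrc p /\ prng (t p) = prng p.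
Proof.
split=> [ht p|h u v].
  have : t p \in paths_between E l (psrc p, prng p).
    by rewrite -ht; apply: imset_f; rewrite inE /= !eqxx.
  by rewrite inE /= => /andP[/eqP -> /eqP ->].
apply/setP => q; apply/imsetP/idP => [[p pP ->]|].
  by move: pP; rewrite !inE; have [-> ->] := h p.
move=> qP; exists (t^-1%g q); last by rewrite permKV.
move: qP; rewrite !inE -{1 2}[q](permKV t).
by have [-> ->] := h (t^-1%g q).
Qed.

Lemma prefix_path_exists z l : ipaths E z ->
  exists p : gpath E l, psrc p = src E (z 0%N) /\ edges p = mkseq z l :> seq W.
Proof.
move=> zP; elim: l => [|l [p [ps pe]]].
  by exists (GPath (isT : walk E (src E (z 0%N), [tuple]).1 (src E (z 0%N), [tuple]).2)).
have pz : prng p = src E (z l).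
  rewrite /prng ps pe; case: l {p ps pe} => [//|l].
  by rewrite mkseqS map_rcons last_rcons zP.
have [q [qf ql]] := rcons_path_exists pz; exists q.
by rewrite -psrc_front qf ps edges_front_last qf pe ql mkseqS.
Qed.

Lemma path_of_length_exists : no_sinks E -> forall l v, exists p : gpath E l, psrc p = v.
Proof.
move=> ns; elim=> [|l IH] v.
  by exists (GPath (isT : walk E (v, [tuple]).1 (v, [tuple]).2)).
have [p pv] := IH v; have [f fp] := ns (prng p).
have [q [qf _]] := rcons_path_exists (esym fp).
by exists q; rewrite -psrc_front qf.
Qed.

Lemma ipath_exists : no_sinks E -> forall v, exists2 z, ipaths E z & src E (z 0%N) = v.
Proof.
move=> ns v; pose nxt v := projT1 (cid (ns v)).
have nxtE u : src E (nxt u) = u by rewrite /nxt; case: cid.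
pose z := fix z n := if n is m.+1 then nxt (rng E (z m)) else nxt v.
by exists z => [i|]; rewrite /= nxtE.
Qed.

End Paths.

Section Graphs.
Variables (V W : finType) (E : graph V W).

Lemma bipaths_tail x i : bipaths E x -> ipaths E (fun j => x (i + j%:Z)).
Proof. by move=> xP j; rewrite xP -addrA -PoszD addn1. Qed.

End Graphs.

Lemma mkseq_cons (T : Type) (x : nat -> T) n :
  mkseq x n.+1 = x 0%N :: mkseq (fun i => x i.+1) n.
Proof. by rewrite /mkseq /= (iotaDl 1 0 n : iota 1 n = map S (iota 0 n)) -map_comp. Qed.

(** * Lifting paths of the graph to its permutation graph *)

Section PermutationGraphs.
Variables (V W : finType) (E : graph V W) (k : nat) (t : {perm gpath E k.+1}).
Hypotheses (hsinks : no_sinks E) (hsources : no_sources E) (ht : endpoint_fixing t).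
Local Notation G := (perm_graph t).

(** As [t] fixes endpoints, the source of the path that forms a vertex of [G] follows the first
    labels, and its range follows the second labels. Hence label sequences of paths in [G] are paths
    in [E]. *)
Lemma psrc_src mu : psrc (src G mu) = src E (lab G mu).1.
Proof. by rewrite /= psrc_front ((endpoint_fixingP t).1 ht mu).1 psrc_first. Qed.

Lemma prng_src mu : prng (src G mu) = src E (lab G mu).2.
Proof. by rewrite /= prng_front. Qed.

Lemma psrc_rng mu : psrc (rng G mu) = rng E (lab G mu).1.
Proof. by []. Qed.

Lemma prng_rng mu : prng (rng G mu) = rng E (lab G mu).2.
Proof. by rewrite /= prng_tail -prng_last ((endpoint_fixingP t).1 ht mu).2. Qed.

Lemma edge_into e a : rng E e = psrc a -> exists mu, (lab G mu).1 = e /\ rng G mu = a.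
Proof. exact: cons_path_exists. Qed.

Lemma edge_from f b : prng b = src E f -> exists mu, (lab G mu).2 = f /\ src G mu = b.
Proof.
move=> bf; have [nu [nb nf]] := rcons_path_exists bf.
by exists (t^-1%g nu); rewrite /= permKV.
Qed.

Lemma edge_into_inj mu nu : (lab G mu).1 = (lab G nu).1 -> rng G mu = rng G nu -> mu = nu.
Proof. exact: first_tail_inj. Qed.

Lemma edge_from_inj mu nu : (lab G mu).2 = (lab G nu).2 -> src G mu = src G nu -> mu = nu.
Proof. by move=> le fe; apply: (@perm_inj _ t); apply: front_last_inj. Qed.

Lemma ipaths_fst y : ipaths G y -> ipaths E (fun i => (lab G (y i)).1).
Proof. by move=> yP i; rewrite -psrc_rng yP psrc_src. Qed.

Lemma bipaths_fst y : bipaths G y -> bipaths E (fun i => (lab G (y i)).1).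
Proof. by move=> yP i; rewrite -psrc_rng yP psrc_src. Qed.

Lemma perm_graph_no_sinks : no_sinks G.
Proof.
move=> b; have [f fb] := hsinks (prng b).
by have [mu [_ mub]] := edge_from (esym fb); exists mu.
Qed.

Lemma perm_graph_no_sources : no_sources G.
Proof.
move=> a; have [e ea] := hsources (psrc a).
by have [mu [_ mua]] := edge_into ea; exists mu.
Qed.

(** The lift is built from its right end, where the vertex is arbitrary: [edge_into] puts an edge
    with the required first label in front of any path. *)
Lemma finite_lift x n : ipaths E x -> exists p : gpath G n,
  [seq (lab G e).1 | e <- edges p] = mkseq x n /\ psrc (psrc p) = src E (x 0%N).
Proof.
elim: n x => [|n IH] x xP.
  have [a ax] := path_of_length_exists hsinks k (src E (x 0%N)).
  by exists (GPath (isT : walk G (a, [tuple]).1 (a, [tuple]).2)).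
have [|p [pl pp]] := IH (fun i => x i.+1); first by move=> i; exact: xP.
have [|mu [mue mup]] := @edge_into (x 0%N) (psrc p); first by rewrite xP.
have [q [qf qt]] := cons_path_exists mup.
exists q; split; last by rewrite psrc_first qf psrc_src mue.
by rewrite edges_first_tail qt map_cons qf mue pl mkseq_cons.
Qed.


Section Synchronizing.
Hypothesis hsync : synchronizing_fst G.

Lemma sync_src : exists m, forall y y', ipaths G y -> ipaths G y' ->
  (forall j, (j < m)%N -> (lab G (y j)).1 = (lab G (y' j)).1) ->
  src G (y 0%N) = src G (y' 0%N).
Proof.
have [m hm] := hsync; exists m => y y' yP y'P yy'.
have [p [ps pe]] := prefix_path_exists m yP.
have [p' [p's p'e]] := prefix_path_exists m y'P.
rewrite -ps -p's; apply: hm; rewrite pe p'e /mkseq -!map_comp.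
by apply/eq_in_map => j; rewrite mem_iota => /andP[_ jm]; exact: yy'.
Qed.

Lemma lift_unique y y' : ipaths G y -> ipaths G y' ->
  (forall j, (lab G (y j)).1 = (lab G (y' j)).1) -> y = y'.
Proof.
move=> yP y'P yy'; have [m hm] := sync_src; apply/funext => i.
apply: edge_into_inj => //; rewrite yP y'P.
have := hm (fun j => y (i.+1 + j)%N) (fun j => y' (i.+1 + j)%N).
by rewrite addn0; apply => // j; rewrite addnS; [exact: yP|exact: y'P].
Qed.

(** The edge at [i] is taken from a finite lift of the window of length [m.+1] starting at [i];
    synchronization makes the choices for successive windows fit together. *)
Lemma lift_exists x : ipaths E x ->
  exists2 y, ipaths G y & (fun j => (lab G (y j)).1) = x.
Proof.
move=> xP; have [m hm] := hsync.
have shift i : ipaths E (fun j => x (i + j)%N) by move=> j; rewrite xP addnS.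
pose q i := projT1 (cid (finite_lift m.+1 (shift i))).
have qE i : [seq (lab G e).1 | e <- edges (q i)] = mkseq (fun j => x (i + j)%N) m.+1.
  by rewrite /q; case: cid => p [].
have first_q i : (lab G (first_edge (q i))).1 = x i.
  by have := qE i; rewrite edges_first_tail map_cons /= => -[->]; rewrite addn0.
exists (fun i => first_edge (q i)); last exact/funext.
(* The tail of the lift at [i] and the front of the lift at [i.+1] carry the same [m] first labels,
   hence have the same source. *)
move=> i; rewrite -psrc_tail -psrc_first -psrc_front; apply: hm.
have := qE i; rewrite edges_first_tail map_cons mkseq_cons => -[_ ->].
have := qE i.+1; rewrite edges_front_last map_rcons mkseqS => /rcons_inj[-> _].
by apply: eq_map => j /=; rewrite addnS.
Qed.

Lemma bilift_unique y y' : bipaths G y -> bipaths G y' ->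
  (forall j, (lab G (y j)).1 = (lab G (y' j)).1) -> y = y'.
Proof.
move=> yP y'P yy'; apply/funext => i.
have := lift_unique (bipaths_tail i yP) (bipaths_tail i y'P) (fun j => yy' _).
by move/(congr1 (fun z => z 0%N)); rewrite addr0.
Qed.

(** One-sided lifts from successive positions agree on their overlap by uniqueness, so their initial
    edges form a path. *)
Lemma bilift_exists x : bipaths E x ->
  exists2 y, bipaths G y & (fun j => (lab G (y j)).1) = x.
Proof.
move=> xP; pose l i := projT1 (cid2 (lift_exists (bipaths_tail i xP))).
have lP i : ipaths G (l i) by rewrite /l; case: cid2.
have lE i j : (lab G (l i j)).1 = x (i + j%:Z).
  by rewrite /l; case: cid2 => /= y _ yE; rewrite -[RHS]/((fun j => x (i + j%:Z)) j) -yE.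
exists (fun i => l i 0%N); last by apply/funext => i; rewrite lE addr0.
move=> i; rewrite lP.
suff -> : l (i + 1) = fun j => l i j.+1 by [].
apply: lift_unique => // [j|j]; first exact: lP.
by rewrite !lE -addrA -PoszD add1n.
Qed.

Lemma textile_mapE y : bipaths G y ->
  textile_map t (fun j => (lab G (y j)).1) = fun j => (lab G (y j)).2.
Proof.
move=> yP; rewrite /textile_map; case: xgetP => [_ -> [y' [y'P /= y'E] <-]|/(_ (fun j => (lab G (y j)).2)) []].
  suff -> : y = y' by [].
  by apply: bilift_unique => // j; rewrite -[LHS]/((fun j => (lab G (y j)).1) j) -y'E.
by exists y.
Qed.

Lemma label_shiftE : label_shift G =
  [set z : int -> W * W | bipaths E (fst \o z) /\ snd \o z = textile_map t (fst \o z)].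
Proof.
apply/seteqP; split=> [_ [y yP <-] /=|z [/= zP zE]].
  split; first exact: bipaths_fst.
  exact/esym/textile_mapE.
have [y yP yz] := bilift_exists zP; exists y => //.
move: zE; rewrite -yz textile_mapE // => zE.
apply/funext => j /=; rewrite [z j]surjective_pairing.
rewrite -[(z j).1]/((fst \o z) j) -yz -[(z j).2]/((snd \o z) j) zE.
by rewrite -surjective_pairing.
Qed.

End Synchronizing.

End PermutationGraphs.

Section Comparison.
Variables (V W : finType) (E : graph V W) (k : nat) (t t' : {perm gpath E k.+1}).
Hypothesis hsinks : no_sinks E.
Hypotheses (ht : endpoint_fixing t) (ht' : endpoint_fixing t').
Hypotheses (hsync : synchronizing_fst (perm_graph t))
           (hsync' : synchronizing_fst (perm_graph t')).

Lemma label_shift_textile : label_shift (perm_graph t) = label_shift (perm_graph t') <->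
  forall x, bipaths E x -> textile_map t x = textile_map t' x.
Proof.
rewrite !label_shiftE //; split=> [h x xP|h].
  have : [set z : int -> W * W | bipaths E (fst \o z) /\ snd \o z = textile_map t (fst \o z)]
      (fun j => (x j, textile_map t x j)) by [].
  by rewrite h => -[_ hx]; exact: hx.
apply/seteqP; split=> z [zP zE]; split=> //; rewrite zE; first exact: h.
exact/esym/h.
Qed.

End Comparison.

(** * Conjugation by a permutation of the vertices *)

Section VertexPermutations.
Variables (V W : finType) (E : graph V W) (k : nat) (pi : {perm gpath E k}).
Hypothesis hpi : endpoint_fixing pi.

Lemma tail_map_exists (mu : gpath E k.+1) :
  exists nu : gpath E k.+1, first_edge nu = first_edge mu /\ path_tail nu = pi (path_tail mu).
Proof. by apply: cons_path_exists; rewrite ((endpoint_fixingP pi).1 hpi _).1. Qed.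

Lemma front_map_exists (mu : gpath E k.+1) :
  exists nu : gpath E k.+1, path_front nu = pi (path_front mu) /\ last_edge nu = last_edge mu.
Proof.
by apply: rcons_path_exists; rewrite ((endpoint_fixingP pi).1 hpi _).2 prng_front.
Qed.

Definition tail_map mu := projT1 (cid (tail_map_exists mu)).
Definition front_map mu := projT1 (cid (front_map_exists mu)).

Lemma tail_mapE mu :
  first_edge (tail_map mu) = first_edge mu /\ path_tail (tail_map mu) = pi (path_tail mu).
Proof. by rewrite /tail_map; case: cid. Qed.

Lemma front_mapE mu :
  path_front (front_map mu) = pi (path_front mu) /\ last_edge (front_map mu) = last_edge mu.
Proof. by rewrite /front_map; case: cid. Qed.

Lemma tail_map_inj : injective tail_map.
Proof.
move=> mu nu h; have [fm tm] := tail_mapE mu; have [fn tn] := tail_mapE nu.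
by apply: first_tail_inj; [rewrite -fm h|apply: (@perm_inj _ pi); rewrite -tm h].
Qed.

Lemma front_map_inj : injective front_map.
Proof.
move=> mu nu h; have [fm tm] := front_mapE mu; have [fn tn] := front_mapE nu.
by apply: front_last_inj; [apply: (@perm_inj _ pi); rewrite -fm h|rewrite -tm h].
Qed.

Definition tail_perm : {perm gpath E k.+1} := perm tail_map_inj.
Definition front_perm : {perm gpath E k.+1} := perm front_map_inj.

Lemma tail_permE mu :
  first_edge (tail_perm mu) = first_edge mu /\ path_tail (tail_perm mu) = pi (path_tail mu).
Proof. by rewrite permE; exact: tail_mapE. Qed.

Lemma front_permE mu :
  path_front (front_perm mu) = pi (path_front mu) /\ last_edge (front_perm mu) = last_edge mu.
Proof. by rewrite permE; exact: front_mapE. Qed.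

Lemma tail_perm_unique mu nu : first_edge nu = first_edge mu ->
  path_tail nu = pi (path_tail mu) -> nu = tail_perm mu.
Proof.
by move=> fe te; apply: first_tail_inj; rewrite ?(tail_permE mu).1 ?(tail_permE mu).2.
Qed.

Lemma tail_perm_fixing : endpoint_fixing tail_perm.
Proof.
apply/endpoint_fixingP => mu; have [fe te] := tail_permE mu.
by rewrite !psrc_first fe -prng_tail te ((endpoint_fixingP pi).1 hpi _).2 prng_tail.
Qed.

Lemma front_perm_fixing : endpoint_fixing front_perm.
Proof.
apply/endpoint_fixingP => mu; have [fe te] := front_permE mu.
by rewrite -psrc_front fe ((endpoint_fixingP pi).1 hpi _).1 !prng_last te.
Qed.

(** In this form [s] is [t] conjugated by two explicit permutations. That settles existence and
    uniqueness for [g_perm], and makes [tail_perm] the edge part of a graph isomorphism whose vertex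
    part is [pi]. *)
Lemma g_spec_tail_perm t s : g_spec pi t s <-> forall mu, s (tail_perm mu) = front_perm (t mu).
Proof.
split=> h mu.
  have [fe te] := tail_permE mu; have [h1 h2] := h _ _ fe te.
  by have [fe' le'] := front_permE (t mu); apply: front_last_inj; rewrite ?fe' ?le'.
by move=> nu fe te; rewrite (tail_perm_unique fe te) h; exact: front_permE.
Qed.

Lemma g_permP (t s : {perm gpath E k.+1}) : endpoint_fixing t -> endpoint_fixing s ->
  s = g_perm pi t <-> g_spec pi t s.
Proof.
move=> ht hs; pose s0 := (tail_perm^-1 * t * front_perm)%g.
have s0E : g_spec pi t s0 by apply/g_spec_tail_perm => mu; rewrite !permM permK.
have s0fix : endpoint_fixing s0.
  apply/endpoint_fixingP => p; rewrite !permM -{2 4}[p](permKV tail_perm).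
  have h1 := (endpoint_fixingP _).1 tail_perm_fixing; have h2 := (endpoint_fixingP _).1 front_perm_fixing.
  by rewrite (h1 _).1 (h1 _).2 (h2 _).1 (h2 _).2; exact: (endpoint_fixingP t).1 ht _.
have uniq s1 s2 : g_spec pi t s1 -> g_spec pi t s2 -> s1 = s2.
  move=> /g_spec_tail_perm h1 /g_spec_tail_perm h2; apply/permP => p.
  by rewrite -[p](permKV tail_perm) h1 h2.
rewrite /g_perm; case: xgetP => [s1 -> [_ s1E]|/(_ s0) []//].
by split=> [->//|sE]; exact: uniq.
Qed.

Section Isomorphism.
Variables t t' : {perm gpath E k.+1}.
Hypothesis tt' : g_spec pi t t'.

Lemma iso_lab mu : lab (perm_graph t') (tail_perm mu) = lab (perm_graph t) mu.
Proof.
have := (g_spec_tail_perm _ _).1 tt' mu; rewrite /= => ->.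
by rewrite (tail_permE mu).1 (front_permE _).2.
Qed.

Lemma iso_src mu : src (perm_graph t') (tail_perm mu) = pi (src (perm_graph t) mu).
Proof. by have /= -> := (g_spec_tail_perm _ _).1 tt' mu; rewrite (front_permE _).1. Qed.

Lemma iso_rng mu : rng (perm_graph t') (tail_perm mu) = pi (rng (perm_graph t) mu).
Proof. exact: (tail_permE mu).2. Qed.

Lemma g_spec_label_shift : label_shift (perm_graph t) = label_shift (perm_graph t').
Proof.
apply/seteqP; split=> [_ [y yP <-]|_ [y yP <-]].
  exists (tail_perm \o y); last by apply/funext => i; exact: iso_lab.
  by move=> i; rewrite iso_src iso_rng yP.
exists ((tail_perm^-1)%g \o y); last first.
  by apply/funext => i; rewrite /comp -iso_lab permKV.
by move=> i; apply: (@perm_inj _ pi); rewrite -iso_src -iso_rng /comp !permKV.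
Qed.

End Isomorphism.

End VertexPermutations.

(** * Bi-infinite paths and recovery of [pi] from the label shift *)

Section Gluing.
Variables (V W : finType) (G : graph V W).

(** The past is read outwards from the origin, so that it is a one-sided path of the reversed
    graph. *)
Definition glue (w z : nat -> W) (i : int) : W :=
  match i with Posz n => z n | Negz n => w n end.

Lemma glue_bipath (w z : nat -> W) : (forall i, src G (w i) = rng G (w i.+1)) ->
  ipaths G z -> rng G (w 0%N) = src G (z 0%N) -> bipaths G (glue w z).
Proof.
move=> wP zP wz [n|[|n]]; first by rewrite -PoszD addn1; exact: zP.
  exact: wz.
by rewrite (_ : Negz n.+1 + 1 = Negz n) ?wP // !NegzE; lia.
Qed.

Lemma bipath_through : no_sinks G -> no_sources G -> forall w0 : W,
  exists2 y, bipaths G y & y 0 = w0.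
Proof.
move=> ns nso w0.
have [z zP z0] := ipath_exists ns (rng G w0).
have [w wP w1] := @ipath_exists _ _ (Graph (rng G) (src G)) nso (src G w0).
pose z' n := if n is m.+1 then z m else w0.
by exists (glue w z') => //; apply: glue_bipath => // -[|i] /=; rewrite ?z0.
Qed.

End Gluing.

Section Partners.
Variables (V W : finType) (E : graph V W) (k : nat) (t t' : {perm gpath E k.+1}).
Hypothesis hsync' : synchronizing_fst (perm_graph t').
Hypothesis hls : label_shift (perm_graph t) `<=` label_shift (perm_graph t').
Local Notation G := (perm_graph t).
Local Notation G' := (perm_graph t').

Lemma partner_exists y : bipaths G y ->
  exists2 y', bipaths G' y' & forall i, lab G' (y' i) = lab G (y i).
Proof.
move=> yP; have [|y' y'P y'E] := @hls (lab G \o y); first by exists y.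
by exists y' => // i; have /(congr1 (fun z => z i)) := y'E.
Qed.

(** The two paths are compared through [u], the past of [y1] followed by the future of [y2]. Its
    partner passes through the vertex of [y1'] at 0 because the past labels agree, and through that
    of [y2'] because the future labels agree. *)
Lemma partner_src y1 y2 y1' y2' : bipaths G y1 -> bipaths G y2 ->
  bipaths G' y1' -> bipaths G' y2' ->
  (forall i, lab G' (y1' i) = lab G (y1 i)) -> (forall i, lab G' (y2' i) = lab G (y2 i)) ->
  src G (y1 0) = src G (y2 0) -> src G' (y1' 0) = src G' (y2' 0).
Proof.
move=> y1P y2P y1'P y2'P y1E y2E y12.
pose u := glue (fun n => y1 (Negz n)) (fun n => y2 n%:Z).
have uP : bipaths G u.
  apply: glue_bipath.
  - by move=> i; rewrite y1P (_ : Negz i.+1 + 1 = Negz i) // !NegzE; lia.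
  - by move=> i; rewrite y2P -PoszD addn1.
  - by rewrite y1P -y12; congr (src G (y1 _)).
have [u' u'P u'E] := partner_exists uP.
have [m hm] := sync_src hsync'.
have past : src G' (y1' 0) = src G' (u' 0).
  (* The [m] labels just before 0 fix the vertex at position [- m]; from there source and second
     label determine each edge up to 0. *)
  have start : src G' (y1' (- m%:Z)) = src G' (u' (- m%:Z)).
    have := hm _ _ (bipaths_tail (- m%:Z) y1'P) (bipaths_tail (- m%:Z) u'P).
    rewrite addr0; apply => j jm; rewrite y1E u'E.
    have [n ->] : exists n, - m%:Z + j%:Z = Negz n.
      by exists (m - j).-1%N; rewrite NegzE; lia.
    by [].
  have step n : (n <= m)%N -> src G' (y1' (- m%:Z + n%:Z)) = src G' (u' (- m%:Z + n%:Z)).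
    elim: n => [|n IH] nm; first by rewrite addr0.
    have e : y1' (- m%:Z + n%:Z) = u' (- m%:Z + n%:Z).
      apply: edge_from_inj; last exact: IH (ltnW nm).
      rewrite y1E u'E; have [j ->] : exists j, - m%:Z + n%:Z = Negz j.
        by exists (m - n).-1%N; rewrite NegzE; lia.
      by [].
    by rewrite -(addn1 n) PoszD addrA -y1'P -u'P e.
  by have := step m (leqnn m); rewrite addNr.
rewrite past; have := hm _ _ (bipaths_tail 0 u'P) (bipaths_tail 0 y2'P).
by rewrite addr0; apply => j _; rewrite add0r u'E y2E.
Qed.

End Partners.

Section Reconstruction.
Variables (V W : finType) (E : graph V W) (k : nat) (t t' : {perm gpath E k.+1}).
Hypotheses (hsinks : no_sinks E) (hsources : no_sources E).
Hypotheses (ht : endpoint_fixing t) (ht' : endpoint_fixing t').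
Hypotheses (hsync : synchronizing_fst (perm_graph t))
           (hsync' : synchronizing_fst (perm_graph t')).
Local Notation G := (perm_graph t).
Local Notation G' := (perm_graph t').

Lemma label_shift_g_spec : label_shift G = label_shift G' ->
  exists2 pi : {perm gpath E k}, endpoint_fixing pi & g_spec pi t t'.
Proof.
move=> ls; have sub : label_shift G `<=` label_shift G' by rewrite ls.
have sub' : label_shift G' `<=` label_shift G by rewrite ls.
have through a : exists y y', [/\ bipaths G y, bipaths G' y',
    forall i, lab G' (y' i) = lab G (y i) & src G (y 0) = a].
  have [mu <-] := perm_graph_no_sinks t hsinks a.
  have [y yP y0] := bipath_through (perm_graph_no_sinks t hsinks)
    (perm_graph_no_sources t hsources) mu.
  by have [y' y'P yy'] := partner_exists sub yP; exists y, y'; split => //; rewrite y0.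
have thrP a : {a' | exists y y', [/\ bipaths G y, bipaths G' y',
    forall i, lab G' (y' i) = lab G (y i), src G (y 0) = a & src G' (y' 0) = a']}.
  apply: cid; have [y [y' [yP y'P yy' ya]]] := through a.
  by exists (src G' (y' 0)), y, y'.
pose p a := sval (thrP a).
have pE y y' : bipaths G y -> bipaths G' y' -> (forall i, lab G' (y' i) = lab G (y i)) ->
    p (src G (y 0)) = src G' (y' 0).
  move=> yP y'P yy'; have [z [z' [zP z'P zz' zy z'p]]] := svalP (thrP (src G (y 0))).
  rewrite /p -z'p; exact: partner_src zP yP z'P y'P zz' yy' zy.
(* Injectivity is [partner_src] with the two graphs exchanged. *)
have pinj : injective p.
  move=> a b; have [y [y' [yP y'P yy' <-]]] := through a.
  have [z [z' [zP z'P zz' <-]]] := through b.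
  rewrite (pE _ _ yP y'P yy') (pE _ _ zP z'P zz') => h.
  by apply: partner_src y'P z'P yP zP _ _ h.
exists (perm pinj).
  apply/endpoint_fixingP => a; rewrite permE; have [y [y' [yP y'P yy' <-]]] := through a.
  by rewrite (pE _ _ yP y'P yy') !psrc_src // !prng_src // yy'.
move=> mu nu fe te.
have [y yP y0] := bipath_through (perm_graph_no_sinks t hsinks)
    (perm_graph_no_sources t hsources) mu.
have [y' y'P yy'] := partner_exists sub yP.
have y'0 : y' 0 = nu.
  apply: first_tail_inj; first by rewrite fe -[LHS]/(lab G' (y' 0)).1 yy' y0.
  (* The range at position 0 is the source at position 1, so [pE] is applied to the paths shifted by
     one. *)
  rewrite te permE -y0 -[LHS]/(rng G' (y' 0)) -[path_tail (y 0)]/(rng G (y 0)) y'P yP.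
  have shift (H : lgraph (gpath E k) (gpath E k.+1) (W * W)) z :
      bipaths H z -> bipaths H (fun i => z (i + 1)) by move=> zP i; rewrite zP.
  by have := pE _ _ (shift _ _ yP) (shift _ _ y'P) (fun i => yy' (i + 1)); rewrite add0r.
rewrite -y'0 permE -[path_front (t' (y' 0))]/(src G' (y' 0)) -(pE _ _ yP y'P yy') y0.
by split => //; rewrite -[LHS]/(lab G' (y' 0)).2 yy' y0.
Qed.

Lemma label_shift_g_perm : label_shift G = label_shift G' <->
  exists pi : {perm gpath E k}, endpoint_fixing pi /\ t' = g_perm pi t.
Proof.
split=> [/label_shift_g_spec[pi hpi tt']|[pi [hpi tt']]].
  by exists pi; split => //; apply/g_permP.
by apply: (g_spec_label_shift hpi); apply/g_permP.
Qed.

End Reconstruction.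

(** * Ordered permutation graphs *)

Section LexicographicOrder.
Variables (T : eqType) (r : rel T).
Hypothesis hr : strict_total_order r.

Definition lexr (m m' : nat -> T) : Prop :=
  exists i, (forall j, (j < i)%N -> m j = m' j) /\ r (m i) (m' i).

Lemma lexr_irr m : ~ lexr m m.
Proof. by have [irr _ _] := hr; move=> [i [_]]; rewrite irr. Qed.

Lemma lexr_trans m1 m2 m3 : lexr m1 m2 -> lexr m2 m3 -> lexr m1 m3.
Proof.
have [_ tr _] := hr; move=> [i [ia ir]] [j [ja jr]].
have [ij|ji|ij] := ltngtP i j.
- exists i; split; last by rewrite -ja.
  by move=> l li; rewrite ia // ja // (ltn_trans li ij).
- exists j; split; last by rewrite ia.
  by move=> l lj; rewrite ia ?ja // (ltn_trans lj ji).
- exists i; subst j; split; last exact: tr ir jr.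
  by move=> l li; rewrite ia ?ja.
Qed.

Lemma lexr_total m m' : m <> m' -> lexr m m' \/ lexr m' m.
Proof.
have [_ _ tot] := hr; move=> mm'.
have ex : exists i, m i != m' i.
  by apply: contrapT => h; apply: mm'; apply/funext => i; apply/eqP;
     apply: contrapT => /negP ne; apply: h; exists i.
have eqj j : (j < ex_minn ex)%N -> m j = m' j.
  by case: ex_minnP => i _ min ji; apply/eqP; apply: contraTT ji => /min; rewrite -leqNgt.
have ne : m (ex_minn ex) != m' (ex_minn ex) by case: ex_minnP.
have /orP[h|h] := tot _ _ ne; [left|right]; exists (ex_minn ex); split => //.
by move=> j /eqj.
Qed.

Section PulledBack.
Variables (U : eqType) (f : U -> nat -> T).
Hypothesis f_inj : injective f.
Definition le_lex : rel U := fun a b => (a == b) || `[< lexr (f a) (f b) >].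

Lemma le_lex_total : total le_lex.
Proof.
move=> a b; rewrite /le_lex; have [//|/eqP ab] /= := eqVneq a b.
have [|h|h] := @lexr_total (f a) (f b); first by move/f_inj.
- by move/asboolP: h => ->.
- by move/asboolP: h => ->; rewrite !orbT.
Qed.

Lemma le_lex_trans : transitive le_lex.
Proof.
move=> b a c; rewrite /le_lex => /orP[/eqP -> //|/asboolP ab] /orP[/eqP <-|/asboolP bc].
  by move/asboolP: ab => ->; rewrite orbT.
by apply/orP; right; apply/asboolP; exact: lexr_trans ab bc.
Qed.

Lemma le_lex_anti : antisymmetric le_lex.
Proof.
move=> a b; rewrite /le_lex => /andP[/orP[/eqP //|/asboolP ab] /orP[/eqP //|/asboolP ba]].
by have := lexr_irr (lexr_trans ab ba).
Qed.

End PulledBack.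
End LexicographicOrder.

(** An element of [P] with the fewest elements below it is minimal, since by transitivity and
    irreflexivity a smaller one would have strictly fewer. *)
Lemma finite_minimum (T : finType) (r : rel T) (P : T -> Prop) :
  strict_total_order r -> (exists x, P x) -> exists2 x, P x & forall y, P y -> ~ r y x.
Proof.
move=> [irr tr tot] [x0 Px0].
have Px0' : `[< P x0 >] by exact/asboolP.
case: (@arg_minnP _ x0 (fun x => `[< P x >]) (fun x => #|[pred z | r z x]|) Px0').
move=> x /asboolP Px min; exists x => // y Py yx.
have /min := asboolT Py; apply/negP; rewrite -ltnNge; apply: proper_card.
apply/properP; split; first by apply/fintype.subsetP => z; rewrite !inE => /tr; apply.
by exists y; rewrite !inE ?irr.
Qed.

(* Greedy choice of letters; the limit word is only a limit of elements of [C]. *)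
Lemma greedy_lex_minimum (T : finType) (r : rel T) (C : set (nat -> T)) :
  strict_total_order r -> C !=set0 -> exists2 m, (forall m', C m' -> ~ lexr r m' m)
    & forall n, exists2 c, C c & forall j, (j < n)%N -> c j = m j.
Proof.
move=> hr [c0 Cc0].
have step (c : {c | C c}) n : {c' : {c | C c} |
    (forall j, (j < n)%N -> sval c' j = sval c j) /\
    forall c1, C c1 -> (forall j, (j < n)%N -> c1 j = sval c j) -> ~ r (c1 n) (sval c' n)}.
  apply: cid.
  have [|x [c' [Cc' c'c <-]] min] := @finite_minimum T r
    (fun x => exists c', [/\ C c', forall j, (j < n)%N -> c' j = sval c j & c' n = x]) hr.
    by exists (sval c n), (sval c); split => //; exact: (svalP c).
  exists (exist _ c' Cc'); split => //= c1 Cc1 c1c.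
  by apply: min; exists c1.
pose fix u n : {c | C c} := if n is n'.+1 then sval (step (u n') n') else exist _ c0 Cc0.
(* Stage [n.+1] fixes letter [n] and keeps the earlier ones, so [u n] and [m] agree on the first [n]
   letters. *)
pose m n := sval (u n.+1) n.
have um n j : (j < n)%N -> sval (u n) j = m j.
  elim: n => // n IH; rewrite ltnS leq_eqVlt => /predU1P[->//|jn].
  by have [h _] := svalP (step (u n) n); exact: etrans (h j jn) (IH jn).
exists m; last by move=> n; exists (sval (u n)); [exact: (svalP (u n))|exact: um].
move=> m' Cm' [i [im ir]]; have [_ /(_ m' Cm') h] := svalP (step (u i) i).
by apply: h ir => j ji; rewrite im // um.
Qed.

Section OrderedGraph.
Variables (V W : finType) (E : graph V W) (ltV : rel V) (ltW : rel W).
Hypotheses (hltV : strict_total_order ltV) (hltW : strict_total_order ltW).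

Lemma lt_pair_strict_total : strict_total_order (@Defs.lt_pair V W ltV ltW).
Proof.
have [Vi Vt Vtot] := hltV; have [Wi Wt Wtot] := hltW; split.
- by move=> [e v]; rewrite /Defs.lt_pair /= Wi eqxx Vi.
- move=> [f v] [e u] [g w]; rewrite /Defs.lt_pair /= => /orP[ef|/andP[/eqP -> uv]].
    by move=> /orP[fg|/andP[/eqP <- _]]; rewrite ?(Wt _ _ _ ef fg) ?ef.
  by move=> /orP[->//|/andP[/eqP <- vw]]; rewrite eqxx (Vt _ _ _ uv vw) orbT.
- move=> [e u] [f v] /eqP ne; rewrite /Defs.lt_pair /=.
  have [ef|ef] := eqVneq e f; last by have /orP[->|->] := Wtot _ _ ef; rewrite ?orbT.
  subst f; rewrite ?eqxx !Wi /=.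
  by apply: Vtot; apply/eqP => uv; apply: ne; rewrite uv.
Qed.

Variables (k : nat) (t : {perm gpath E k.+1}).
Hypotheses (hsinks : no_sinks E) (hsync : synchronizing_fst (perm_graph t)).
Local Notation G := (perm_graph t).
Local Notation M a m := (is_M ltV ltW t a m).

(** The greedy word is only a limit of codes. Synchronization plays the role of compactness: edge
    [j] depends only on the first labels at positions [j] to [j + l], so edge [j] of the
    approximating paths stabilizes, and the stable edges form a path that attains the word. *)
Lemma is_M_exists a : exists m, M a m.
Proof.
have C0 : codes_from t a !=set0.
  have [y yP ya] := ipath_exists (perm_graph_no_sinks t hsinks) a.
  by exists (Defs.code t \o y); exists y.
have [m min app] := greedy_lex_minimum lt_pair_strict_total C0.
exists m; split => //.
have [y yE] : exists y : nat -> nat -> gpath E k.+1, forall n,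
    [/\ ipaths G (y n), src G (y n 0%N) = a & forall j, (j < n)%N -> Defs.code t (y n j) = m j].
  have h n : exists y, [/\ ipaths G y, src G (y 0%N) = a &
      forall j, (j < n)%N -> Defs.code t (y j) = m j].
    by have [c [y [yP ya] <-] cm] := app n; exists y.
  by exists (fun n => projT1 (cid (h n))) => n; case: cid.
have [l hl] := sync_src hsync.
have yeq n n' j : (j + l < n)%N -> (j + l < n')%N -> y n j = y n' j.
  move=> jn jn'; have [yP _ yc] := yE n; have [y'P _ y'c] := yE n'.
  apply: (@edge_into_inj _ _ _ _ t).
    by have := yc j; rewrite -y'c ?(leq_ltn_trans (leq_addr l j)) // => /(_ isT) [].
  rewrite yP y'P.
  have := hl (fun i => y n (j.+1 + i)%N) (fun i => y n' (j.+1 + i)%N).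
  rewrite addn0; apply => i; rewrite ?addnS // => il.
  have ijl : (j.+1 + i <= j + l)%N by rewrite addSnnS leq_add2l.
  have := yc (j.+1 + i)%N; rewrite -y'c ?(leq_ltn_trans ijl) //.
  by move=> /(_ isT) [].
pose z j := y (j + l).+1 j.
exists z; last first.
  by apply/funext => j; have [_ _] := yE (j + l).+1; apply; rewrite ltnS leq_addr.
split; last by have [_ ya _] := yE (0 + l).+1.
move=> j; rewrite /z (yeq _ (j.+1 + l).+1) //.
by have [yP _ _] := yE (j.+1 + l).+1; exact: yP.
Qed.

Lemma is_M_unique a m m' : M a m -> M a m' -> m = m'.
Proof.
move=> [Cm min] [Cm' min']; apply: contrapT => /(lexr_total lt_pair_strict_total)[h|h].
  exact: min' Cm h.
exact: min Cm' h.
Qed.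

(** The word contains the first labels of a path from the vertex, so synchronization recovers the
    vertex. This makes the order on vertices total. *)
Lemma is_M_inj a b m : M a m -> M b m -> a = b.
Proof.
move=> [[y [yP /= <-] ym] _] [[y' [y'P /= <-] y'm] _].
have [l hl] := sync_src hsync; apply: hl => // j _.
by have := congr1 (fun z => (z j).1) ym; rewrite -y'm.
Qed.

Definition Mword a : nat -> W * V := projT1 (cid (is_M_exists a)).

Lemma MwordP a m : M a m <-> m = Mword a.
Proof.
have hM : M a (Mword a) by rewrite /Mword; case: cid.
by split=> [/is_M_unique|->//]; apply.
Qed.

Definition M1word mu i := if i is j.+1 then Mword (rng G mu) j else Defs.code t mu.

Lemma M1wordP mu m : is_M1 ltV ltW t mu m <-> m = M1word mu.
Proof.
split=> [[m0 /MwordP mS]|->]; last by split => //; exact/MwordP.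
by apply/funext => -[|i] //=; rewrite -mS.
Qed.

Lemma Mword_inj : injective Mword.
Proof. by move=> a b ab; apply: (@is_M_inj _ _ (Mword a)); apply/MwordP. Qed.

Lemma M1word_inj : injective M1word.
Proof.
move=> mu nu h; have := congr1 (fun z => z 0%N) h; rewrite /= => -[e _].
apply: (@edge_into_inj _ _ _ _ t) => //; apply: Mword_inj; apply/funext => i.
exact: (congr1 (fun z => z i.+1) h).
Qed.

Lemma le_vertexE : le_vertex ltV ltW t = le_lex (Defs.lt_pair ltV ltW) Mword.
Proof.
apply/funext => a; apply/funext => b; rewrite /le_vertex /le_lex; congr (_ || _).
apply/asbool_equiv_eq; split=> [[m [m' [/MwordP -> /MwordP ->]]]//|h].
by exists (Mword a), (Mword b); split => //; exact/MwordP.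
Qed.

Lemma le_edgeE : le_edge ltV ltW t = le_lex (Defs.lt_pair ltV ltW) M1word.
Proof.
apply/funext => a; apply/funext => b; rewrite /le_edge /le_lex; congr (_ || _).
apply/asbool_equiv_eq; split=> [[m [m' [/M1wordP -> /M1wordP ->]]]//|h].
by exists (M1word a), (M1word b); split => //; exact/M1wordP.
Qed.

End OrderedGraph.

(** * Renaming vertices and edges by rank *)

Section OrderedGraphShift.
Variables (V W : finType) (E : graph V W) (ltV : rel V) (ltW : rel W).
Variables (k : nat) (t : {perm gpath E k.+1}).
Local Notation G := (perm_graph t).
Local Notation O := (ordered_perm_graph ltV ltW t).

Lemma overtex_eq (u v : Overtex E k) :
  tag u = tag v -> tagged u = tagged v :> nat -> u = v.
Proof.
case: u v => [u i] [v j] /= uv; subst v => ij.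
by congr existT; apply: ord_inj.
Qed.

Lemma omega0_inj : injective (omega0 ltV ltW t).
Proof.
move=> a b ab.
have uv : (psrc a, prng a) = (psrc b, prng b) := congr1 (@tag _ _) ab.
have := congr1 (fun o : Overtex E k => nat_of_ord (tagged o)) ab; rewrite /= uv.
set s := sort _ _ => ij.
have inS c : (psrc c, prng c) = (psrc b, prng b) -> c \in s.
  by move=> cb; rewrite mem_sort mem_enum -cb inE /= !eqxx.
by rewrite -(nth_index a (inS a uv)) ij nth_index // inS.
Qed.

Lemma omega1_surj mu : exists i, omega1 ltV ltW t i = mu.
Proof.
have : mu \in [tuple of sort (le_edge ltV ltW t) (enum_tuple {: gpath E k.+1})].
  by rewrite mem_sort mem_enum.
by case/tnthP => i ->; exists i.
Qed.

(** Sorting only permutes a list, so ranks separate vertices and every edge gets a symbol; a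
    renaming of this kind preserves the set of label sequences. *)
Lemma ordered_label_shift : label_shift O = label_shift G.
Proof.
apply/seteqP; split=> [_ [y yP <-]|_ [y yP <-]].
  exists (omega1 ltV ltW t \o y) => // i; apply: omega0_inj; exact: yP.
pose z i := projT1 (cid (omega1_surj (y i))).
have zE i : omega1 ltV ltW t (z i) = y i by rewrite /z; case: cid.
exists z; last by apply/funext => i; rewrite /= zE.
by move=> i; rewrite /= !zE; congr omega0; exact: yP.
Qed.

End OrderedGraphShift.

(** Sorting by a total order depends only on the multiset, so [s] may be replaced by [map p s], and
    [p] then moves outside the sort. *)
Lemma sort_iso (T : eqType) (le le' : rel T) (p : T -> T) (s : seq T) :
  total le' -> transitive le' -> antisymmetric le' ->
  (forall x y, le' (p x) (p y) = le x y) -> perm_eq s (map p s) ->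
  sort le' s = map p (sort le s).
Proof.
move=> tot tr anti iso /(perm_sortP tot tr anti) ->.
by rewrite sort_map; congr (map _ (sort _ _)); apply/funext => x; apply/funext => y /=.
Qed.

Lemma perm_eq_map_perm (T : finType) (p : {perm T}) (s : seq T) :
  uniq s -> (forall x, (p x \in s) = (x \in s)) -> perm_eq s (map p s).
Proof.
move=> us ps; apply: uniq_perm; rewrite ?map_inj_uniq //; first exact: perm_inj.
move=> x; rewrite -[x](permKV p) mem_map ?ps //; exact: perm_inj.
Qed.

Section OrderedGraphIsomorphism.
Variables (V W : finType) (E : graph V W) (ltV : rel V) (ltW : rel W).
Hypotheses (hltV : strict_total_order ltV) (hltW : strict_total_order ltW).
Hypothesis hsinks : no_sinks E.
Variables (k : nat) (t t' : {perm gpath E k.+1}).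
Hypothesis hsync' : synchronizing_fst (perm_graph t').
Variable pi : {perm gpath E k}.
Hypotheses (hpi : endpoint_fixing pi) (tt' : g_spec pi t t').
Local Notation tp := (tail_perm hpi).

Lemma iso_code mu : Defs.code t' (tp mu) = Defs.code t mu.
Proof. by rewrite /Defs.code (iso_lab hpi tt'). Qed.

Lemma iso_codes_from a : codes_from t' (pi a) = codes_from t a.
Proof.
apply/seteqP; split=> [_ [y [yP /= ya] <-]|_ [y [yP /= ya] <-]].
  exists ((tp^-1)%g \o y); last first.
    by apply/funext => i; rewrite /comp -iso_code permKV.
  split; last by apply: (@perm_inj _ pi); rewrite -(iso_src hpi tt') /comp permKV.
  by move=> i; apply: (@perm_inj _ pi); rewrite -(iso_src hpi tt') -(iso_rng hpi t t') /comp !permKV.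
exists (tp \o y); last by apply/funext => i; exact: iso_code.
split; last exact: etrans (iso_src hpi tt' _) (congr1 pi ya).
by move=> i; rewrite /comp (iso_src hpi tt') (iso_rng hpi t t') yP.
Qed.

Lemma iso_is_M a m : is_M ltV ltW t' (pi a) m <-> is_M ltV ltW t a m.
Proof. by rewrite /is_M iso_codes_from. Qed.

Lemma iso_le_vertex a b : le_vertex ltV ltW t' (pi a) (pi b) = le_vertex ltV ltW t a b.
Proof.
rewrite /le_vertex (inj_eq perm_inj); congr (_ || _); apply: asbool_equiv_eq.
by split=> -[m [m' [h h' mm']]]; exists m, m'; split => //; exact/iso_is_M.
Qed.

Lemma iso_le_edge mu nu : le_edge ltV ltW t' (tp mu) (tp nu) = le_edge ltV ltW t mu nu.
Proof.
rewrite /le_edge (inj_eq perm_inj); congr (_ || _); apply: asbool_equiv_eq.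
have h la m : is_M1 ltV ltW t' (tp la) m <-> is_M1 ltV ltW t la m.
  by rewrite /is_M1 iso_code (iso_rng hpi t t') iso_is_M.
by split=> -[m [m' [h1 h2 mm']]]; exists m, m'; split => //; exact/h.
Qed.

(** Since [pi] fixes endpoints, it permutes each set of paths with given source and range;
    preserving the order there, it preserves ranks. *)
Lemma iso_omega0 a : omega0 ltV ltW t' (pi a) = omega0 ltV ltW t a.
Proof.
have [pa ra] := (endpoint_fixingP pi).1 hpi a.
apply: overtex_eq; rewrite /= pa ra //.
rewrite (@sort_iso _ (le_vertex ltV ltW t) _ pi); first by rewrite index_map //; exact: perm_inj.
- by rewrite (le_vertexE hltV hltW hsinks hsync'); apply: le_lex_total;
    [exact: lt_pair_strict_total|exact: Mword_inj].
- by rewrite (le_vertexE hltV hltW hsinks hsync'); apply: le_lex_trans;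
    exact: lt_pair_strict_total.
- by rewrite (le_vertexE hltV hltW hsinks hsync'); apply: le_lex_anti;
    exact: lt_pair_strict_total.
- exact: iso_le_vertex.
- apply: perm_eq_map_perm => [|b]; first exact: enum_uniq.
  by have [pb rb] := (endpoint_fixingP pi).1 hpi b; rewrite !mem_enum !inE pb rb.
Qed.

Lemma iso_omega1 i : omega1 ltV ltW t' i = tp (omega1 ltV ltW t i).
Proof.
have mu0 := omega1 ltV ltW t i.
rewrite /omega1 !(tnth_nth mu0) /=.
rewrite (@sort_iso _ (le_edge ltV ltW t) _ tp); first last.
- by apply: perm_eq_map_perm => [|b]; rewrite ?enum_uniq ?mem_enum.
- exact: iso_le_edge.
- by rewrite (le_edgeE hltV hltW hsinks hsync'); apply: le_lex_anti;
    exact: lt_pair_strict_total.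
- by rewrite (le_edgeE hltV hltW hsinks hsync'); apply: le_lex_trans;
    exact: lt_pair_strict_total.
- by rewrite (le_edgeE hltV hltW hsinks hsync'); apply: le_lex_total;
    [exact: lt_pair_strict_total|exact: M1word_inj].
by rewrite (nth_map mu0) // size_sort -cardE.
Qed.

Lemma iso_ordered_perm_graph :
  ordered_perm_graph ltV ltW t = ordered_perm_graph ltV ltW t'.
Proof.
rewrite /ordered_perm_graph; congr LGraph; first congr Graph; apply/funext => i.
- by rewrite /comp iso_omega1 (iso_src hpi tt') iso_omega0.
- by rewrite /comp iso_omega1 (iso_rng hpi t t') iso_omega0.
- by rewrite /comp iso_omega1 (iso_lab hpi tt').
Qed.

End OrderedGraphIsomorphism.

Lemma ordered_perm_graph_label_shift (V W : finType) (E : graph V W)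
    (ltV : rel V) (ltW : rel W) (k : nat) (t t' : {perm gpath E k.+1}) :
  strict_total_order ltV -> strict_total_order ltW ->
  no_sinks E -> no_sources E -> endpoint_fixing t -> endpoint_fixing t' ->
  synchronizing_fst (perm_graph t) -> synchronizing_fst (perm_graph t') ->
  ordered_perm_graph ltV ltW t = ordered_perm_graph ltV ltW t' <->
  label_shift (perm_graph t) = label_shift (perm_graph t').
Proof.
move=> hV hW ns nso ht ht' hs hs'; split=> [h|/label_shift_g_spec].
  by rewrite -!(ordered_label_shift ltV ltW) h.
by case=> // pi hpi tt'; exact: (iso_ordered_perm_graph hV hW ns hs' hpi tt').
Qed.

(** * Words read along a path of a permutation graph *)

Section OutputWords.
Variables (V W : finType) (E : graph V W) (k : nat) (t : {perm gpath E k.+1}).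
Hypothesis ht : endpoint_fixing t.
Local Notation G := (perm_graph t).

Definition in_word (g : nat -> gpath E k.+1) (i : nat) : W := (lab G (g i)).1.

(* The word [b f_0 f_1 ...], where [b] is the initial vertex of the path [g] of
   [perm_graph t], itself a path of length [k] in [E], and the [f_i] are the
   second labels along [g]. *)
Definition out_word (g : nat -> gpath E k.+1) (i : nat) : W :=
  if (i < k)%N then nth (lab G (g 0%N)).2 (edges (src G (g 0%N))) i
  else (lab G (g (i - k)%N)).2.

(** The clause on [prng] carries the induction: the range of the current vertex is where the next
    second label starts. *)
Lemma out_word_prefix g n : ipaths G g -> exists nu : gpath E (n + k),
  [/\ psrc nu = psrc (src G (g 0%N)), edges nu = mkseq (out_word g) (n + k) :> seq W
    & prng nu = prng (src G (g n))].
Proof.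
move=> gP; elim: n => [|n [nu [ns ne nr]]].
  exists (src G (g 0%N)); split => //.
  apply: (@eq_from_nth _ (lab G (g 0%N)).2); first by rewrite size_mkseq size_tuple.
  by move=> i; rewrite size_tuple => ik; rewrite nth_mkseq // /out_word ik.
have [nu' [nf nl]] : exists nu' : gpath E (n.+1 + k),
    path_front nu' = nu /\ last_edge nu' = (lab G (g n)).2.
  by apply: rcons_path_exists; rewrite nr prng_src.
exists nu'; split.
- by rewrite -psrc_front nf ns.
- rewrite edges_front_last nf ne nl addSn mkseqS; congr rcons.
  by rewrite /out_word ltnNge leq_addl addnK.
- by rewrite prng_last nl -gP prng_rng.
Qed.

Lemma walk_nth (v : V) s x0 i : walk E v s -> (i.+1 < size s)%N ->
  rng E (nth x0 s i) = src E (nth x0 s i.+1).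
Proof.
elim: s v i => [|e s IH] v i //= /andP[_ w]; case: i => [|i]; last exact: IH w.
by case: s w {IH} => [|f s] //= /andP[/eqP -> _].
Qed.

Lemma out_word_ipath g : ipaths G g -> ipaths E (out_word g).
Proof.
move=> gP i; have [nu [_ ne _]] := out_word_prefix i.+2 gP.
have := gpath_walk nu; rewrite -/(psrc nu) -/(edges nu) ne => w.
have := @walk_nth _ _ (out_word g 0%N) i w; rewrite size_mkseq ltn_addr // => /(_ isT).
by rewrite !nth_mkseq ?ltn_addr.
Qed.

Lemma out_word_src g : ipaths G g -> psrc (src G (g 0%N)) = src E (out_word g 0%N).
Proof.
move=> gP; have [nu [<- ne _]] := out_word_prefix 1 gP.
rewrite psrc_first; congr (src E _).
by have := ne; rewrite edges_first_tail mkseq_cons => -[].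
Qed.

(** The path is built forwards: the prefix of length [k] is its initial vertex, and [edge_from]
    yields an edge with any admissible second label. *)
Lemma out_word_surj z : ipaths E z -> exists2 g, ipaths G g & out_word g = z.
Proof.
move=> zP; have [b [bs be]] := prefix_path_exists k zP.
have bz : prng b = src E (z k).
  have [c [cs ce]] := prefix_path_exists k.+1 zP.
  have [cf cl] : edges (path_front c) = mkseq z k :> seq W /\ last_edge c = z k.
    by have := ce; rewrite edges_front_last mkseqS => /rcons_inj[].
  have <- : path_front c = b.
    apply: gpath_eq; first by rewrite psrc_front cs bs.
    by apply: val_inj; rewrite /= cf be.
  by rewrite prng_front cl.
pose T j := {mu : gpath E k.+1 | (lab G mu).2 = z (k + j)%N}.
have nxt j (mu : T j) : {nu : T j.+1 | src G (sval nu) = rng G (sval mu)}.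
  apply: cid; have [|nu [nl ns]] := @edge_from _ _ _ _ t (z (k + j.+1)%N) (rng G (sval mu)).
    by rewrite prng_rng // (svalP mu) zP addnS.
  by exists (exist _ nu nl).
have [mu0 [mul mus]] := edge_from t bz.
have mul' : (lab G mu0).2 = z (k + 0)%N by rewrite addn0.
pose fix h j : T j := if j is i.+1 then sval (nxt i (h i)) else exist _ mu0 mul'.
exists (fun j => sval (h j)).
  by move=> j; rewrite /= -/(h j); exact/esym/(svalP (nxt j (h j))).
apply/funext => i; rewrite /out_word; case: ltnP => ik; last first.
  by rewrite (svalP (h (i - k)%N)) subnKC.
by rewrite [sval (h 0%N)]/= mus be nth_mkseq.
Qed.

(** The first [n + m] input labels fix the vertices at positions up to [n], hence the edges before
    [n]. The output letters below [k] are already part of the initial vertex. *)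
Lemma out_word_determined : synchronizing_fst G -> forall n, exists l, forall g g',
  ipaths G g -> ipaths G g' -> (forall j, (j < l)%N -> in_word g j = in_word g' j) ->
  psrc (src G (g 0%N)) = psrc (src G (g' 0%N)) /\
  mkseq (out_word g) n = mkseq (out_word g') n.
Proof.
move=> hsync n; have [m hm] := sync_src hsync; exists (n + m)%N => g g' gP g'P gg'.
have vE j : (j <= n)%N -> src G (g j) = src G (g' j).
  move=> jn; have := hm (fun i => g (j + i)%N) (fun i => g' (j + i)%N).
  rewrite addn0; apply => i; rewrite ?addnS // => im.
  by apply: gg'; rewrite (leq_trans _ (leq_add jn (leqnn m))) // ltn_add2l.
have eE j : (j < n)%N -> g j = g' j.
  move=> jn; apply: (@edge_into_inj _ _ _ _ t); first by apply: gg'; rewrite ltn_addr.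
  by rewrite gP g'P vE.
split; first by rewrite vE.
apply/eq_in_map => i; rewrite mem_iota add0n => /= ij.
rewrite /out_word; case: ltnP => ik; last by rewrite eE // (leq_ltn_trans (leq_subr _ _)).
by rewrite vE //; apply: set_nth_default; rewrite size_tuple.
Qed.

End OutputWords.

Local Open Scope cstar_scope.

(** * Automatic continuity *)

Section ClosedSets.
Variables (K : numFieldType) (V : normedModType K).

Lemma closed_normP (D : set V) :
  closed D <-> forall x, (forall e, 0 < e -> exists2 y, D y & `|x - y| < e) -> D x.
Proof.
split=> [cD x xD|h x xD].
  apply: cD => B /nbhs_normP[e /= e0 eB].
  by have [y Dy xy] := xD e e0; exists y; split => //; exact: eB.
apply: h => e e0; have [|y [Dy xy]] := xD (ball x e); first exact: nbhsx_ballx.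
by exists y => //; move: xy; rewrite -ball_normE.
Qed.

Lemma norm_small_eq0 (x : V) : (forall e, 0 < e -> `|x| <= e) -> x = 0.
Proof.
move=> h; apply/eqP; apply: contraT => x0.
have n0 : 0 < `|x| by rewrite normr_gt0.
have := h (`|x| / 2); rewrite divr_gt0 // => /(_ isT).
rewrite ler_pdivlMr // mulr_natr mulr2n gerDl => le.
by have := lt_le_trans n0 le; rewrite ltxx.
Qed.

End ClosedSets.

Section CstarBasics.
Variables (R : realType) (A : cstarType R).
Implicit Types (x y z h b u : A) (D : set A).
Local Notation C := R[i].

Lemma cmul0x x : 0 ** x = 0.
Proof. by apply: (addrI (0 ** x)); rewrite -cmulDl !addr0. Qed.
Lemma cmulx0 x : x ** 0 = 0.
Proof. by apply: (addrI (x ** 0)); rewrite -cmulDr !addr0. Qed.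
Lemma cmulNx x y : (- x) ** y = - (x ** y).
Proof. by apply: (addrI (x ** y)); rewrite -cmulDl !subrr cmul0x. Qed.
Lemma cmulxN x y : x ** (- y) = - (x ** y).
Proof. by apply: (addrI (x ** y)); rewrite -cmulDr !subrr cmulx0. Qed.
Lemma cmulBl x y z : (x - y) ** z = x ** z - y ** z.
Proof. by rewrite cmulDl cmulNx. Qed.
Lemma cmulBr x y z : x ** (y - z) = x ** y - x ** z.
Proof. by rewrite cmulDr cmulxN. Qed.
Lemma adj0 : adj (0 : A) = 0.
Proof. by apply: (addrI (adj 0)); rewrite -adjD !addr0. Qed.
Lemma adjN x : adj (- x) = - adj x.
Proof. by apply: (addrI (adj x)); rewrite -adjD !subrr adj0. Qed.
Lemma adjB x y : adj (x - y) = adj x - adj y.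
Proof. by rewrite adjD adjN. Qed.
Lemma cmul_suml (I : Type) (r : seq I) (Q : pred I) (F : I -> A) y :
  (\sum_(i <- r | Q i) F i) ** y = \sum_(i <- r | Q i) F i ** y.
Proof. by apply: (big_morph (fun a => a ** y)) => [a b|]; rewrite ?cmulDl ?cmul0x. Qed.
Lemma cmul_sumr (I : Type) (r : seq I) (Q : pred I) (F : I -> A) y :
  y ** (\sum_(i <- r | Q i) F i) = \sum_(i <- r | Q i) y ** F i.
Proof. by apply: (big_morph (fun a => y ** a)) => [a b|]; rewrite ?cmulDr ?cmulx0. Qed.
Lemma adj_sum (I : Type) (r : seq I) (Q : pred I) (F : I -> A) :
  adj (\sum_(i <- r | Q i) F i) = \sum_(i <- r | Q i) adj (F i).
Proof. by apply: (big_morph _ (@adjD _ _) adj0). Qed.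

Lemma norm_adj x : `|adj x| = `|x|.
Proof.
have half y : `|y| <= `|adj y|.
  have [->|y0] := eqVneq y 0; first by rewrite adj0.
  have n0 : 0 < `|y| by rewrite normr_gt0.
  by rewrite -(ler_pM2r n0) -expr2 -cstar_identity cnormM.
by apply/eqP; rewrite eq_le half -{2}[x]adjK half.
Qed.

Lemma norm_projection_le1 x : is_projection x -> `|x| <= 1.
Proof.
move=> [xa xx]; have := cstar_identity x; rewrite xa xx => h.
have [->|x0] := eqVneq x 0; first by rewrite normr0 ler01.
have n0 : 0 < `|x| by rewrite normr_gt0.
by rewrite -(ler_pM2l n0) mulr1 -expr2 -h.
Qed.

Lemma cvg_cmul (u v : nat -> A) x y : u @ \oo --> x -> v @ \oo --> y ->
  (fun n => u n ** v n) @ \oo --> x ** y.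
Proof.
move=> ux vy; apply/cvgrPdist_lt => e e0.
have M0 : 0 < `|x| + `|y| + 1 by rewrite ltr_wpDl ?addr_ge0.
pose d := e / (`|x| + `|y| + 1) / 2.
have d0 : 0 < d by rewrite !divr_gt0.
near=> n.
have h1 : `|x - u n| < d by near: n; exact: cvgr_dist_lt.
have h2 : `|y - v n| < d by near: n; exact: cvgr_dist_lt.
have h3 : `|y - v n| < 1 by near: n; exact: cvgr_dist_lt.
rewrite (_ : _ - _ = x ** (y - v n) + (x - u n) ** v n); last first.
  by rewrite cmulBr cmulBl addrA subrK.
have vn : `|v n| <= `|y| + 1.
  rewrite -[v n](subKr y); apply: le_trans (ler_normB _ _) _.
  by rewrite lerD // ltW.
apply: le_lt_trans (ler_normD _ _) _.
apply: le_lt_trans (_ : `|x| * d + d * (`|y| + 1) < _).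
  apply: lerD; apply: le_trans (cnormM _ _) _.
    by rewrite ler_wpM2l // ltW.
  by rewrite ler_pM // ltW.
rewrite mulrC -mulrDr addrA /d mulrAC divfK ?gt_eqF //.
by rewrite ltr_pdivrMr // ltr_pMr // ltr1n.
Unshelve. all: by end_near.
Qed.

Lemma cvg_adj (u : nat -> A) x : u @ \oo --> x -> (fun n => adj (u n)) @ \oo --> adj x.
Proof.
move=> ux; apply/cvgrPdist_lt => e e0; near=> n.
by rewrite -adjB norm_adj; near: n; exact: cvgr_dist_lt.
Unshelve. all: by end_near.
Qed.

Lemma half_pow_small (e : C) : 0 < e -> exists N, forall n, (N <= n)%N -> 2 * 2^-1 ^+ n < e.
Proof.
move=> e0; have eE : e = (complex.Re e)%:C%C.
  by case: e e0 => a b; rewrite ltcE /= => /andP[/eqP -> _].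
have r0 : 0 < complex.Re e by rewrite -ltcR -eE.
pose N := Num.bound (2 / complex.Re e); exists N => n Nn.
have le2 : 2 / complex.Re e < 2 ^+ n.
  apply: lt_le_trans (archi_boundP _) _; first by rewrite divr_ge0 // ltW.
  by rewrite -natrX ler_nat (leq_trans Nn) // ltnW // ltn_expl.
rewrite eE -(rmorph_nat (real_complex R) 2) -fmorphV -rmorphXn -rmorphM ltcR.
by rewrite exprVn ltr_pdivrMr ?exprn_gt0 // mulrC -ltr_pdivrMr.
Qed.

Lemma geometric_cvg (u : nat -> A) :
  (forall n, `|u n.+1 - u n| <= 2^-1 ^+ n) -> cvg (u @ \oo).
Proof.
move=> hu.
(* The partial sum of the geometric series is kept exact so that the induction closes. *)
have far n k : `|u (n + k)%N - u n| <= 2 * 2^-1 ^+ n * (1 - 2^-1 ^+ k).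
  elim: k => [|k IH]; first by rewrite addn0 subrr normr0 expr0 subrr mulr0.
  rewrite addnS -(subrK (u (n + k)%N) (u _)) -addrA.
  apply: le_trans (ler_normD _ _) _.
  apply: le_trans (lerD (hu _) IH) _.
  rewrite le_eqVlt; apply/orP; left; apply/eqP.
  by rewrite exprD exprS; field.
have half0 n : 0 <= 2^-1 ^+ n :> C by rewrite exprn_ge0 // invr_ge0.
have far2 n m : (n <= m)%N -> `|u m - u n| <= 2 * 2^-1 ^+ n.
  move=> nm; rewrite -(subnKC nm); apply: le_trans (far _ _) _.
  by rewrite ler_piMr ?mulr_ge0 // gerBl.
apply: cauchy_cvg; apply: cauchy_exP => e e0.
have [N /(_ N (leqnn N)) hN] := half_pow_small e0.
exists (u N); change (\forall n \near \oo, ball (u N) e (u n)); near=> n; rewrite -ball_normE /ball_ /= distrC.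
apply: le_lt_trans hN; apply: far2; near: n; exact: nbhs_infty_ge.
Unshelve. all: end_near.
Qed.


(** The algebras carry no unit in their structure; here it is an element relative to [D], so that
    the whole algebra and the diagonal are treated alike. *)
Definition unit_of D u : Prop := D u /\ forall x, D x -> u ** x = x /\ x ** u = x.

Lemma unit_of_projection D u : is_cstar_subalgebra D -> unit_of D u -> is_projection u.
Proof.
move=> [_ [_ _ _ _ Dadj]] [Du hu]; have [_ uu] := hu _ Du; split => //.
have [h1 _] := hu _ (Dadj _ Du).
by rewrite -{2}(adjK u) -[in RHS]h1 adjM adjK.
Qed.

(* [b] is [1 - sqrt (1 - h^2)], obtained as the attracting fixed point of
   [b |-> (h^2 + b^2) / 2] in the ball of radius 1/4. *)
Lemma sqrt_fixpoint D h : is_cstar_subalgebra D -> D h -> adj h = h -> `|h| <= 2^-1 ->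
  exists b, [/\ D b, adj b = b, h ** b = b ** h & b + b = h ** h + b ** b].
Proof.
move=> [Dcl [D0 Dadd Dscale Dmul Dadj]] Dh hh hle.
pose F b := 2^-1 *: (h ** h + b ** b).
pose u n := iter n F 0.
have q0 : 0 <= 4^-1 :> C by rewrite invr_ge0.
have uN n : `|u n| <= 4^-1.
  elim: n => [|n IH]; first by rewrite normr0.
  rewrite /= normrZ ger0_norm ?invr_ge0 //.
  apply: le_trans (_ : 2^-1 * (2^-1 * 2^-1 + 4^-1 * 4^-1) <= _).
    rewrite ler_wpM2l ?invr_ge0 //; apply: le_trans (ler_normD _ _) _.
    by rewrite lerD //; apply: le_trans (cnormM _ _) _; rewrite ler_pM.
  rewrite (_ : _ * _ = 4^-1 * (8^-1 * 5)); last by field.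
  by rewrite ler_piMr // ler_pdivrMl // mulr1 ler_nat.
have uD n : D (u n).
  by elim: n => //= n IH; apply: Dscale; apply: Dadd; apply: Dmul.
have uadj n : adj (u n) = u n.
  elim: n => [|n IH] /=; first exact: adj0.
  by rewrite Defs.adjZ adjD !adjM hh IH fmorphV rmorph_nat.
have ucomm n : h ** u n = u n ** h.
  elim: n => [|n IH] /=; first by rewrite cmulx0 cmul0x.
  rewrite cscalerAl cscalerAr cmulDl cmulDr !cmulA; congr (_ *: (_ + _)).
  by rewrite IH -cmulA IH cmulA.
(* [F] contracts by 1/4 on the ball of radius 1/4, which beats the rate 1/2 asked for by
   [geometric_cvg]. *)
have ucvg : cvg (u @ \oo).
  apply: geometric_cvg; elim=> [|n IH].
    by rewrite subr0 expr0; apply: le_trans (uN _) _; rewrite invf_le1 ?ler1n.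
  have -> : u n.+2 - u n.+1 = 2^-1 *: (u n.+1 ** u n.+1 - u n ** u n).
    by rewrite -[u n.+2]/(F (u n.+1)) -{2}[u n.+1]/(F (u n)) -scalerBr opprD addrACA subrr add0r.
  rewrite normrZ ger0_norm ?invr_ge0 // exprS ler_wpM2l ?invr_ge0 //.
  rewrite (_ : _ - _ = u n.+1 ** (u n.+1 - u n) + (u n.+1 - u n) ** u n); last first.
    by rewrite cmulBr cmulBl addrA subrK.
  apply: le_trans (ler_normD _ _) _.
  apply: le_trans (_ : 4^-1 * `|u n.+1 - u n| + `|u n.+1 - u n| * 4^-1 <= _).
    by rewrite lerD //; apply: le_trans (cnormM _ _) _; rewrite ler_pM.
  rewrite (_ : _ + _ = 2^-1 * `|u n.+1 - u n|); last by field.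
  by apply: le_trans IH; rewrite ler_piMl // invf_le1 ?ler1n.
have [b ub] := (cvg_ex _).1 ucvg; exists b.
have ub1 : (fun n => u n.+1) @ \oo --> b by rewrite (cvg_shiftS u).
split.
- by apply: (closed_cvg _ Dcl _ _ ub); exact: nearW.
- apply: (cvg_unique _ (cvg_adj ub)) => //.
  by rewrite (_ : (fun n => adj (u n)) = u) //; apply/funext.
- apply: (cvg_unique _ (cvg_cmul (cvg_cst h) ub)) => //.
  rewrite (_ : (fun n => _) = (fun n => u n ** h)); last exact/funext.
  exact: cvg_cmul ub (cvg_cst h).
- have c1 : (fun n => u n.+1 + u n.+1) @ \oo --> b + b by exact: (cvgD ub1 ub1).
  have c2 : (fun n => u n.+1 + u n.+1) @ \oo --> h ** h + b ** b.
    rewrite (_ : (fun n => _) = fun n => h ** h + u n ** u n); last first.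
      by apply/funext => n /=; rewrite /F -scalerDl -div1r -splitr scale1r.
    exact: cvgD (cvg_cst _) (cvg_cmul ub ub).
  exact: (norm_cvg_unique c1 c2).
Qed.

(** [c = u - b] is a self-adjoint square root of [u - h ** h] commuting with [h]; the unitary is
    [h + 'i *: c]. *)
Lemma half_sum_of_unitaries D u h : is_cstar_subalgebra D -> unit_of D u ->
  D h -> adj h = h -> `|h| <= 2^-1 ->
  exists w, [/\ D w, adj w ** w = u, w ** adj w = u & w + adj w = h + h].
Proof.
move=> Dsub uD Dh hh hle.
have [ua uu] := unit_of_projection Dsub uD.
have [b [Db ba bh bb]] := sqrt_fixpoint Dsub Dh hh hle.
have [[Du uE] [_ [_ Dadd Dscale _ _]]] := (uD, Dsub).
pose c := u - b.
have ca : adj c = c by rewrite /c adjB ua ba.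
have ch : h ** c = c ** h.
  by rewrite /c cmulBr cmulBl bh; have [-> ->] := uE _ Dh.
have cc : c ** c = u - h ** h.
  rewrite /c cmulBr !cmulBl uu; have [-> ->] := uE _ Db.
  by rewrite opprB addrA addrAC -[u - b - b]addrA -opprD bb opprD addrA subrK.
have Dc : D c by rewrite /c -scaleN1r; apply: Dadd => //; exact: Dscale.
have wa : adj (h + 'i *: c) = h - 'i *: c.
  by rewrite adjD Defs.adjZ hh ca conjCi scaleNr.
have ii x : 'i *: ('i *: x) = - x :> A by rewrite scalerA -expr2 sqrCi scaleN1r.
exists (h + 'i *: c); split.
- by apply: Dadd => //; exact: Dscale.
- rewrite wa cmulDr !cmulBl !cscalerAl !cscalerAr ii ch cc.
  by rewrite opprK addrA subrK addrC subrK.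
- rewrite wa cmulBr !cmulDl !cscalerAl !cscalerAr ii ch cc.
  by rewrite opprD opprK addrA addrK addrC subrK.
- by rewrite wa addrACA subrr addr0.
Qed.

Lemma is_cstar_subalgebraT : is_cstar_subalgebra [set: A].
Proof. by split; first exact: closedT. Qed.

(** A character has modulus 1 on unitaries, hence at most 1 on self-adjoint elements of norm at most
    1/2. Applying this to [adj y ** y], with [y] the multiple of [x] of norm 1/2, gives the factor
    2. *)
Lemma character_bounded D u chi : is_cstar_subalgebra D -> unit_of D u ->
  is_character D chi -> forall x, D x -> `|chi x| <= 2 * `|x|.
Proof.
move=> Dsub uD [chiL chiM chiA [x0 Dx0 chix0]].
have [[Du uE] [_ [D0 Dadd Dscale Dmul Dadj]]] := (uD, Dsub).
have chi0 : chi 0 = 0.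
  have := chiL 1 0 0 D0 D0; rewrite scale1r addr0 mul1r => h.
  by apply: (addrI (chi 0)); rewrite addr0.
have chiD x y : D x -> D y -> chi (x + y) = chi x + chi y.
  by move=> Dx Dy; rewrite -{1}[x]scale1r chiL // mul1r.
have chiZ c x : D x -> chi (c *: x) = c * chi x.
  by move=> Dx; rewrite -[c *: x]addr0 chiL // chi0 addr0.
have chi1 : chi u = 1.
  have := chiM _ _ Du Dx0; have [-> _] := uE _ Dx0 => h.
  by apply: (mulIf chix0); rewrite mul1r -h.
have small h : D h -> adj h = h -> `|h| <= 2^-1 -> `|chi h| <= 1.
  move=> Dh hh hle.
  have [w [Dw ww _ wh]] := half_sum_of_unitaries Dsub uD Dh hh hle.
  have nw : `|chi w| = 1.
    apply/eqP; rewrite -(@eqrXn2 _ 2) // expr1n normCK mulrC -chiA // -chiM //.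
      by rewrite ww chi1.
    exact: Dadj.
  have : chi h *+ 2 = chi w + (chi w)^*.
    by rewrite mulr2n -chiD // -wh chiD //; [rewrite chiA|exact: Dadj].
  move/(congr1 Num.norm); rewrite normrMn => h2.
  rewrite -(ler_pMn2r (n := 2)) // h2; apply: le_trans (ler_normD _ _) _.
  by rewrite norm_conjC nw.
move=> x Dx; have [->|xn] := eqVneq x 0; first by rewrite chi0 !normr0 mulr0.
have n0 : 0 < `|x| by rewrite normr_gt0.
pose y := (2 * `|x|)^-1 *: x.
have Dy : D y by exact: Dscale.
have yn : `|y| = 2^-1.
  by rewrite normrZ normfV normrM normr_id ger0_norm // invfM -mulrA mulVf ?mulr1 ?gt_eqF.
have : `|chi (adj y ** y)| <= 1.
  apply: small; first by apply: Dmul => //; exact: Dadj.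
    by rewrite adjM adjK.
  rewrite cstar_identity yn expr2; apply: ler_piMl; first by rewrite invr_ge0.
  by rewrite invf_le1 ?ler1n.
rewrite chiM ?chiA //; last exact: Dadj.
rewrite mulrC -normCK normrX normr_id expr_le1 // /y chiZ // normrM normfV normrM normr_id.
by rewrite (@ger0_norm _ 2) // ler_pdivrMl ?mulr_gt0 // mulr1.
Qed.

End CstarBasics.

(** The argument for characters carries over: [f u] is a projection, so its norm is at most 1, and
    by the C*-identity [f] has norm at most 1 on unitaries. *)
Lemma star_hom_bounded (R : realType) (A B : cstarType R) (u : A) (f : A -> B) :
  unit_of [set: A] u -> star_hom f -> forall x, `|f x| <= 2 * `|x|.
Proof.
move=> uA [flin fM fA].
have fZ c x : f (c *: x) = c *: f x.
  have f0 : f 0 = 0.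
    have := flin 1 0 0; rewrite !scale1r addr0 => h.
    by apply: (addrI (f 0)); rewrite addr0.
  by have := flin c x 0; rewrite !addr0 f0 addr0.
have fD x y : f (x + y) = f x + f y by have := flin 1 x y; rewrite !scale1r.
have f0 : f 0 = 0 by have := fZ 0 0; rewrite !scale0r.
have [ua uu] := unit_of_projection (is_cstar_subalgebraT A) uA.
have fu1 : `|f u| <= 1.
  by apply: norm_projection_le1; split; rewrite -?fA -?fM ?ua ?uu.
have unitary w : adj w ** w = u -> `|f w| <= 1.
  move=> ww; rewrite -(@ler_pXn2r _ 2) ?nnegrE // expr1n -cstar_identity.
  by rewrite -fA -fM ww.
have small h : adj h = h -> `|h| <= 2^-1 -> `|f h| <= 1.
  move=> hh hle.
  have [w [_ ww wa wh]] := half_sum_of_unitaries (is_cstar_subalgebraT A) uA I hh hle.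
  have : f h *+ 2 = f w + f (adj w) by rewrite mulr2n -!fD wh.
  move/(congr1 Num.norm); rewrite normrMn => h2.
  rewrite -(ler_pMn2r (n := 2)) // h2; apply: le_trans (ler_normD _ _) _.
  by rewrite mulr2n lerD ?unitary // adjK.
move=> x; have [->|xn] := eqVneq x 0; first by rewrite f0 !normr0 mulr0.
have n0 : 0 < `|x| by rewrite normr_gt0.
pose y := (2 * `|x|)^-1 *: x.
have yn : `|y| = 2^-1.
  by rewrite normrZ normfV normrM normr_id ger0_norm // invfM -mulrA mulVf ?mulr1 ?gt_eqF.
have : `|f (adj y ** y)| <= 1.
  apply: small; first by rewrite adjM adjK.
  rewrite cstar_identity yn expr2; apply: ler_piMl; first by rewrite invr_ge0.
  by rewrite invf_le1 ?ler1n.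
rewrite fM fA cstar_identity expr_le1 // /y fZ normrZ normfV normrM normr_id.
by rewrite (@ger0_norm _ 2) // ler_pdivrMl ?mulr_gt0 // mulr1.
Qed.

(** * Cuntz-Krieger families *)

Section ClosedSubalgebras.
Variables (R : realType) (A : cstarType R).
Implicit Types (x y : A) (D X Q : set A).

Lemma closed_lipschitz (B : cstarType R) (f : A -> B) (c : R[i]) (D : set B) :
  (forall x y, `|f x - f y| <= c * `|x - y|) -> closed D -> closed [set x | D (f x)].
Proof.
move=> fl /closed_normP cD; apply/closed_normP => x h; apply: cD => e e0.
have c0 : 0 < `|c| + 1 by rewrite ltr_wpDl.
have [|y Dy xy] := h (e / (`|c| + 1)); first by rewrite divr_gt0.
exists (f y) => //; apply: le_lt_trans (fl _ _) _.
have [->|xy0] := eqVneq (`|x - y|) 0; first by rewrite mulr0.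
have n0 : 0 < `|x - y| by rewrite lt_def xy0 normr_ge0.
have cr : c <= `|c| + 1.
  have cge : 0 <= c by rewrite -(pmulr_lge0 _ n0) (le_trans _ (fl x y)).
  by rewrite ger0_norm // lerDl.
apply: le_lt_trans (_ : (`|c| + 1) * `|x - y| < _); first by rewrite ler_wpM2r.
by rewrite mulrC -ltr_pdivlMr.
Qed.

Lemma closed_eq_lipschitz (f g : A -> A) (c d : R[i]) :
  (forall x y, `|f x - f y| <= c * `|x - y|) ->
  (forall x y, `|g x - g y| <= d * `|x - y|) -> closed [set x | f x = g x].
Proof.
move=> fl gl.
have -> : [set x | f x = g x] = [set x | [set 0] (f x - g x)].
  by apply/seteqP; split => x /= => [->|/eqP]; rewrite ?subrr // subr_eq0 => /eqP.
apply: (@closed_lipschitz _ _ (c + d)) => [x y|].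
  rewrite opprD opprK addrACA [- g x + g y]addrC mulrDl.
  by apply: le_trans (ler_normD _ _) _; rewrite lerD // distrC.
by apply/closed_normP => x h; apply: norm_small_eq0 => e e0; have [y -> ] := h e e0; rewrite subr0 => /ltW.
Qed.

Lemma is_cstar_subalgebra_generated X : is_cstar_subalgebra (cstar_generated X).
Proof.
split; first by apply: closed_bigI => Q [[]].
split=> [Q [[_ []] //]|x y hx hy Q QX|c x hx Q QX|x y hx hy Q QX|x hx Q QX];
  have [[_ [_ hD hZ hM ha]] _] := QX.
- by apply: hD; [exact: hx|exact: hy].
- by apply: hZ; exact: hx.
- by apply: hM; [exact: hx|exact: hy].
- by apply: ha; exact: hx.
Qed.

Lemma generated_sub X x : X x -> cstar_generated X x.
Proof. by move=> Xx Q [_]; apply. Qed.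

Lemma generated_ind X Q : is_cstar_subalgebra Q -> X `<=` Q -> cstar_generated X `<=` Q.
Proof. by move=> hQ XQ x; apply. Qed.

Lemma subalgebra_sum D (I : Type) (r : seq I) (p : pred I) (F : I -> A) :
  is_cstar_subalgebra D -> (forall i, p i -> D (F i)) -> D (\sum_(i <- r | p i) F i).
Proof.
by move=> [_ [D0 DD _ _ _]] DF; apply: (big_ind D).
Qed.

Lemma cmul_lipschitz_l a x y : `|a ** x - a ** y| <= `|a| * `|x - y|.
Proof. by rewrite -cmulBr cnormM. Qed.

Lemma cmul_lipschitz_r a x y : `|x ** a - y ** a| <= `|a| * `|x - y|.
Proof. by rewrite -cmulBl mulrC cnormM. Qed.

End ClosedSubalgebras.

Section StarHoms.
Variables (R : realType) (A B : cstarType R) (f : A -> B).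
Hypothesis hf : star_hom f.

Lemma star_hom0 : f 0 = 0.
Proof.
have [fl _ _] := hf; have := fl 1 0 0; rewrite !scale1r addr0 => h.
by apply: (addrI (f 0)); rewrite addr0.
Qed.

Lemma star_homD x y : f (x + y) = f x + f y.
Proof. by have [fl _ _] := hf; have := fl 1 x y; rewrite !scale1r. Qed.

Lemma star_homZ c x : f (c *: x) = c *: f x.
Proof. by have [fl _ _] := hf; have := fl c x 0; rewrite !addr0 star_hom0 addr0. Qed.

Lemma star_homB x y : f (x - y) = f x - f y.
Proof. by rewrite star_homD -scaleN1r star_homZ scaleN1r. Qed.

Lemma star_hom_sum (I : Type) (r : seq I) (p : pred I) (F : I -> A) :
  f (\sum_(i <- r | p i) F i) = \sum_(i <- r | p i) f (F i).
Proof. exact: (big_morph _ star_homD star_hom0). Qed.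

Lemma star_hom_lipschitz u x y : unit_of [set: A] u -> `|f x - f y| <= 2 * `|x - y|.
Proof. by move=> hu; rewrite -star_homB; exact: star_hom_bounded hu hf _. Qed.

End StarHoms.

Section CuntzKriegerFamily.
Variables (R : realType) (V W : finType) (E : graph V W) (A : cstarType R).
Variables (P : V -> A) (S : W -> A).
Hypothesis hck : cuntz_krieger E P S.
Hypothesis hsinks : no_sinks E.
Local Notation S_path := (S_path P S).
Local Notation P_path := (P_path P S).
Local Notation one := (cstar_one P).
Implicit Types (u v : V) (e f : W).

Lemma ckP v : adj (P v) = P v /\ P v ** P v = P v.
Proof. have [[h _] _ _ _ _] := hck; exact: h. Qed.

Lemma ckPP u v : P u ** P v = if u == v then P v else 0.
Proof.
have [[h h'] _ _ _ _] := hck; case: eqP => [->|/eqP]; last exact: h'.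
exact: (h v).2.
Qed.

Lemma ckSS e f : adj (S e) ** S f = if e == f then P (rng E f) else 0.
Proof. by have [_ _ [h h'] _ _] := hck; case: eqP => [->|/eqP /h']. Qed.

Lemma ckSP e : S e ** P (rng E e) = S e.
Proof. by have [_ h _ _ _] := hck; have := ckSS e e; rewrite eqxx => <-; rewrite cmulA; exact: h. Qed.

Lemma ckP_sum v : P v = \sum_(e | src E e == v) S e ** adj (S e).
Proof. by have [_ _ _ _ h] := hck; apply: h. Qed.

Lemma ckPS v e : P v ** S e = if v == src E e then S e else 0.
Proof.
have h : P (src E e) ** S e = S e.
  rewrite ckP_sum cmul_suml (bigD1 e) //= -cmulA ckSS eqxx ckSP big1 ?addr0 //.
  by move=> f /andP[_ fe]; rewrite -cmulA ckSS (negbTE fe) cmulx0.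
case: eqP => [->//|ve]; rewrite -h cmulA ckPP; case: eqP => // _; exact: cmul0x.
Qed.

Lemma S_walk_cons v e q : S_walk E P S v (e :: q) = S e ** S_walk E P S (rng E e) q.
Proof. by case: q => [|f q] //=; rewrite ckSP. Qed.

Lemma S_walk_rcons v q f : src E f = last v (map (rng E) q) ->
  S_walk E P S v (rcons q f) = S_walk E P S v q ** S f.
Proof.
elim: q v => [|e q IH] v h.
  by rewrite [LHS]/= [X in X ** _]/= ckPS h eqxx.
by rewrite rcons_cons !S_walk_cons IH // cmulA.
Qed.

Lemma S_path_first k (mu : gpath E k.+1) : S_path mu = S (first_edge mu) ** S_path (path_tail mu).
Proof. by rewrite /Defs.S_path edges_first_tail S_walk_cons. Qed.

Lemma S_path_last k (mu : gpath E k.+1) : S_path mu = S_path (path_front mu) ** S (last_edge mu).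
Proof. by rewrite /Defs.S_path edges_front_last S_walk_rcons // -prng_front. Qed.

Lemma gpath0_eq (p q : gpath E 0) : (p == q) = (psrc p == psrc q).
Proof.
apply/eqP/eqP => [->//|pq]; apply: gpath_eq => //.
by rewrite (tuple0 (edges p)) (tuple0 (edges q)).
Qed.

Lemma S_path0 (p : gpath E 0) : S_path p = P (psrc p).
Proof. by rewrite /Defs.S_path (tuple0 (edges p)). Qed.

Lemma P_S_path l v (p : gpath E l) : P v ** S_path p = if v == psrc p then S_path p else 0.
Proof.
case: l p => [|l] p; first by rewrite S_path0 ckPP.
by rewrite S_path_first cmulA ckPS -psrc_first; case: eqP => // _; rewrite cmul0x.
Qed.

Lemma S_path_orth l (p q : gpath E l) :
  adj (S_path p) ** S_path q = if p == q then P (prng q) else 0.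
Proof.
elim: l p q => [|l IH] p q.
  rewrite !S_path0 (ckP _).1 ckPP gpath0_eq; case: eqP => // _.
  by rewrite /prng (tuple0 (edges q)).
rewrite !S_path_first adjM -cmulA [adj (S _) ** _]cmulA ckSS.
have [fe|fe] := eqVneq (first_edge p) (first_edge q); last first.
  rewrite cmul0x cmulx0; case: eqP => // pq; by rewrite pq eqxx in fe.
rewrite P_S_path psrc_tail eqxx IH prng_tail.
have [te|te] := eqVneq (path_tail p) (path_tail q).
  by rewrite (first_tail_inj fe te) eqxx.
by case: eqP => // pq; rewrite pq eqxx in te.
Qed.

Lemma S_path_prng l (p : gpath E l) : S_path p ** P (prng p) = S_path p.
Proof.
case: l p => [|l] p; first by rewrite S_path0 /prng (tuple0 (edges p)) /= (ckP _).2.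
by rewrite S_path_last prng_last -cmulA ckSP.
Qed.

Lemma P_pathM l (p q : gpath E l) : P_path p ** P_path q = if p == q then P_path q else 0.
Proof.
rewrite /Defs.P_path -cmulA [adj _ ** (_ ** _)]cmulA S_path_orth.
case: eqP => [->|_]; last by rewrite cmul0x cmulx0.
by rewrite cmulA S_path_prng.
Qed.

Lemma adj_P_path l (p : gpath E l) : adj (P_path p) = P_path p.
Proof. by rewrite /Defs.P_path adjM adjK. Qed.

Lemma P_path_S_path l (p q : gpath E l) : P_path p ** S_path q = if p == q then S_path q else 0.
Proof.
rewrite /Defs.P_path -cmulA S_path_orth; case: eqP => [->|_]; last exact: cmulx0.
exact: S_path_prng.
Qed.

Lemma P_path_refine l (a : gpath E l) :
  P_path a = \sum_(mu : gpath E l.+1 | path_front mu == a) P_path mu.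
Proof.
rewrite (partition_big (@last_edge _ _ E l) (fun f => src E f == prng a)) /=; last first.
  by move=> mu /eqP <-; rewrite prng_front.
have -> : P_path a = S_path a ** P (prng a) ** adj (S_path a).
  by rewrite S_path_prng.
rewrite ckP_sum cmul_sumr cmul_suml.
apply: eq_bigr => f /eqP fa.
have [mu [mua muf]] := rcons_path_exists (esym fa).
rewrite (big_pred1 mu) => [|nu /=]; last first.
  apply/andP/eqP => [[/eqP na /eqP nf]|->]; last by rewrite mua muf !eqxx.
  by apply: front_last_inj; rewrite ?mua ?muf.
by rewrite /Defs.P_path S_path_last mua muf adjM !cmulA.
Qed.

Lemma P_path_sum l : \sum_(p : gpath E l) P_path p = one.
Proof.
elim: l => [|l IH].
  rewrite /cstar_one [RHS](reindex (@psrc _ _ E 0)) /=.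
    by apply: eq_bigr => p _; rewrite /Defs.P_path S_path0 (ckP _).1 (ckP _).2.
  exists (fun v => GPath (isT : walk E (v, [tuple]).1 (v, [tuple]).2)) => [p _|v _] //.
  by apply/eqP; rewrite gpath0_eq.
rewrite -IH (partition_big (@path_front _ _ E l) xpredT) //=.
by apply: eq_bigr => a _; rewrite [RHS]P_path_refine.
Qed.

Lemma cuntz_krieger_unit : cstar_generated (range P `|` range S) = setT ->
  unit_of [set: A] one.
Proof.
move=> gen; split => // x _.
have gx : cstar_generated (range P `|` range S) x by rewrite gen.
have one_adj : adj one = one by rewrite adj_sum; apply: eq_bigr => v _; exact: (ckP v).1.
suff sub : cstar_generated (range P `|` range S) `<=` [set x | one ** x = x /\ x ** one = x].
  exact: (sub x gx).
apply: generated_ind => [|y].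
  split; first apply: closedI.
  - apply: (@closed_eq_lipschitz _ _ _ id `|one| 1) => a b; first exact: cmul_lipschitz_l.
    by rewrite mul1r.
  - apply: (@closed_eq_lipschitz _ _ (fun x => x ** one) id `|one| 1) => a b; first exact: cmul_lipschitz_r.
    by rewrite mul1r.
  split=> [|a b [a1 a2] [b1 b2]|c a [a1 a2]|a b [a1 a2] [b1 b2]|a [a1 a2]] /=.
  - by rewrite cmulx0 cmul0x.
  - by rewrite cmulDr cmulDl a1 a2 b1 b2.
  - by rewrite cscalerAr cscalerAl a1 a2.
  - by rewrite cmulA a1 -cmulA b2.
  - by rewrite -{1 2}one_adj -!adjM a1 a2.
case=> [[v _ <-]|[e _ <-]] /=.
  rewrite cmul_suml cmul_sumr (bigD1 v) //= ckPP eqxx big1 => [|u uv]; last first.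
    by rewrite ckPP (negbTE uv).
  rewrite (bigD1 v) //= ckPP eqxx big1 => [|u uv]; first by rewrite !addr0.
  by rewrite ckPP eq_sym (negbTE uv).
rewrite cmul_suml cmul_sumr (bigD1 (src E e)) //= ckPS eqxx big1 => [|u uv]; last first.
  by rewrite ckPS (negbTE uv).
rewrite -[S e in X in _ /\ X](ckSP e) (bigD1 (rng E e)) //= -cmulA (ckP _).2 big1 => [|u uv].
  by rewrite !addr0 ckSP.
by rewrite -cmulA ckPP eq_sym (negbTE uv) cmulx0.
Qed.

Section Permutation.
Variables (l : nat) (t : {perm gpath E l}).
Hypothesis ht : endpoint_fixing t.
Local Notation U := (U_perm P S t).

Lemma U_perm_S_path p : U ** S_path p = S_path (t p).
Proof.
rewrite /U_perm cmul_suml (bigD1 p) //= -cmulA S_path_orth eqxx.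
rewrite -((endpoint_fixingP t).1 ht p).2 S_path_prng big1 ?addr0 // => q qp.
by rewrite -cmulA S_path_orth (negbTE qp) cmulx0.
Qed.

Lemma U_perm_unitary : adj U ** U = one /\ U ** adj U = one.
Proof.
have adjU : adj U = \sum_(a : gpath E l) S_path a ** adj (S_path (t a)).
  by rewrite /U_perm adj_sum; apply: eq_bigr => a _; rewrite adjM adjK.
split.
  rewrite adjU {1}/U_perm cmul_suml -(P_path_sum l); apply: eq_bigr => a _.
  rewrite cmul_sumr (bigD1 a) //= -cmulA [adj _ ** (_ ** _)]cmulA S_path_orth eqxx.
  rewrite ((endpoint_fixingP t).1 ht a).2 cmulA S_path_prng big1 ?addr0 // => b ba.
  rewrite -cmulA [adj _ ** (_ ** _)]cmulA S_path_orth (inj_eq perm_inj) eq_sym (negbTE ba).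
  by rewrite cmul0x cmulx0.
rewrite adjU cmul_sumr -(P_path_sum l) [RHS](reindex_inj (@perm_inj _ t)) /=.
by apply: eq_bigr => a _; rewrite cmulA U_perm_S_path.
Qed.

End Permutation.

Section Unital.
Hypothesis hone : unit_of [set: A] one.

Lemma cmul1x x : one ** x = x.
Proof. by have [_ h] := hone; apply: (h x I).1. Qed.
Lemma cmulx1 x : x ** one = x.
Proof. by have [_ h] := hone; apply: (h x I).2. Qed.

(** Range projections of the paths of one length sum to the unit, so testing against these paths
    determines an element. *)
Lemma S_path_ext l x y : (forall p : gpath E l, x ** S_path p = y ** S_path p) -> x = y.
Proof.
move=> h; rewrite -[x]cmulx1 -[y]cmulx1 -(P_path_sum l) !cmul_sumr.
by apply: eq_bigr => p _; rewrite !cmulA h.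
Qed.

Lemma U_perm_vertex l (t : {perm gpath E l}) v : endpoint_fixing t ->
  P v ** U_perm P S t = U_perm P S t ** P v.
Proof.
move=> ht; apply: (@S_path_ext l) => p.
rewrite -!cmulA U_perm_S_path // !P_S_path ((endpoint_fixingP t).1 ht p).1.
by case: eqP => _; rewrite ?cmulx0 // U_perm_S_path.
Qed.

(** Fixing endpoints makes [U_perm] commute with the vertex projections, so the twisted edges form a
    family over the same projections; universality then produces [lambda]. *)
Lemma cuntz_krieger_lambda l (t : {perm gpath E l}) : endpoint_fixing t ->
  cuntz_krieger E P (fun e => U_perm P S t ** S e).
Proof.
move=> ht; have [UU UU'] := U_perm_unitary ht; set U := U_perm P S t in UU UU' *.
have TT e f : adj (U ** S e) ** (U ** S f) = adj (S e) ** S f.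
  by rewrite adjM -cmulA [adj U ** _]cmulA UU cmul1x.
have TTT e : U ** S e ** adj (U ** S e) ** (U ** S e) = U ** S e.
  by rewrite -(cmulA (U ** S e)) TT ckSS eqxx -cmulA ckSP.
have sumT v : P v = \sum_(e | src E e == v) U ** S e ** adj (U ** S e).
  transitivity (U ** P v ** adj U).
    by rewrite -U_perm_vertex // -cmulA UU' cmulx1.
  rewrite [in LHS]ckP_sum cmul_sumr cmul_suml; apply: eq_bigr => e _.
  by rewrite adjM !cmulA.
have [h1 _ _ _ _] := hck; split => //.
- split=> [e|e f ef]; rewrite TT ckSS ?eqxx //.
  by rewrite (negbTE ef).
(* The difference is the sum [q] of the other range projections at the vertex, and
   [q = adj q ** q]. *)
- move=> e; pose q := \sum_(f | (src E f == src E e) && (f != e)) U ** S f ** adj (U ** S f).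
  have qE : P (src E e) - U ** S e ** adj (U ** S e) = q.
    by rewrite [P _]sumT (bigD1 e) //= addrAC subrr add0r.
  have qa : adj q = q by rewrite adj_sum; apply: eq_bigr => f _; rewrite adjM adjK.
  exists q; rewrite qE qa /q cmul_suml; apply: eq_bigr => f fe.
  rewrite cmul_sumr (bigD1 f) //= big1 => [|g /andP[_ gf]].
    by rewrite addr0 [RHS]cmulA TTT.
  rewrite [LHS]cmulA -(cmulA (U ** S f)) TT ckSS eq_sym (negbTE gf).
  by rewrite cmulx0 cmul0x.
Qed.

End Unital.
End CuntzKriegerFamily.

(** * The diagonal as a closed linear span *)

Section Diagonal.
Variables (R : realType) (V W : finType) (E : graph V W) (A : cstarType R).
Variables (P : V -> A) (S : W -> A).
Hypothesis hck : cuntz_krieger E P S.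
Hypothesis hsinks : no_sinks E.
Local Notation C := R[i].
Local Notation P_path := (P_path P S).
Local Notation one := (cstar_one P).
Local Notation D := (Defs.diagonal E P S).

(** At fixed length the cylinder projections are orthogonal with sum [cstar_one], so these elements
    add and multiply like the functions [c] on paths. *)
Definition span_of l (c : gpath E l -> C) : A := \sum_(p : gpath E l) c p *: P_path p.

Lemma span_ofM l c d : span_of c ** span_of d = @span_of l (fun p => c p * d p).
Proof.
rewrite /span_of cmul_suml; apply: eq_bigr => p _.
rewrite cmul_sumr (bigD1 p) //= cscalerAl cscalerAr (P_pathM hck hsinks) eqxx scalerA.
rewrite big1 ?addr0 // => q qp.
by rewrite cscalerAl cscalerAr (P_pathM hck hsinks) eq_sym (negbTE qp) !scaler0.
Qed.

Lemma span_of_refine l c : @span_of l c = @span_of l.+1 (fun mu => c (path_front mu)).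
Proof.
rewrite /span_of [RHS](partition_big (@path_front _ _ E l) xpredT) //=.
apply: eq_bigr => a _; rewrite (P_path_refine hck hsinks) scaler_sumr.
by apply: eq_bigr => mu /eqP ->.
Qed.

Lemma span_of_refine_to l l' c : (l <= l')%N ->
  exists c' : gpath E l' -> C, @span_of l c = span_of c'.
Proof.
move=> ll'; rewrite -(subnKC ll'); elim: (l' - l)%N => [|n [c' ->]].
  by rewrite addn0; exists c.
by rewrite addnS span_of_refine; exists (fun mu => c' (path_front mu)).
Qed.

Lemma P_path_span l (p : gpath E l) : P_path p = span_of (fun q => (q == p)%:R).
Proof.
rewrite /span_of (bigD1 p) //= eqxx scale1r big1 ?addr0 // => q qp.
by rewrite (negbTE qp) scale0r.
Qed.

(** The lower bound [L] on the length lets later arguments look at long paths only: conjugation by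
    [U_perm] is transparent once a path is longer than the permuted block. *)
Definition span_limit L : set A := [set x | forall e : C, 0 < e ->
  exists l, (L <= l)%N /\ exists c : gpath E l -> C, `|x - span_of c| < e].

Lemma span_limit2 L x y (e : C) : span_limit L x -> span_limit L y -> 0 < e ->
  exists l, (L <= l)%N /\ exists c d : gpath E l -> C,
    `|x - span_of c| < e /\ `|y - span_of d| < e.
Proof.
move=> hx hy e0; have [l [Ll [c xc]]] := hx e e0; have [l' [Ll' [d yd]]] := hy e e0.
have [c' cE] := span_of_refine_to c (leq_maxl l l').
have [d' dE] := span_of_refine_to d (leq_maxr l l').
exists (maxn l l'); split; first by rewrite leq_max Ll.
by exists c', d'; rewrite -cE -dE.
Qed.

Lemma span_limit_subalgebra L : is_cstar_subalgebra (span_limit L).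
Proof.
split.
  apply/closed_normP => x h e e0; have e2 : 0 < e / 2 by rewrite divr_gt0.
  have [y hy xy] := h _ e2; have [l [Ll [c yc]]] := hy _ e2.
  exists l; split => //; exists c; rewrite -(subrK y x) -addrA [e]splitr.
  by apply: le_lt_trans (ler_normD _ _) _; rewrite ltrD.
split.
- move=> e e0; exists L; split => //; exists (fun=> 0).
  by rewrite /span_of big1 ?subr0 ?normr0 // => p _; rewrite scale0r.
- move=> x y hx hy e e0; have e2 : 0 < e / 2 by rewrite divr_gt0.
  have [l [Ll [c [d [xc yd]]]]] := span_limit2 hx hy e2.
  exists l; split => //; exists (fun p => c p + d p).
  rewrite (_ : span_of _ = span_of c + span_of d); last first.
    by rewrite /span_of -big_split /=; apply: eq_bigr => p _; rewrite scalerDl.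
  rewrite opprD addrACA [e]splitr.
  by apply: le_lt_trans (ler_normD _ _) _; rewrite ltrD.
- move=> a x hx e e0; have a1 : 0 < `|a| + 1 by rewrite ltr_wpDl.
  have [|l [Ll [c xc]]] := hx (e / (`|a| + 1)); first by rewrite divr_gt0.
  exists l; split => //; exists (fun p => a * c p).
  rewrite (_ : span_of _ = a *: span_of c); last first.
    by rewrite /span_of scaler_sumr; apply: eq_bigr => p _; rewrite scalerA.
  rewrite -scalerBr normrZ; apply: le_lt_trans (_ : (`|a| + 1) * `|x - span_of c| < _).
    by rewrite ler_wpM2r // lerDl.
  by rewrite mulrC -ltr_pdivlMr.
- move=> x y hx hy e e0.
  have M0 : 0 < `|x| + (`|y| + 1) by rewrite ltr_wpDl ?ltr_wpDl.
  (* The precision [r / (r + 1)] is below [r], which gives the final estimate, and below 1, which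
     keeps the norm of [span_of d] at most [|y| + 1]. *)
  pose r := e / (`|x| + (`|y| + 1)).
  have r0 : 0 < r by rewrite divr_gt0.
  have m0 : 0 < r / (r + 1) by rewrite divr_gt0 // addr_gt0.
  have mr : r / (r + 1) < r by rewrite ltr_pdivrMr ?addr_gt0 // ltr_pMr // ltrDr.
  have m1 : r / (r + 1) < 1 by rewrite ltr_pdivrMr ?addr_gt0 // mul1r ltrDl.
  have [l [Ll [c [d [xc yd]]]]] := span_limit2 hx hy m0.
  exists l; split => //; exists (fun p => c p * d p); rewrite -span_ofM.
  rewrite (_ : _ - _ = x ** (y - span_of d) + (x - span_of c) ** span_of d); last first.
    by rewrite cmulBr cmulBl addrA subrK.
  have dn : `|span_of d| <= `|y| + 1.
    rewrite -[span_of d](subKr y); apply: le_trans (ler_normB _ _) _.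
    by rewrite lerD // ltW // (lt_trans yd).
  apply: le_lt_trans (ler_normD _ _) _.
  apply: le_lt_trans (lerD (cnormM _ _) (cnormM _ _)) _.
  apply: le_lt_trans (_ : `|x| * (r / (r + 1)) + (r / (r + 1)) * (`|y| + 1) < _).
    by apply: lerD; [rewrite ler_wpM2l // ltW|apply: ler_pM => //; exact: ltW].
  rewrite [X in X + _]mulrC -mulrDr -ltr_pdivlMr //.
- move=> x hx e e0; have [l [Ll [c xc]]] := hx e e0.
  exists l; split => //; exists (fun p => (c p)^*).
  rewrite (_ : span_of _ = adj (span_of c)) -?adjB ?norm_adj //.
  by rewrite /span_of adj_sum; apply: eq_bigr => p _; rewrite Defs.adjZ adj_P_path.
Qed.

Lemma diagonal_span_limit L x : D x -> span_limit L x.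
Proof.
move=> Dx; suff sub : D `<=` span_limit L by exact: sub.
apply: generated_ind; first exact: span_limit_subalgebra.
move=> _ [l [p ->]] e e0; exists (maxn L l); split; first exact: leq_maxl.
have [c cE] := span_of_refine_to (fun q => (q == p)%:R) (leq_maxr L l).
by exists c; rewrite -cE -P_path_span subrr normr0.
Qed.

Lemma diagonal_subalgebra : is_cstar_subalgebra D.
Proof. exact: is_cstar_subalgebra_generated. Qed.

Lemma P_path_diagonal l (p : gpath E l) : D (P_path p).
Proof. by apply: generated_sub; exists l, p. Qed.

Lemma vertex_diagonal v : D (P v).
Proof.
pose p : gpath E 0 := GPath (isT : walk E (v, [tuple]).1 (v, [tuple]).2).
have -> : P v = P_path p.
  by rewrite /Defs.P_path (S_path0 P S p) (ckP hck v).1 (ckP hck v).2.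
exact: P_path_diagonal.
Qed.

Lemma one_diagonal : D one.
Proof. by apply: subalgebra_sum => [|v _]; [exact: diagonal_subalgebra|exact: vertex_diagonal]. Qed.

(** Adapted to closed linear conditions, such as the vanishing of a matrix entry, which need not be
    stable under products. *)
Lemma diagonal_ind L (Q : set A) : closed Q ->
  (forall x y, Q x -> Q y -> Q (x + y)) -> (forall (c : C) x, Q x -> Q (c *: x)) ->
  Q 0 -> (forall l (p : gpath E l), (L <= l)%N -> Q (P_path p)) -> D `<=` Q.
Proof.
move=> /closed_normP cQ QD QZ Q0 QP x Dx; apply: cQ => e e0.
have [l [Ll [c xc]]] := diagonal_span_limit L Dx e0.
exists (span_of c) => //; apply: (big_ind Q) => // p _.
by apply: QZ; exact: QP.
Qed.

End Diagonal.

(** * The endomorphisms and their conjugation by [U_pi] *)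

Section Lambda.
Variables (R : realType) (V W : finType) (E : graph V W) (A : cstarType R).
Variables (P : V -> A) (S : W -> A).
Hypothesis hA : is_graph_cstar E P S.
Hypothesis hsinks : no_sinks E.
Local Notation one := (cstar_one P).
Local Notation D := (Defs.diagonal E P S).
Local Notation S_path := (S_path P S).
Local Notation P_path := (P_path P S).

Lemma graph_cstar_ck : cuntz_krieger E P S. Proof. by case: hA. Qed.
Let hck := graph_cstar_ck.

Lemma graph_cstar_unit : unit_of [set: A] one.
Proof. by case: hA => _ gen _; exact: (cuntz_krieger_unit hck hsinks gen). Qed.
Let hone := graph_cstar_unit.

Lemma diagonal_unit : unit_of D one.
Proof. by split; [exact: (one_diagonal hck)|move=> x _; exact: hone.2]. Qed.

(** The coincidence set is closed by automatic continuity, and contains each [P v] because [P v] is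
    a sum of terms [S e ** adj (S e)]. *)
Lemma star_hom_eq (f g : A -> A) : star_hom f -> star_hom g ->
  (forall e, f (S e) = g (S e)) -> f = g.
Proof.
move=> hf hg fg; apply/funext => x; case: hA => _ gen _.
have gx : cstar_generated (range P `|` range S) x by rewrite gen.
suff sub : cstar_generated (range P `|` range S) `<=` [set x | f x = g x] by exact: sub.
apply: generated_ind.
  split.
    by apply: (@closed_eq_lipschitz _ _ f g 2 2) => a b; exact: star_hom_lipschitz hone.
  have [_ fM fA] := hf; have [_ gM gA] := hg.
  split=> [|a b /= ha hb|c a /= ha|a b /= ha hb|a /= ha].
  - by rewrite /= !star_hom0.
  - by rewrite !star_homD // ha hb.
  - by rewrite !star_homZ // ha.
  - by rewrite fM gM ha hb.
  - by rewrite fA gA ha.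
have [_ fM fA] := hf; have [_ gM gA] := hg.
move=> _ [[v _ <-]|[e _ <-]] /=; last exact: fg.
rewrite (ckP_sum hck hsinks) !star_hom_sum //.
by apply: eq_bigr => e _; rewrite fM gM fA gA fg.
Qed.

Section Endomorphism.
Variables (l : nat) (t : {perm gpath E l}).
Hypothesis ht : endpoint_fixing t.

Lemma lambdaP : [/\ star_hom (lambda P S t), lambda P S t one = one
  & forall e, lambda P S t (S e) = U_perm P S t ** S e].
Proof.
rewrite /lambda; case: xgetP => [f -> []//|].
case: hA => _ _ univ.
have [f [hf fP fS]] := univ A P _ (cuntz_krieger_lambda hck hsinks hone ht).
move=> /(_ f) []; split => //.
by rewrite star_hom_sum //; apply: eq_bigr => v _.
Qed.

Lemma lambda_vertex v : lambda P S t (P v) = P v.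
Proof.
have [hl _ lS] := lambdaP; have [_ lM lA] := hl.
have [h1 _ _ _ h5] := cuntz_krieger_lambda hck hsinks hone ht.
rewrite [RHS]h5; last exact: hsinks.
rewrite {1}(ckP_sum hck hsinks) star_hom_sum //.
by apply: eq_bigr => e _; rewrite lM lA lS.
Qed.

End Endomorphism.

Lemma Ad_star_hom (U : A) : adj U ** U = one -> U ** adj U = one -> star_hom (Ad U).
Proof.
move=> UU UU'; rewrite /Ad; split.
- by move=> c x y; rewrite cmulDr cmulDl cscalerAr cscalerAl.
- move=> x y; rewrite !cmulA -(cmulA (U ** x) (adj U)) UU.
  by rewrite -(cmulA _ one) (cmul1x hone).
- by move=> x; rewrite !adjM adjK cmulA.
Qed.

Lemma star_hom_comp (f g : A -> A) : star_hom f -> star_hom g -> star_hom (f \o g).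
Proof.
move=> hf hg; have [fl fM fA] := hf; have [gl gM gA] := hg; split.
- by move=> c x y; rewrite /= gl fl.
- by move=> x y; rewrite /= gM fM.
- by move=> x; rewrite /= gA fA.
Qed.

Section Conjugacy.
Variables (k : nat) (t t' : {perm gpath E k.+1}) (pi : {perm gpath E k}).
Hypotheses (ht : endpoint_fixing t) (ht' : endpoint_fixing t').
Hypothesis hpi : endpoint_fixing pi.
Local Notation U := (U_perm P S pi).

(** With [mu = e alpha] and [t mu = beta f], conjugation by [U] replaces [alpha] and [beta] in the
    identity for [lambda] by [pi alpha] and [pi beta]; this is the algebraic form of [g_spec]. *)
Lemma Ad_lambda_S mu :
  Ad U (lambda P S t (S (first_edge mu))) ** S_path (path_tail (tail_perm hpi mu))
  = S_path (front_perm hpi (t mu)).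
Proof.
have [UU _] := U_perm_unitary hck hsinks hpi; have [_ _ lS] := lambdaP ht.
rewrite (tail_permE hpi mu).2 -(U_perm_S_path hck hsinks hpi) /Ad lS.
rewrite -!cmulA [adj U ** _]cmulA UU (cmul1x hone).
rewrite -(S_path_first hck) (U_perm_S_path hck hsinks ht).
rewrite (S_path_last hck hsinks) cmulA (U_perm_S_path hck hsinks hpi).
by rewrite (S_path_last hck hsinks (front_perm _ _)) (front_permE hpi _).1 (front_permE hpi _).2.
Qed.

Lemma lambda_S mu :
  lambda P S t' (S (first_edge mu)) ** S_path (path_tail mu) = S_path (t' mu).
Proof.
have [_ _ lS] := lambdaP ht'.
by rewrite lS -cmulA -(S_path_first hck) (U_perm_S_path hck hsinks ht').
Qed.

Lemma g_spec_Ad_lambda : g_spec pi t t' -> Ad U \o lambda P S t = lambda P S t'.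
Proof.
move=> /(g_spec_tail_perm hpi) tt'; have [hl _ _] := lambdaP ht; have [hl' _ lS'] := lambdaP ht'.
have [UU UU'] := U_perm_unitary hck hsinks hpi.
have hAd : star_hom (Ad U \o lambda P S t) by apply: star_hom_comp => //; exact: Ad_star_hom.
apply: star_hom_eq => // e; apply: (S_path_ext hck hsinks hone (l := k)) => q.
(* Test paths that cannot follow [e] are annihilated on both sides; the others make [e] followed by
   [q] an edge of the permutation graph. *)
have [eq|eq] := eqVneq (rng E e) (psrc q); last first.
  have zero (f : A -> A) : star_hom f -> f (P (rng E e)) = P (rng E e) -> f (S e) ** S_path q = 0.
    move=> [_ fM _] fP; rewrite -(ckSP hck e) fM fP -cmulA (P_S_path hck hsinks) (negbTE eq).
    exact: cmulx0.
  rewrite !zero //; first exact: lambda_vertex.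
  rewrite /= lambda_vertex // /Ad -(U_perm_vertex hck hsinks hone _ hpi) -cmulA UU'.
  exact: (cmulx1 hone).
have [nu [ne nq]] := cons_path_exists eq.
pose mu := (tail_perm hpi)^-1%g nu.
have nuE : nu = tail_perm hpi mu by rewrite permKV.
have e1 : first_edge mu = e by rewrite -ne nuE (tail_permE hpi mu).1.
rewrite -nq -{2}ne lambda_S nuE tt' -{1}e1.
exact: Ad_lambda_S.
Qed.

Hypothesis hP : forall v, P v != 0.

(** Distinct paths have orthogonal ranges, so a coincidence would make a vertex projection
    vanish. *)
Lemma S_path_inj l : injective (fun p : gpath E l => S_path p).
Proof.
move=> p q pq; apply/eqP; apply: contraT => ne.
have := S_path_orth hck hsinks p q; rewrite (negbTE ne) pq (S_path_orth hck hsinks) eqxx.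
by move/eqP; rewrite (negbTE (hP _)).
Qed.

Lemma Ad_lambda_g_spec : Ad U \o lambda P S t = lambda P S t' -> g_spec pi t t'.
Proof.
move=> h; apply/(g_spec_tail_perm hpi) => mu; apply: S_path_inj.
rewrite -lambda_S -Ad_lambda_S -h /=.
by rewrite (tail_permE hpi mu).1.
Qed.

End Conjugacy.
End Lambda.

(** * Path space representation and characters of the diagonal *)

Section PathSpaceRepresentation.
Variables (R : realType) (V W : finType) (E : graph V W).
Local Notation C := R[i].

Definition pspace := {x : nat -> W | `[< ipaths E x >]}.
HB.instance Definition _ := Choice.on pspace.
Local Notation bop := (bop R pspace).
Implicit Types (x y z : pspace).

Lemma pspace_eq x y : (forall i, sval x i = sval y i) -> x = y.
Proof. by move=> xy; apply/val_inj/funext. Qed.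

Lemma pspaceP x : ipaths E (sval x).
Proof. exact: asboolW (svalP x). Qed.

Lemma path_shift_subproof x : `[< ipaths E (fun i => sval x i.+1) >].
Proof. by apply/asboolP => i; rewrite (pspaceP x i.+1). Qed.

Definition path_shift x : pspace := exist _ (fun i => sval x i.+1) (path_shift_subproof x).

(* Junk value [x] when [e] cannot be put in front of [x]. *)
Definition prepend e x : pspace := insubd x (fun i => if i is j.+1 then sval x j else e).

Lemma prependE e x i : rng E e = src E (sval x 0%N) ->
  sval (prepend e x) i = if i is j.+1 then sval x j else e.
Proof.
move=> ex; rewrite [sval _]insubdK //; apply/asboolP => -[|j] /=; first exact: ex.
exact: pspaceP.
Qed.

Definition starts_at v : pred pspace := [pred x | src E (sval x 0%N) == v].
Definition starts_with e : pred pspace := [pred x | sval x 0%N == e].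

Lemma vertex_inverses v : partial_inverses (starts_at v) (starts_at v) id id.
Proof. by []. Qed.

Lemma edge_inverses e :
  partial_inverses (starts_with e) (starts_at (rng E e)) path_shift (prepend e).
Proof.
split=> [y /eqP ye|x /eqP xe].
  have ye' : rng E e = src E (sval (path_shift y) 0%N) by rewrite -ye (pspaceP y 0%N).
  split; first by rewrite /starts_at /= ye'.
  by apply: pspace_eq => i; rewrite prependE //; case: i.
split; first by rewrite /starts_with /= prependE.
by apply: pspace_eq => i; rewrite /= prependE.
Qed.

Definition Prep v : bop := wop R (vertex_inverses v).
(** Functions are pulled back along the shift, so on basis vectors this operator puts [e] in front:
    it sends [delta x] to [delta (prepend e x)] if [x] starts at the range of [e], and to 0
    otherwise. *)
Definition Srep e : bop := wop R (edge_inverses e).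

Lemma adj_Prep v : adj (Prep v) = Prep v.
Proof. exact: wop_adj. Qed.

Lemma PrepE v f y : Prep v f y = if src E (sval y 0%N) == v then f y else 0.
Proof. by []. Qed.
Lemma SrepE e f y : Srep e f y = if sval y 0%N == e then f (path_shift y) else 0.
Proof. by []. Qed.
Lemma adj_SrepE e f y : adj (Srep e) f y =
  if src E (sval y 0%N) == rng E e then f (prepend e y) else 0.
Proof. by rewrite (wop_adj _ _ (partial_inverses_sym (edge_inverses e))). Qed.

Lemma SSrepE e f y : (Srep e ** adj (Srep e)) f y = if sval y 0%N == e then f y else 0.
Proof.
rewrite cmul_bopE SrepE adj_SrepE; case: eqP => // ye.
have [/(_ y) h _] := edge_inverses e; have [|h1 h2] := h; first exact/eqP.
by rewrite h2; move: h1; rewrite /starts_at /= => ->.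
Qed.

Lemma path_space_cuntz_krieger : cuntz_krieger E Prep Srep.
Proof.
have SS e f' f y : (adj (Srep e) ** Srep f') f y =
    if (src E (sval y 0%N) == rng E e) && (e == f') then f y else 0.
  rewrite cmul_bopE adj_SrepE SrepE; case: eqP => //= ye.
  rewrite prependE //; case: eqP => //= _; congr (f _).
  by apply: pspace_eq => i; rewrite /= prependE.
split.
- split=> [v|u v uv].
    split; first exact: adj_Prep.
    by apply: bop_eq => f y; rewrite cmul_bopE !PrepE; case: eqP.
  apply: bop_eq => f y; rewrite cmul_bopE !PrepE; case: eqP => // ->.
  by rewrite (negbTE uv).
- move=> e; apply: bop_eq => f y; rewrite /is_partial_isometry cmul_bopE SSrepE SrepE.
  by case: eqP.
- split=> [e|e f ef]; apply: bop_eq => g y; rewrite SS ?PrepE ?eqxx ?andbT //.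
  by rewrite (negbTE ef) andbF.
- move=> e.
  (* The difference is the projection onto the paths that leave the source of [e] by another
     edge. *)
  pose D : pred pspace := [pred x | (src E (sval x 0%N) == src E e) && (sval x 0%N != e)].
  have h : partial_inverses D D id id by [].
  exists (wop R h); rewrite (wop_adj _ h h); apply: bop_eq => f y.
  rewrite cmul_bopE !wopE bopBE l2BE SSrepE PrepE /D /=.
  have [ye|ye] := eqVneq (sval y 0%N) e; last by rewrite andbT subr0; case: ifP.
  by rewrite ye eqxx subrr.
- move=> v _; apply: bop_eq => f y; rewrite PrepE bop_sumE.
  under eq_bigr do rewrite SSrepE.
  rewrite -big_mkcondr /=; case: eqP => [yv|yv]; last first.
    by rewrite big1 // => e /andP[/eqP ev /eqP ye]; case: yv; rewrite ye.
  rewrite (big_pred1 (sval y 0%N)) // => e /=.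
  by have [->|_] := eqVneq e (sval y 0%N); rewrite ?yv ?eqxx ?andbF.
Qed.

End PathSpaceRepresentation.

Section Prefixes.
Variables (V W : finType) (E : graph V W).

Lemma is_prefix0 (p : gpath E 0) z : is_prefix p z = (psrc p == src E (z 0%N)).
Proof. by rewrite /is_prefix (tuple0 (edges p)) eqxx andbT. Qed.

Lemma is_prefixS l (p : gpath E l.+1) z : ipaths E z ->
  is_prefix p z = (first_edge p == z 0%N) && is_prefix (path_tail p) (fun i => z i.+1).
Proof.
move=> zP; rewrite /is_prefix edges_first_tail mkseq_cons eqseq_cons psrc_first psrc_tail.
have [->|] := eqVneq (first_edge p) (z 0%N); last by rewrite andbF.
by rewrite eqxx /= zP eqxx.
Qed.

Lemma prefix_extends : no_sinks E -> forall l (p : gpath E l),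
  exists2 z, ipaths E z & is_prefix p z.
Proof.
move=> ns; elim=> [|l IH] p.
  by have [z zP z0] := ipath_exists ns (psrc p); exists z => //; rewrite is_prefix0 z0.
have [z zP pz] := IH (path_tail p).
have z'P : ipaths E (fun i => if i is j.+1 then z j else first_edge p).
  move=> [|i] /=; last exact: zP.
  by rewrite -psrc_tail; case/andP: pz => /eqP ->.
by eexists; [exact: z'P|rewrite is_prefixS //= eqxx].
Qed.

Lemma prefix_unique l (p q : gpath E l) z : is_prefix p z -> is_prefix q z -> p = q.
Proof.
move=> /andP[/eqP ps /eqP pe] /andP[/eqP qs /eqP qe]; apply: gpath_eq; first by rewrite ps qs.
by apply: val_inj; rewrite /= pe qe.
Qed.

Lemma is_prefix_exists l z : ipaths E z -> exists p : gpath E l, is_prefix p z.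
Proof.
move=> zP; have [p [ps pe]] := prefix_path_exists l zP.
by exists p; rewrite /is_prefix ps pe !eqxx.
Qed.

End Prefixes.

Section CharacterExistence.
Variables (R : realType) (V W : finType) (E : graph V W) (A : cstarType R).
Variables (P : V -> A) (S : W -> A).
Hypothesis hA : is_graph_cstar E P S.
Hypothesis hsinks : no_sinks E.
Local Notation C := R[i].
Local Notation one := (cstar_one P).
Local Notation D := (Defs.diagonal E P S).
Local Notation P_path := (P_path P S).
Local Notation bop := (bop R (pspace E)).
Local Notation delta := (delta R).
Let hck := graph_cstar_ck hA.
Let hone := graph_cstar_unit hA hsinks.

Lemma adj_Srep_delta e (z : pspace E) :
  adj (Srep R E e) (delta z) = if sval z 0%N == e then delta (path_shift z) else 0.
Proof.
apply: l2_ext => y; rewrite adj_SrepE; case: (eqVneq (sval z 0%N) e) => [<-|ze].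
  rewrite !deltaE (pspaceP z 0%N); case: eqP => [ye|ye]; last first.
    by case: eqP => // yz; case: ye; rewrite yz.
  congr (_%:R); congr nat_of_bool; apply/eqP/eqP => [<-|->].
    by apply: pspace_eq => i; rewrite [RHS]prependE // ye (pspaceP z 0%N).
  by apply: pspace_eq => i; rewrite prependE ?(pspaceP z 0%N) //; case: i.
rewrite l20E; case: eqP => // ye; rewrite deltaE; case: eqP => // yz.
by rewrite -yz prependE // eqxx in ze.
Qed.

Lemma Srep_delta_path_shift (z : pspace E) : Srep R E (sval z 0%N) (delta (path_shift z)) = delta z.
Proof.
apply: l2_ext => y; rewrite SrepE !deltaE; case: eqP => yz; last first.
  by case: eqP => // e; case: yz; rewrite e.
congr (_%:R); congr nat_of_bool; apply/eqP/eqP => [sy|->] //.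
apply: pspace_eq => -[//|i]; exact: (congr1 (fun u => sval u i) sy).
Qed.

Lemma path_space_representation : exists f : A -> bop, star_hom f /\
  forall l (p : gpath E l) z, f (P_path p) (delta z) = (is_prefix p (sval z))%:R *: delta z.
Proof.
have [_ _ univ] := hA.
have [f [hf fP fS]] := univ _ _ _ (path_space_cuntz_krieger R E).
have [_ fM fA] := hf.
exists f; split => //; elim=> [|l IH] p z.
  rewrite /Defs.P_path (S_path0 P S p) (ckP hck _).1 (ckP hck _).2 fP is_prefix0.
  apply: l2_ext => y; rewrite PrepE [RHS]l2ZE !deltaE eq_sym.
  have [->|_] := eqVneq y z; last by rewrite mulr0; case: ifP.
  by rewrite eq_sym mulr1; case: ifP.
have -> : P_path p = S (first_edge p) ** P_path (path_tail p) ** adj (S (first_edge p)).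
  by rewrite /Defs.P_path (S_path_first hck p) adjM !cmulA.
rewrite (fM (_ ** _)) fM fA fS.
transitivity (Srep R E (first_edge p) (f (P_path (path_tail p))
  (adj (Srep R E (first_edge p)) (delta z)))); first by [].
rewrite adj_Srep_delta is_prefixS; last exact: pspaceP.
rewrite eq_sym; case: eqP => [->|_]; last by rewrite !linear0 andFb scale0r.
by rewrite IH andTb bop_scale Srep_delta_path_shift.
Qed.

(** The basis vector at [z] is a common eigenvector of the represented diagonal; its eigenvalue is
    multiplicative and is the character. *)
Lemma path_character_exists z : ipaths E z -> exists chi, is_character D chi /\
  forall l (p : gpath E l), chi (P_path p) = (is_prefix p z)%:R.
Proof.
move=> zP; have [f [hf fP]] := path_space_representation.
have [_ fM fA] := hf.
pose x : pspace E := exist _ z (asboolT zP).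
pose chi a : C := f a (delta x) x.
have lip y a b : `|f a (delta x) y - f b (delta x) y| <= 2 * `|a - b|.
  have -> : f a (delta x) y - f b (delta x) y = f (a - b) (delta x) y.
    by rewrite star_homB // bopBE l2BE.
  apply: le_trans (bop_entry_le _ _ _) _.
  exact: star_hom_bounded hone hf _.
(* Off-diagonal entries vanish on cylinder projections, hence on their closed span. *)
have eigen : forall a, D a -> forall y, y != x -> f a (delta x) y = 0.
  move=> a Da y yx; suff sub : D `<=` [set a | f a (delta x) y = 0] by exact: sub.
  apply: (@diagonal_ind _ _ _ _ _ _ _ hck hsinks 0).
  - apply/closed_normP => b h; apply: (@norm_small_eq0 _ C^o) => e e0.
    have [c /= c0 bc] := h (e / 2) (divr_gt0 e0 (ltr0n _ 2)).
    rewrite -[f b _ _]subr0 -c0; apply: le_trans (lip _ _ _) _.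
    by rewrite mulrC -ler_pdivlMr // ltW.
  - by move=> b c /= hb hc; rewrite star_homD // bopDE l2DE hb hc addr0.
  - by move=> c b /= hb; rewrite star_homZ // bopZE l2ZE hb mulr0.
  - by rewrite /= star_hom0 // bop0E.
  - by move=> l p _ /=; rewrite fP l2ZE deltaE (negbTE yx) mulr0.
have eigen' a : D a -> f a (delta x) = chi a *: delta x.
  move=> Da; apply: l2_ext => y; rewrite l2ZE deltaE.
  by have [->|yx] := eqVneq y x; [rewrite mulr1|rewrite mulr0 eigen].
have chiP l (p : gpath E l) : chi (P_path p) = (is_prefix p z)%:R.
  by rewrite /chi fP l2ZE deltaE eqxx mulr1.
have chiL c a b : chi (c *: a + b) = c * chi a + chi b.
  by rewrite /chi star_homD // star_homZ // bopDE l2DE bopZE l2ZE.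
exists chi; split => //; split.
- by move=> c a b _ _; exact: chiL.
- move=> a b Da Db; rewrite {1}/chi fM cmul_bopE (eigen' b Db) bop_scale l2ZE.
  exact: mulrC.
- move=> a Da; suff sub : D `<=` [set a | chi (adj a) = (chi a)^*] by exact: sub.
  apply: (@diagonal_ind _ _ _ _ _ _ _ hck hsinks 0).
  + apply/closed_normP => b h; apply/eqP; rewrite -subr_eq0; apply/eqP.
    apply: (@norm_small_eq0 _ C^o) => e e0.
    have [c /= cE bc] := h (e / 4) (divr_gt0 e0 (ltr0n _ 4)).
    rewrite (_ : _ - _ = (chi (adj b) - chi (adj c)) + (chi c - chi b)^*); last first.
      by rewrite cE rmorphB addrA subrK.
    apply: le_trans (ler_normD _ _) _; rewrite norm_conjC.
    apply: le_trans (lerD (lip _ _ _) (lip _ _ _)) _.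
    rewrite -adjB norm_adj (distrC c) -mulrDl -natrD mulrC -ler_pdivlMr //.
    exact: ltW.
  + move=> b c /= hb hc; rewrite adjD /chi !star_homD // !bopDE !l2DE rmorphD.
    by congr (_ + _).
  + move=> c b /= hb; rewrite Defs.adjZ /chi !star_homZ // !bopZE !l2ZE rmorphM.
    by congr (_ * _).
  + by rewrite /= adj0 /chi star_hom0 // bop0E l20E rmorph0.
  + by move=> l p _ /=; rewrite (adj_P_path P S p) chiP rmorph_nat.
- exists one; first exact: (one_diagonal hck).
  rewrite -(P_path_sum hck hsinks 0) /chi star_hom_sum // (bop_sumE (fun=> true)).
  have [p pz] := is_prefix_exists 0 zP.
  rewrite (bigD1 p) //= -[f _ _ _]/(chi _) chiP pz big1 ?addr0 ?oner_eq0 // => q qp.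
  rewrite -[f _ _ _]/(chi _) chiP; case: (boolP (is_prefix q z)) => // qz.
  by rewrite (prefix_unique qz pz) eqxx in qp.
Qed.

End CharacterExistence.

(** * Path characters and norms on the diagonal *)

Section PathCharacters.
Variables (R : realType) (V W : finType) (E : graph V W) (A : cstarType R).
Variables (P : V -> A) (S : W -> A).
Hypothesis hA : is_graph_cstar E P S.
Hypothesis hsinks : no_sinks E.
Local Notation C := R[i].
Local Notation one := (cstar_one P).
Local Notation D := (Defs.diagonal E P S).
Local Notation S_path := (S_path P S).
Local Notation P_path := (P_path P S).
Local Notation phi z := (path_character E P S z).
Let hck := graph_cstar_ck hA.
Let hone := graph_cstar_unit hA hsinks.

Lemma path_characterP z : ipaths E z -> is_character D (phi z) /\
  forall l (p : gpath E l), phi z (P_path p) = (is_prefix p z)%:R.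
Proof.
move=> zP; rewrite /path_character; case: xgetP => [chi -> //|h].
by have [chi hchi] := path_character_exists hA hsinks zP; case: (h chi).
Qed.

Lemma diagonal_character_bounded chi x : is_character D chi -> D x -> `|chi x| <= 2 * `|x|.
Proof.
move=> hchi; apply: character_bounded hchi x; first exact: diagonal_subalgebra.
exact: diagonal_unit hA hsinks.
Qed.

Lemma characterB chi x y : is_character D chi -> D x -> D y ->
  chi (x - y) = chi x - chi y.
Proof.
by move=> [chiL _ _ _] Dx Dy; rewrite addrC -scaleN1r chiL // mulN1r addrC.
Qed.

Lemma diagonalB x y : D x -> D y -> D (x - y).
Proof.
have [_ [_ DD DZ _ _]] := diagonal_subalgebra E P S.
by move=> Dx Dy; rewrite -scaleN1r; apply: DD => //; exact: DZ.
Qed.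

Lemma character_unique chi chi' : is_character D chi -> is_character D chi' ->
  (forall l (p : gpath E l), chi (P_path p) = chi' (P_path p)) ->
  forall x, D x -> chi x = chi' x.
Proof.
move=> hc hc' cc x Dx.
have [Dcl [D0 DD DZ _ _]] := diagonal_subalgebra E P S.
(* Membership in the diagonal is carried along because characters are linear and bounded only
   there. *)
suff sub : D `<=` [set y | D y /\ chi y = chi' y] by have [] := sub x Dx.
have [cL _ _ _] := hc; have [cL' _ _ _] := hc'.
have c0 (f : A -> C) : is_character D f -> f 0 = 0.
  by move=> hf; rewrite -(subrr (0 : A)) characterB // subrr.
have cD (f : A -> C) a b : is_character D f -> D a -> D b -> f (a + b) = f a + f b.
  by move=> [fL _ _ _] Da Db; rewrite -{1}[a]scale1r fL // mul1r.
apply: (@diagonal_ind _ _ _ _ _ _ _ hck hsinks 0).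
- apply/closed_normP => y h.
  have Dy : D y.
    by apply: ((closed_normP D).1 Dcl) => e /h [b [Db _] yb]; exists b.
  split => //; apply/eqP; rewrite -subr_eq0; apply/eqP.
  apply: (@norm_small_eq0 _ C^o) => e e0.
  have [b [Db bE] yb] := h (e / 4) (divr_gt0 e0 (ltr0n _ 4)).
  rewrite (_ : _ - _ = chi (y - b) - chi' (y - b)); last first.
    by rewrite !characterB // bE opprB addrA subrK.
  apply: le_trans (ler_normB _ _) _.
  have Dyb := diagonalB Dy Db.
  apply: le_trans (lerD (diagonal_character_bounded hc Dyb) (diagonal_character_bounded hc' Dyb)) _.
  by rewrite -mulrDl -natrD mulrC -ler_pdivlMr // ltW.
- by move=> a b /= [Da ha] [Db hb]; split; [exact: DD|rewrite !cD // ha hb].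
- move=> c a /= [Da ha]; split; first exact: DZ.
  by rewrite -[c *: a]addr0 cL // cL' // ha !c0.
- by split => //; rewrite !c0.
- by move=> l p _; split; [exact: P_path_diagonal|exact: cc].
Qed.

(** Some infinite path starts at [v], and its character takes the value 1 on [P v]. *)
Lemma vertex_projection_neq0 v : P v != 0.
Proof.
have [z zP z0] := ipath_exists hsinks v.
have [hchi hP] := path_characterP zP.
pose p : gpath E 0 := GPath (isT : walk E (v, [tuple]).1 (v, [tuple]).2).
have := hP _ p; rewrite is_prefix0 z0 eqxx => h.
apply/eqP => Pv0; move: h.
rewrite /Defs.P_path (S_path0 P S p) [psrc p]/= Pv0 cmul0x.
rewrite -(subrr (0 : A)) characterB //; try by case: (diagonal_subalgebra E P S) => _ [].
by move/eqP; rewrite subrr eq_sym oner_eq0.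
Qed.

Lemma span_of_character l (c : gpath E l -> C) p z : ipaths E z -> is_prefix p z ->
  phi z (span_of P S c) = c p.
Proof.
move=> zP pz; have [hchi hP] := path_characterP zP; have [cL _ _ _] := hchi.
have [_ [D0 DD DZ _ _]] := diagonal_subalgebra E P S.
have c0 : phi z 0 = 0 by rewrite -(subrr (0 : A)) characterB // subrr.
have sumE (r : seq (gpath E l)) : D (\sum_(q <- r) c q *: P_path q) /\
    phi z (\sum_(q <- r) c q *: P_path q) = \sum_(q <- r) c q * phi z (P_path q).
  elim: r => [|q r [Dr IH]]; first by rewrite !big_nil.
  have Dq : D (P_path q) by exact: P_path_diagonal.
  by rewrite !big_cons cL // IH; split => //; apply: DD => //; exact: DZ.
rewrite /span_of (sumE _).2 (bigD1 p) //= hP pz mulr1 big1 ?addr0 // => q qp.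
rewrite hP; case: (boolP (is_prefix q z)) => [qz|]; last by rewrite mulr0.
by rewrite (prefix_unique qz pz) eqxx in qp.
Qed.

(* Real coefficients in [0, 1] are averages of two conjugate unimodular
   numbers, hence the element is an average of two unitaries. *)
Lemma span_of_norm l (c : gpath E l -> C) : (forall p, `|c p| <= 1) -> `|span_of P S c| <= 1.
Proof.
move=> c1.
have adj_span (d : gpath E l -> C) : adj (span_of P S d) = span_of P S (fun p => (d p)^*).
  by rewrite /span_of adj_sum; apply: eq_bigr => p _; rewrite Defs.adjZ (adj_P_path P S p).
have unimod (d : gpath E l -> C) : (forall p, `|d p| = 1) -> `|span_of P S d| <= 1.
  move=> d1; rewrite -(@ler_pXn2r _ 2) ?nnegrE // expr1n -cstar_identity.
  rewrite adj_span (span_ofM hck hsinks) (_ : span_of _ _ _ = one).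
    apply: norm_projection_le1; apply: unit_of_projection hone.
    exact: is_cstar_subalgebraT.
  rewrite /span_of -(P_path_sum hck hsinks l); apply: eq_bigr => p _.
  by rewrite mulrC -normCK d1 expr1n scale1r.
(* The C*-identity replaces the coefficients by their squared moduli, which lie in the unit
   interval. *)
rewrite -(@ler_pXn2r _ 2) ?nnegrE // expr1n -cstar_identity.
rewrite adj_span (span_ofM hck hsinks).
pose a p := `|c p| ^+ 2; pose b p := sqrtC (1 - a p ^+ 2).
have a0 p : 0 <= a p by rewrite exprn_ge0.
have a1 p : a p ^+ 2 <= 1 by rewrite exprn_ile1 // exprn_ile1.
have b0 p : 0 <= b p by rewrite sqrtC_ge0 subr_ge0.
pose w (s : C) p := a p + s * b p.
have w1 (s : C) : s = 'i \/ s = - 'i -> forall p, `|w s p| = 1.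
  move=> hs p; apply/eqP; rewrite -(@eqrXn2 _ 2) // expr1n normCK.
  have cj (x y : C) : (x + s * y)^* = x^* + s^* * y^* by rewrite rmorphD rmorphM.
  rewrite /w cj (geC0_conj (a0 p)) (geC0_conj (b0 p)).
  have sq : s^* = - s by case: hs => ->; [rewrite conjCi|rewrite -conjCi conjCK conjCi opprK].
  have s2 : s * s = -1 by case: hs => ->; rewrite ?mulrNN -expr2 sqrCi.
  rewrite sq; have := sqrtCK (1 - a p ^+ 2); rewrite -/(b p) expr2 => b2.
  rewrite (_ : _ * _ = a p ^+ 2 - (s * s) * (b p * b p)); last by ring.
  by rewrite s2 b2; apply/eqP; ring.
have -> : span_of P S (fun p => (c p)^* * c p) =
    2^-1 *: (span_of P S (w 'i) + span_of P S (w (- 'i))).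
  rewrite /span_of -big_split scaler_sumr; apply: eq_bigr => p _ /=.
  rewrite -scalerDl scalerA /w mulNr mulrC -normCK -/(a p); congr (_ *: _).
  by field.
rewrite normrZ ger0_norm ?invr_ge0 // ler_pdivrMl // mulr1.
apply: le_trans (ler_normD _ _) _.
by rewrite -[2]/(1 + 1) lerD // unimod //; apply: w1; [left|right].
Qed.

(** Take a span within [M / 2] of [x]. Characters move by at most [M] and read off its coefficients,
    which are therefore at most [2 * M]; so is its norm, and the error fits into the remaining
    [M]. *)
Lemma norm_le_characters x (M : C) : D x -> 0 < M ->
  (forall z, ipaths E z -> `|phi z x| <= M) -> `|x| <= 3 * M.
Proof.
move=> Dx M0 xM; have M2 : 0 < M / 2 by rewrite divr_gt0.
have [l [_ [c xc]]] := diagonal_span_limit hck hsinks 0 Dx M2.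
have Ds : D (span_of P S c).
  apply: subalgebra_sum => [|p _]; first exact: diagonal_subalgebra.
  have [_ [_ _ DZ _ _]] := diagonal_subalgebra E P S.
  by apply: DZ; exact: P_path_diagonal.
have cM p : `|c p| <= 2 * M.
  have [z zP pz] := prefix_extends hsinks p.
  have [hchi _] := path_characterP zP.
  rewrite -(span_of_character c zP pz) -[span_of P S c](subKr x) characterB //; last exact: diagonalB.
  apply: le_trans (ler_normB _ _) _; rewrite mulr_natl mulr2n lerD ?xM //.
  apply: le_trans (diagonal_character_bounded hchi (diagonalB Dx Ds)) _.
  by rewrite mulrC -ler_pdivlMr // ltW.
have sM : `|span_of P S c| <= 2 * M.
  have M20 : 0 < 2 * M by rewrite mulr_gt0.
  have -> : span_of P S c = (2 * M) *: span_of P S (fun p => (2 * M)^-1 * c p).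
    rewrite /span_of scaler_sumr; apply: eq_bigr => p _.
    by rewrite scalerA mulrA divff ?mul1r // gt_eqF.
  rewrite normrZ (ger0_norm (ltW M20)); apply: ler_piMr; first exact: ltW.
  apply: span_of_norm => p.
  by rewrite normrM normfV (ger0_norm (ltW M20)) ler_pdivrMl // mulr1.
rewrite -(subrK (span_of P S c) x); apply: le_trans (ler_normD _ _) _.
rewrite (_ : 3 * M = M + 2 * M); last by ring.
apply: lerD => //; apply: le_trans (ltW xc) _.
by rewrite ler_pdivrMr // ler_pMr // ler1n.
Qed.

End PathCharacters.

(** * The induced map on paths *)

Section LambdaDiagonal.
Variables (R : realType) (V W : finType) (E : graph V W) (A : cstarType R).
Variables (P : V -> A) (S : W -> A).
Hypothesis hA : is_graph_cstar E P S.
Hypothesis hsinks : no_sinks E.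
Variables (k : nat) (t : {perm gpath E k.+1}).
Hypothesis ht : endpoint_fixing t.
Local Notation C := R[i].
Local Notation one := (cstar_one P).
Local Notation D := (Defs.diagonal E P S).
Local Notation S_path := (S_path P S).
Local Notation P_path := (P_path P S).
Local Notation U := (U_perm P S t).
Local Notation G := (perm_graph t).
Local Notation phi z := (path_character E P S z).
Local Notation lam := (lambda P S t).
Let hck := graph_cstar_ck hA.
Let hone := graph_cstar_unit hA hsinks.
Let hlam : star_hom lam. Proof. by case: (lambdaP hA hsinks ht). Qed.

(** [U] permutes the first [k.+1] letters and leaves the rest; preserving the range allows the rest
    to be appended again. *)
Lemma U_perm_S_long_path l (p : gpath E l) : (k < l)%N ->
  exists q : gpath E l, U ** S_path p = S_path q /\ prng q = prng p.
Proof.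
move=> kl; move: p; rewrite -(subnK kl); elim: (l - k.+1)%N => [|n IH] p.
  by exists (t p); rewrite (U_perm_S_path hck hsinks ht) ((endpoint_fixingP t).1 ht p).2.
have [q [qE qr]] := IH (path_front p).
have [|q' [q'f q'l]] := @rcons_path_exists _ _ E _ q (last_edge p); first by rewrite qr prng_front.
exists q'; split; last by rewrite !prng_last q'l.
by rewrite !(S_path_last hck hsinks) cmulA qE q'f q'l.
Qed.

Lemma conj_closed (a : A) : closed [set x | D (a ** x ** adj a)].
Proof.
apply: (@closed_lipschitz _ _ _ (fun x => a ** x ** adj a) (`|a| * `|adj a|)).
  move=> x y; rewrite -cmulBl -cmulBr; apply: le_trans (cnormM _ _) _.
  by rewrite mulrAC ler_wpM2r // cnormM.
exact: (diagonal_subalgebra E P S).1.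
Qed.

Lemma conj_diagonal (a : A) L :
  (forall l (p : gpath E l), (L <= l)%N -> D (a ** P_path p ** adj a)) ->
  forall x, D x -> D (a ** x ** adj a).
Proof.
have [_ [D0 DD DZ _ _]] := diagonal_subalgebra E P S.
move=> h x Dx; suff sub : D `<=` [set x | D (a ** x ** adj a)] by exact: sub.
apply: (@diagonal_ind _ _ _ _ _ _ _ hck hsinks L) => //.
- exact: conj_closed.
- by move=> y z /= hy hz; rewrite cmulDr cmulDl; exact: DD.
- by move=> c y /= hy; rewrite cscalerAr cscalerAl; exact: DZ.
- by rewrite /= cmulx0 cmul0x.
Qed.

Lemma U_conj_diagonal x : D x -> D (U ** x ** adj U).
Proof.
move: x; apply: (@conj_diagonal U k.+1) => l p kl.
have [q [qE _]] := U_perm_S_long_path p kl.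
have -> : U ** P_path p ** adj U = P_path q.
  by rewrite /Defs.P_path -qE adjM !cmulA.
exact: P_path_diagonal.
Qed.

Lemma S_conj_diagonal e x : D x -> D (S e ** x ** adj (S e)).
Proof.
move: x; apply: (@conj_diagonal (S e) 0) => l p _.
have [ep|ep] := eqVneq (rng E e) (psrc p).
  have [q [qf qt]] := cons_path_exists ep.
  have -> : S e ** P_path p ** adj (S e) = P_path q.
    by rewrite /Defs.P_path (S_path_first hck q) qf qt adjM !cmulA.
  exact: P_path_diagonal.
have -> : S e ** P_path p = 0.
  rewrite /Defs.P_path -(ckSP hck e) !cmulA -(cmulA (S e)) (P_S_path hck hsinks) (negbTE ep).
  by rewrite cmulx0 cmul0x.
rewrite cmul0x; by case: (diagonal_subalgebra E P S) => _ [].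
Qed.

(** On a cylinder projection, removing the first edge shows [lam (P_path p)] to be a conjugate by
    [U] and [S e] of the value at the tail, and both conjugations preserve the diagonal. *)
Lemma lambda_diagonal x : D x -> D (lam x).
Proof.
have [_ lM lA] := hlam; have [_ _ lS] := lambdaP hA hsinks ht.
have [Dcl [D0 DD DZ _ _]] := diagonal_subalgebra E P S.
move=> Dx; suff sub : D `<=` [set x | D (lam x)] by exact: sub.
apply: (@diagonal_ind _ _ _ _ _ _ _ hck hsinks 0).
- apply: (@closed_lipschitz _ _ _ lam 2) => // y z.
  exact: star_hom_lipschitz hone.
- by move=> y z /= hy hz; rewrite star_homD //; exact: DD.
- by move=> c y /= hy; rewrite star_homZ //; exact: DZ.
- by rewrite /= star_hom0.
- move=> l p _ /=; elim: l p => [|l IH] p.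
    rewrite /Defs.P_path (S_path0 P S p) (ckP hck _).1 (ckP hck _).2.
    by rewrite (lambda_vertex hA hsinks ht); exact: (vertex_diagonal hck).
  have -> : lam (P_path p) = U ** (S (first_edge p) ** lam (P_path (path_tail p))
      ** adj (S (first_edge p))) ** adj U.
    by rewrite /Defs.P_path (S_path_first hck p) adjM !lM !lA lS adjM !cmulA.
  apply: U_conj_diagonal; apply: S_conj_diagonal. exact: IH.
Qed.

(** Iterating [lambda_S] along [g] trades each first label inside [lam] for a second label outside;
    the [k] extra letters of [nu] are the initial vertex. *)
Lemma lambda_S_path_along g : ipaths G g -> forall n (nu : gpath E (n + k)),
  is_prefix nu (out_word t g) -> forall mu : gpath E n, is_prefix mu (in_word t g) ->
  lam (S_path mu) ** S_path (src G (g n)) = S_path nu.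
Proof.
move=> gP; have [_ lM lA] := hlam; have og := out_word_ipath ht gP.
elim=> [|n IH] nu nuP mu muP.
  have -> : nu = src G (g 0%N).
    have [nu' [ns ne _]] := out_word_prefix ht 0 gP.
    case/andP: nuP => /eqP nus /eqP nue.
    apply: gpath_eq; first by rewrite nus -(out_word_src ht gP).
    apply: val_inj; rewrite /= nue.
    apply: (@eq_from_nth _ (lab G (g 0%N)).2); first by rewrite size_mkseq size_tuple.
    by move=> i; rewrite size_mkseq => ik; rewrite nth_mkseq // /out_word ik.
  rewrite (S_path0 P S mu) (lambda_vertex hA hsinks ht) (P_S_path hck hsinks).
  move: muP; rewrite is_prefix0 => /eqP ->.
  by rewrite /in_word -psrc_src // eqxx.
have [/eqP mus /eqP mue] := andP muP.
have [/eqP nus /eqP nue] := andP nuP.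
have [mfe mle] : edges (path_front mu) = mkseq (in_word t g) n :> seq W /\
    last_edge mu = in_word t g n.
  by have := mue; rewrite edges_front_last mkseqS => /rcons_inj[].
have [nfe nle] : edges (path_front nu) = mkseq (out_word t g) (n + k) :> seq W /\
    last_edge nu = (lab G (g n)).2.
  have := nue; rewrite (@edges_front_last _ _ E (n + k) nu) mkseqS => /rcons_inj[e1 e2].
  by split; [exact: e1|rewrite [LHS]e2 /out_word ltnNge leq_addl addnK].
have IHn := IH (path_front nu) _ (path_front mu) _.
rewrite (S_path_last hck hsinks mu) (@S_path_last _ _ _ _ _ _ _ hck hsinks (n + k) nu).
rewrite nle lM -gP -IHn; first last.
- by rewrite /is_prefix psrc_front mus mfe !eqxx.
- by rewrite /is_prefix psrc_front nus nfe !eqxx.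
rewrite mle -!cmulA; congr (_ ** _).
by rewrite (lambda_S hA hsinks ht (g n)) (S_path_last hck hsinks).
Qed.

Lemma character_one chi : is_character D chi -> chi one = 1.
Proof.
move=> [cL cM _ [x Dx x0]]; have [D1 h] := diagonal_unit hA hsinks.
by apply: (mulIf x0); rewrite mul1r -cM // (h x Dx).1.
Qed.

(** Both sides are characters, so cylinder projections decide. For a prefix [mu] of the input word,
    [lam (P_path mu)] dominates the projection of a prefix of the output word, so its value is 1;
    any other path of that length gives an orthogonal projection, with value 0. *)
Lemma character_lambda g : ipaths G g -> forall d, D d ->
  phi (out_word t g) (lam d) = phi (in_word t g) d.
Proof.
move=> gP; have [lL lM lA] := hlam; have [_ l1 _] := lambdaP hA hsinks ht.
have og := out_word_ipath ht gP.
have ig : ipaths E (in_word t g) by exact: ipaths_fst.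
have [ho hoP] := path_characterP hA hsinks og.
have [hi hiP] := path_characterP hA hsinks ig.
have [oL oM oA _] := ho.
have [Dcl [D0 DD DZ DM DA]] := diagonal_subalgebra E P S.
have hl : is_character D (fun d => phi (out_word t g) (lam d)).
  split.
  - by move=> c x y Dx Dy; rewrite lL oL //; exact: lambda_diagonal.
  - by move=> x y Dx Dy; rewrite lM oM //; exact: lambda_diagonal.
  - by move=> x Dx; rewrite lA oA //; exact: lambda_diagonal.
  - exists one; first exact: (diagonal_unit hA hsinks).1.
    by rewrite l1 character_one // oner_eq0.
have PD l (q : gpath E l) : D (P_path q) by exact: P_path_diagonal.
have pref l (mu : gpath E l) : is_prefix mu (in_word t g) ->
    phi (out_word t g) (lam (P_path mu)) = 1.
  move=> mug; have [nu nug] := is_prefix_exists (l + k) og.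
  have along := lambda_S_path_along gP nug mug.
  have e : lam (P_path mu) ** P_path nu = P_path nu.
    rewrite {2}/Defs.P_path cmulA -along cmulA -lM (P_path_S_path hck hsinks) eqxx.
    by rewrite along.
  have := hoP _ nu; rewrite nug => h1.
  have := oM _ _ (lambda_diagonal (PD _ mu)) (PD _ nu).
  by rewrite e h1 mulr1 => <-.
apply: (character_unique hA hsinks hl hi) => l p.
rewrite hiP; case: (boolP (is_prefix p _)) => [/pref //|np].
have [p0 p0g] := is_prefix_exists l ig.
have [_ hM _ _] := hl.
have := hM _ _ (PD _ p) (PD _ p0).
rewrite (pref _ _ p0g) mulr1 => <-; rewrite (P_pathM hck hsinks).
case: eqP => [pp|_]; first by rewrite pp p0g in np.
rewrite star_hom0 // -(subrr (0 : A)) (characterB ho D0 D0); exact: subrr.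
Qed.

End LambdaDiagonal.

Section InducedMap.
Variables (R : realType) (V W : finType) (E : graph V W) (A : cstarType R).
Variables (P : V -> A) (S : W -> A).
Hypothesis hA : is_graph_cstar E P S.
Hypothesis hsinks : no_sinks E.
Variables (k : nat) (t : {perm gpath E k.+1}).
Hypothesis ht : endpoint_fixing t.
Hypothesis hsync : synchronizing_fst (perm_graph t).
Local Notation C := R[i].
Local Notation one := (cstar_one P).
Local Notation D := (Defs.diagonal E P S).
Local Notation P_path := (P_path P S).
Local Notation G := (perm_graph t).
Local Notation phi z := (path_character E P S z).
Local Notation lam := (lambda P S t).
Let hck := graph_cstar_ck hA.
Let hone := graph_cstar_unit hA hsinks.
Let hlam : star_hom lam. Proof. by case: (lambdaP hA hsinks ht). Qed.

Lemma in_word_surj z : ipaths E z -> exists2 g, ipaths G g & in_word t g = z.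
Proof. exact: lift_exists. Qed.

(** Every path is an input word, so each character value of [x] is a character value of [lam x], at
    most [2 * |lam x|]; the factor 3 of [norm_le_characters] makes 6. The bound yields closed
    range. *)
Lemma norm_le_lambda x : D x -> `|x| <= 6 * `|lam x|.
Proof.
move=> Dx.
have chi_le z : ipaths E z -> `|phi z x| <= 2 * `|lam x|.
  move=> /in_word_surj[g gP <-]; rewrite -(character_lambda hA hsinks ht gP Dx).
  have [ho _] := path_characterP hA hsinks (out_word_ipath ht gP).
  by apply: (diagonal_character_bounded hA hsinks ho); exact: lambda_diagonal.
(* [norm_le_characters] wants a positive bound, so the case [lam x = 0] runs through arbitrarily
   small ones. *)
have [l0|ln] := eqVneq (lam x) 0.
  rewrite l0 normr0 mulr0; suff -> : x = 0 by rewrite normr0.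
  apply: norm_small_eq0 => e e0; have e3 : 0 < e / 3 by rewrite divr_gt0.
  have -> : e = 3 * (e / 3) by rewrite mulrC divfK // pnatr_eq0.
  apply: (norm_le_characters hA hsinks Dx e3) => z /chi_le.
  by rewrite l0 normr0 mulr0 => h; apply: le_trans h _; exact: ltW.
have M0 : 0 < 2 * `|lam x| by rewrite mulr_gt0 // normr_gt0.
have := norm_le_characters hA hsinks Dx M0 chi_le.
by rewrite mulrA -natrM.
Qed.

Lemma diagonal_eq0 x : D x -> (forall z, ipaths E z -> phi z x = 0) -> x = 0.
Proof.
move=> Dx x0; apply: norm_small_eq0 => e e0; have e3 : 0 < e / 3 by rewrite divr_gt0.
have -> : e = 3 * (e / 3) by rewrite mulrC divfK // pnatr_eq0.
apply: (norm_le_characters hA hsinks Dx e3) => z /x0 ->.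
by rewrite normr0 ltW.
Qed.

(* The first letters of [out_word t g] depend on finitely many letters of
   [in_word t g], so a cylinder projection is the image of a finite sum of
   cylinder projections. *)
Lemma P_path_lambda_image n (nu : gpath E n) : exists2 d, D d & lam d = P_path nu.
Proof.
have [l hl] := out_word_determined hsync n.
pose c (p : gpath E l) : C :=
  `[< exists g, [/\ ipaths G g, is_prefix p (in_word t g) & is_prefix nu (out_word t g)] >]%:R.
have [Dcl [D0 DD DZ _ _]] := diagonal_subalgebra E P S.
have Dd : D (span_of P S c).
  apply: subalgebra_sum => [|p _]; first exact: diagonal_subalgebra.
  by apply: DZ; exact: P_path_diagonal.
have Dl := lambda_diagonal hA hsinks ht Dd.
have Dnu : D (P_path nu) by exact: P_path_diagonal.
exists (span_of P S c) => //; apply/eqP; rewrite -subr_eq0; apply/eqP.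
apply: diagonal_eq0; first exact: diagonalB.
(* Every path is an output word; there [character_lambda] moves the test to the input word, which
   reads off the coefficient [c p]. *)
move=> z zP; have [g gP gz] := out_word_surj ht zP; rewrite -gz in zP *.
have [ho hoP] := path_characterP hA hsinks zP.
rewrite (characterB ho) // (character_lambda hA hsinks ht gP Dd) hoP.
have ig : ipaths E (in_word t g) by exact: ipaths_fst.
have [p pg] := is_prefix_exists l ig.
rewrite (span_of_character hA hsinks c ig pg) /c; apply/eqP; rewrite subr_eq0; apply/eqP.
congr (_%:R); congr nat_of_bool; apply/asboolP/idP => [[g' [g'P pg' nug']]|nug]; last by exists g.
have [|hs hw] := hl g g' gP g'P.
  move=> j jl; case/andP: pg => _ /eqP pe; case/andP: pg' => _ /eqP pe'.
  have := congr1 (fun s => nth (in_word t g 0%N) s j) (etrans (esym pe) pe').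
  by rewrite !nth_mkseq.
case/andP: nug' => nus nue; rewrite /is_prefix hw nue andbT.
by rewrite -(out_word_src ht gP) hs (out_word_src ht g'P).
Qed.

(** Cylinder projections have preimages, and [norm_le_lambda] turns convergence of images into
    convergence of preimages, so limits have preimages too. *)
Lemma lambda_onto_diagonal d : D d -> exists2 d', D d' & lam d' = d.
Proof.
have [Dcl [D0 DD DZ _ _]] := diagonal_subalgebra E P S.
move=> Dd; suff sub : D `<=` [set d | exists2 d', D d' & lam d' = d] by exact: sub.
apply: (@diagonal_ind _ _ _ _ _ _ _ hck hsinks 0).
- apply/closed_normP => x h.
  (* With precision [2^-1 ^+ n / 12], the factor 6 bounds successive preimages by 3/4 of
     [2^-1 ^+ n], as [geometric_cvg] requires. *)
  have q0 n : 0 < 2^-1 ^+ n / 12 :> C by rewrite divr_gt0 // exprn_gt0 // invr_gt0.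
  have u_ex n : {u | D u /\ `|x - lam u| < 2^-1 ^+ n / 12}.
    by apply: cid; have [y [u Du <-] xu] := h _ (q0 n); exists u.
  pose u n := sval (u_ex n).
  have uD n : D (u n) by have [] := svalP (u_ex n).
  have ux n : `|x - lam (u n)| < 2^-1 ^+ n / 12 by have [] := svalP (u_ex n).
  have : cvg (u @ \oo).
    apply: geometric_cvg => n; apply: le_trans (norm_le_lambda (diagonalB (uD _) (uD _))) _.
    rewrite star_homB // (_ : _ - _ = (x - lam (u n)) - (x - lam (u n.+1))); last first.
      by rewrite opprB [RHS]addrC addrA subrK.
    apply: le_trans (_ : 6 * (2^-1 ^+ n / 12 + 2^-1 ^+ n.+1 / 12) <= _).
      rewrite ler_wpM2l //; apply: le_trans (ler_normB _ _) _.
      by rewrite lerD // ltW.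
    rewrite exprS (_ : 6 * _ = 2^-1 ^+ n * (3 / 4)); last by field.
    by rewrite ler_piMr ?ler_pdivrMr ?mul1r ?ler_nat // exprn_ge0 // invr_ge0.
  move=> /cvg_ex [y uy]; exists y.
    by apply: (closed_cvg _ Dcl _ _ uy); exact: nearW.
  apply/eqP; rewrite -subr_eq0; apply/eqP; apply: norm_small_eq0 => e e0.
  have e4 : 0 < e / 4 by rewrite divr_gt0.
  have e2 : 0 < e / 2 by rewrite divr_gt0.
  have [N [h1 h2]] : exists N, `|y - u N| < e / 4 /\ `|x - lam (u N)| < e / 2.
    have [N0 hN0] := half_pow_small e2.
    have close : \forall n \near \oo, `|y - u n| < e / 4 by exact: cvgr_dist_lt uy _ e4.
    have [N [N0N yN]] := filter_ex (filterI (nbhs_infty_ge N0) close).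
    exists N; split => //; apply: lt_trans (ux N) _; apply: le_lt_trans (hN0 N N0N).
    have half0 : 0 <= 2^-1 ^+ N :> C by rewrite exprn_ge0 // invr_ge0.
    rewrite mulrC ler_wpM2r //; apply: (@le_trans _ _ 1); last by rewrite ler1n.
    by rewrite invf_le1 ?ler1n.
  rewrite (_ : _ - _ = lam (y - u N) - (x - lam (u N))); last first.
    by rewrite star_homB // opprB addrA subrK.
  apply: le_trans (ler_normB _ _) _; rewrite [e]splitr lerD // ltW //.
  apply: le_lt_trans (star_hom_bounded hone hlam _) _.
  rewrite mulrC -ltr_pdivlMr // -mulrA -invfM -natrM //.
- move=> x y /= [a Da <-] [b Db <-]; exists (a + b); first exact: DD.
  by rewrite star_homD.
- by move=> c x /= [a Da <-]; exists (c *: a); [exact: DZ|rewrite star_homZ].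
- by exists 0 => //; rewrite star_hom0.
- by move=> l p _; exact: P_path_lambda_image.
Qed.

Lemma lambda_diag_invP d : D d ->
  D (lambda_diag_inv P S t d) /\ lam (lambda_diag_inv P S t d) = d.
Proof.
move=> Dd; rewrite /lambda_diag_inv; case: xgetP => [d' -> //|h].
by have [d' Dd' d'E] := lambda_onto_diagonal Dd; case: (h d').
Qed.

(** [out_word] meets the defining condition by [character_lambda], and any other solution has the
    same character on cylinder projections, hence the same prefixes. *)
Lemma phi_plusE g : ipaths G g -> phi_plus P S t (in_word t g) = out_word t g.
Proof.
move=> gP; have og := out_word_ipath ht gP.
have good : forall d, D d ->
    phi (out_word t g) d = phi (in_word t g) (lambda_diag_inv P S t d).
  move=> d Dd; have [Di iE] := lambda_diag_invP Dd.
  by rewrite -(character_lambda hA hsinks ht gP Di) iE.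
rewrite /phi_plus; case: xgetP => [y _ [yP yE]|/(_ (out_word t g)) []//].
have [hy hyP] := path_characterP hA hsinks yP.
have [ho hoP] := path_characterP hA hsinks og.
apply/funext => i; have [p pg] := is_prefix_exists i.+1 og.
have Dp : D (P_path p) by exact: P_path_diagonal.
have : phi y (P_path p) = 1 by rewrite yE // -good // hoP pg.
rewrite hyP; case: (boolP (is_prefix p y)) => [py _|_ /eqP]; last by rewrite eq_sym oner_eq0.
case/andP: py => _ /eqP py; case/andP: pg => _ /eqP pg.
have := congr1 (fun s => nth (y 0%N) s i) (etrans (esym py) pg).
by rewrite !nth_mkseq.
Qed.

Lemma phi_two_sidedE x : bipaths E x ->
  phi_two_sided P S t x = fun m => textile_map t x (m - k%:Z).
Proof.
move=> xP; have [y yP yx] := bilift_exists hsinks ht hsync xP.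
apply/funext => m.
(* Once [n] is at least [|m| + k], position [m + n] lies beyond the [k] letters of the initial
   vertex; its letter is the second label at [m - k]. *)
have ev : \forall n \near \oo,
    phi_plus P S t (fun j : nat => x (j%:Z - n%:Z)) (absz (m + n%:Z)) = (lab G (y (m - k%:Z))).2.
  near=> n.
  have mn : (0 <= m + n%:Z - k%:Z)%R.
    have : (absz m + k <= n)%N by near: n; exact: nbhs_infty_ge.
    by lia.
  have -> : (fun j : nat => x (j%:Z - n%:Z)) = in_word t (fun j => y (- n%:Z + j%:Z)).
    by apply/funext => j; rewrite /in_word -yx addrC.
  rewrite phi_plusE; last exact: bipaths_tail.
  rewrite /out_word ifF; last by lia.
  congr (lab G (y _)).2; lia.
have -> : textile_map t x = fun j => (lab G (y j)).2 by rewrite -yx textile_mapE.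
rewrite /phi_two_sided; case: xgetP => [e _ he|h].
  have [n [h1 h2]] := filter_ex (filterI ev he); exact: etrans (esym h2) h1.
by exfalso; apply: (h _); exact: ev.
Unshelve. all: by end_near.
Qed.

End InducedMap.

Theorem proposition5p10 (R : realType) (V W : finType) (E : graph V W)
    (hsinks : no_sinks E) (hsources : no_sources E)
    (hexits : cycles_have_exits E)
    (A : cstarType R) (P : V -> A) (S : W -> A)
    (hA : is_graph_cstar E P S)
    (ltV : rel V) (ltW : rel W)
    (hltV : strict_total_order ltV) (hltW : strict_total_order ltW)
    (hlt : compatible_orders E ltV ltW)
    (k : nat) (t t' : {perm gpath E k.+1})
    (ht : endpoint_fixing t) (ht' : endpoint_fixing t')
    (hsync : synchronizing_fst (perm_graph t))
    (hsync' : synchronizing_fst (perm_graph t')) :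
  let same_ordered_graph :=
    ordered_perm_graph ltV ltW t = ordered_perm_graph ltV ltW t' in
  [/\ same_ordered_graph <->
        label_shift (perm_graph t) = label_shift (perm_graph t'),
      same_ordered_graph <->
        (exists pi : {perm gpath E k},
           endpoint_fixing pi /\ t' = g_perm pi t),
      same_ordered_graph <->
        (exists pi : {perm gpath E k}, endpoint_fixing pi /\
           Ad (U_perm P S pi) \o lambda P S t = lambda P S t'),
      same_ordered_graph <->
        (forall x, bipaths E x -> textile_map t x = textile_map t' x)
    & same_ordered_graph <->
        (forall x, bipaths E x ->
           phi_two_sided P S t x = phi_two_sided P S t' x)].
Proof.
move=> same_ordered_graph; rewrite /same_ordered_graph {same_ordered_graph}.
have shift_iff := ordered_perm_graph_label_shift hltV hltW hsinks hsources ht ht' hsync hsync'.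
have textile_iff := label_shift_textile hsinks ht ht' hsync hsync'.
split.
- exact: shift_iff.
- exact: iff_trans shift_iff (label_shift_g_perm hsinks hsources ht ht' hsync hsync').
- apply: iff_trans shift_iff _; split=> [/label_shift_g_spec|[pi [hpi h]]].
    case=> // pi hpi tt'; exists pi; split => //.
    exact: (g_spec_Ad_lambda hA hsinks ht ht' hpi tt').
  apply: (g_spec_label_shift hpi).
  exact: (Ad_lambda_g_spec hA hsinks ht ht' hpi (vertex_projection_neq0 hA hsinks) h).
- exact: iff_trans shift_iff textile_iff.
- apply: iff_trans shift_iff (iff_trans textile_iff _).
  split=> h x xP; first by rewrite !phi_two_sidedE // h.
  (* Comparing at [m + k] undoes the common delay by [k]. *)
  apply/funext => m; have := congr1 (fun f => f (m + k%:Z)) (h x xP).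
  by rewrite !phi_two_sidedE // addrK.
Qed.
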